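(* Let $n\in\mathbb{N}$, let $\Gamma$ and $\Lambda$ be groups of type $\mathrm{FP}_{n+1}$, and let $\alpha$ and $\beta$ be standard actions of $\Gamma$ and $\Lambda$, respectively, that are weakly bounded orbit equivalent of index $c$. Then $$\mathrm{medim}^Z_n(\alpha)=c\cdot\mathrm{medim}^Z_n(\beta)\quad\text{if $Z$ is $\mathbb{Z}$ or a finite field},\qquad \mathrm{mevol}_n(\alpha)=c\cdot\mathrm{mevol}_n(\beta).$$
   Context: $\mathbb{N}$ contains $0$. $Z$ denotes $\mathbb{Z}$ with the usual absolute value or a finite field with the trivial norm ($|0|=0$, $|x|=1$ for $x\neq 0$). A group $\Gamma$ is of type $\mathrm{FP}_m$ if the trivial $\mathbb{Z}\Gamma$-module $\mathbb{Z}$ has a projective resolution that is finitely generated in degrees $\le m$. Weak bounded orbit equivalence. For a standard action $\alpha\colon\Gamma\curvearrowright(X,\mu)$, a measurable subset $A\subset X$ is $\alpha$-cofinite if there is a finite $F\subset\Gamma$ with $F\cdot A=X$ up to measure $0$. Standard actions $\alpha\colon\Gamma\curvearrowright(X,\mu)$ and $\beta\colon\Lambda\curvearrowright(Y,\nu)$ are weakly bounded orbit equivalent of index $c\in\mathbb{R}_{>0}$ if there exist an $\alpha$-cofinite set $A\subset X$, a $\beta$-cofinite set $B\subset Y$ and a measurable isomorphism $\varphi\colon A\to B$ such that: (a) $\frac1{\mu(A)}\varphi_*\mu|_A=\frac1{\nu(B)}\nu|_B$ and $c=\mu(A)/\nu(B)$; (b) for every $\gamma\in\Gamma$ there is a finite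 set $F(\gamma)\subset\Lambda$ such that $\varphi(\gamma\cdot x)\in F(\gamma)\cdot\varphi(x)$ for $\mu$-almost every $x\in A\cap\gamma^{-1}A$; (c) for every $\lambda\in\Lambda$ there is a finite set $E(\lambda)\subset\Gamma$ such that $\varphi^{-1}(\lambda\cdot y)\in E(\lambda)\cdot\varphi^{-1}(y)$ for $\nu$-almost every $y\in B\cap\lambda^{-1}B$. Standard actions. A standard $\Gamma$-action $\alpha\colon\Gamma\curvearrowright(X,\mu)$ is an essentially free, probability measure preserving action of a countable group on a standard Borel probability space. $L^\infty(\alpha,Z)=L^\infty(X,\mu,Z)$ is the ring of essentially bounded measurable functions $X\to Z$ modulo a.e. equality, with $(\gamma\cdot\lambda)(x)=\lambda(\gamma^{-1}x)$. The crossed product ring $R=L^\infty(\alpha,Z)*\Gamma$ is the free $L^\infty(\alpha,Z)$-module with basis $\Gamma$ (elements are finite sums of terms $(\lambda,\gamma)$) with multiplication $(\lambda,\gamma)(\lambda',\gamma')=(\lambda\cdot(\gamma\cdot\lambda'),\gamma\gamma')$. It contains $Z\Gamma$ via $\gamma\mapsto(1,\gamma)$ and acts on $L^\infty(\alpha,Z)$ by $(\lambda,\gamma)\cdot f=\lambda\cdot(\gamma\cdot f)$. Marked modules. For measurable $A\subset X$ put $\langle A\rangle=R\cdot(\chi_A,1)$. A marked projective $R$-module is an $R$-module $M$ with a finite family $(A_i)_{i\in I}$ of measurable subsets of $X$ and an isomorphism $M\cong\bigoplus_{i\in I}\langle A_i\rangle$ (suppressed from notation); $\dim_R(M)=\sum_i\mu(A_i)$.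 On $R$ let $|\sum_\gamma(\lambda_\gamma,\gamma)|_1=\sum_\gamma\int_X|\lambda_\gamma|\,d\mu$; elements of $M\subset\bigoplus_I R$ have norm $\|\sum_i\lambda_ie_i\|_1=\sum_i|\lambda_i|_1$. For an $R$-homomorphism $f\colon M\to N$ of marked projective modules, $\|f\|$ is the least $c$ with $\|f(z)\|_1\le c\|z\|_1$ for all $z$ (always finite). A marked direct summand of $\bigoplus_j\langle B_j\rangle$ is a submodule $\bigoplus_j\langle B_j'\rangle$ with $B_j'\subset B_j$ measurable. A finite marked decomposition of $M=\bigoplus_i\langle A_i\rangle$ is a finite family $(M_k)_k$ with $M_k=\bigoplus_i\langle A_{i,k}\rangle$ for measurable partitions $A_i=\bigsqcup_kA_{i,k}$. Logarithmic norm. $\log_+(t)=\max\{\log t,0\}$ (and $\log_+0=0$). $\mathrm{rk}(f)=\inf\{\dim N'\mid N'\subset N\text{ marked direct summand with }f(M)\subset N'\}$; $\mathrm{lognorm}'(f)=\min\{\dim(M)\log_+\|f\|,\ \mathrm{rk}(f)\log_+\|f\|\}$; $\mathrm{lognorm}(f)=\inf\sum_k\mathrm{lognorm}'(f|_{M_k}\colon M_k\to N)$, the infimum over all finite marked decompositions $(M_k)_k$ of $M$. Measured embeddings. A marked projective augmented $R$-chain complex $D_*\twoheadrightarrow L^\infty(\alpha,Z)$ is a chain complex $(D_k)_{k\ge0}$ of marked projective $R$-modules with a surjective $R$-homomorphism $\eta\colon D_0\to L^\infty(\alpha,Z)$, $\eta\circ\partial_1=0$. Fix a free $Z\Gamma$-resolution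 $C_*\twoheadrightarrow Z$ (the following is independent of the choice). An $\alpha$-embedding (up to degree $n$) is such a complex together with a $Z\Gamma$-chain map $C_*\to D_*$ up to degree $n+1$ extending the inclusion $Z\to L^\infty(\alpha,Z)$ as constant functions. $A_n(\alpha)$ is the class of all augmented complexes $D_*$ arising in this way. For $\Gamma$ of type $\mathrm{FP}_{n+1}$: $\mathrm{medim}^Z_n(\alpha)=\inf_{D_*\in A_n(\alpha)}\dim_R(D_n)$, and (for $Z=\mathbb{Z}$) $\mathrm{mevol}_n(\alpha)=\inf_{D_*\in A_n(\alpha)}\mathrm{lognorm}(\partial^D_{n+1})$. *)

(* Defs.v *)
From HB Require Import structures.
From mathcomp Require Import all_boot all_order all_algebra.
From mathcomp Require Import generic_quotient ring_quotient finmap.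
From mathcomp Require Import all_classical all_reals all_analysis.

Set Implicit Arguments.
Unset Strict Implicit.
Unset Printing Implicit Defensive.

Import Order.TTheory GRing.Theory Num.Theory.

Local Open Scope classical_set_scope.
Local Open Scope ring_scope.
Local Open Scope quotient_scope.

Record ringAction (G : groupType) (L : pzRingType) := RingAction {
  ract :> G -> {rmorphism L -> L};
  ract1 : forall x, ract 1%g x = x;
  ractM : forall g h x, ract (g * h)%g x = ract g (ract h x)
}.

Definition trivial_ringAction (G : groupType) (L : pzRingType) :
    ringAction G L :=
  @RingAction G L (fun=> idfun) (fun=> erefl) (fun _ _ _ => erefl).

Definition finsupp_pred (G : Type) (L : zmodType) : pred (G -> L) :=
  fun f => `[< finite_set [set g | f g != 0] >].

Lemma finsupp_zmod_closed (G : Type) (L : zmodType) :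
  zmod_closed (@finsupp_pred G L).
Proof.
split=> [|f g /asboolP ff /asboolP fg].
  by apply/asboolP; apply: (sub_finite_set _ (finite_set0 G)) => g /=; rewrite eqxx.
apply/asboolP.
apply: (@sub_finite_set _ _ ([set x | f x != 0] `|` [set x | g x != 0])).
  move=> x /= fgx; apply/orP; apply: contraNT fgx.
  by rewrite negb_or !negbK => /andP[/eqP fx /eqP gx]; rewrite !fctE fx gx subrr.
by rewrite finite_setU.
Qed.

HB.instance Definition _ (G : Type) (L : zmodType) :=
  GRing.isZmodClosed.Build (G -> L) (@finsupp_pred G L)
    (@finsupp_zmod_closed G L).

(* The crossed product ring L * G: a finitely supported function f stands for *)
(* the finite sum of the terms (f g, g).                                      *)
Record crossed (G : groupType) (L : pzRingType) (a : ringAction G L) :=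
  Crossed { crossed_val :> G -> L; _ : finsupp_pred crossed_val }.

Section CrossedProduct.
Variables (G : groupType) (L : pzRingType) (a : ringAction G L).

HB.instance Definition _ := [isSub for @crossed_val G L a].
HB.instance Definition _ := [Choice of crossed a by <:].
HB.instance Definition _ := [SubChoice_isSubZmodule of crossed a by <:].

Implicit Types (f g h : crossed a) (s t : G).

Lemma crossed_finite f : finite_set [set s | f s != 0].
Proof. by case: f => f /= /asboolP. Qed.

Lemma crossedD f g s : (f + g) s = f s + g s. Proof. by []. Qed.

Lemma crossed0 s : (0 : crossed a) s = 0. Proof. by []. Qed.

Lemma crossed_sum I (r : seq I) (F : I -> crossed a) s :
  (\sum_(i <- r) F i) s = \sum_(i <- r) F i s.
Proof. by elim/big_rec2: _ => // i x y _ <-. Qed.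

Definition single_fun (x : L) s : G -> L := fun t => if t == s then x else 0.

Lemma single_subproof x s : finsupp_pred (single_fun x s).
Proof.
apply/asboolP; apply: (sub_finite_set _ (finite_set1 s)) => t /=.
by rewrite /single_fun; case: (t =P s) => // _; rewrite eqxx.
Qed.

Definition single (x : L) (s : G) : crossed a := Crossed a (single_subproof x s).

Definition crossed_mul_fun f g : G -> L :=
  fun t => \sum_(s \in [set: G]) f s * a s (g (s^-1 * t)%g).

Lemma crossed_mul_funE (r : seq G) f g t : uniq r ->
  [set s | f s != 0] `<=` [set` r] ->
  crossed_mul_fun f g t = \sum_(s <- r) f s * a s (g (s^-1 * t)%g).
Proof.
move=> ur fr; rewrite /crossed_mul_fun.
rewrite -(fsbig_widen [set` r]) //; last first.
  move=> s /= [_ nrs]; have [->|/fr//] := eqVneq (f s) 0.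
  by rewrite mul0r.
by rewrite -fsbig_seq.
Qed.

Definition csupp f : seq G := fset_set [set s | f s != 0].

Lemma csupp_uniq f : uniq (csupp f). Proof. exact: fset_uniq. Qed.

Lemma csuppP f : [set s | f s != 0] `<=` [set` csupp f].
Proof.
move=> s fs; rewrite /csupp /= in_fset_set; last exact: crossed_finite.
by rewrite inE.
Qed.

Lemma crossed_mul_subproof f g : finsupp_pred (crossed_mul_fun f g).
Proof.
apply/asboolP.
pose r := [seq (s * t)%g | s <- csupp f, t <- csupp g].
apply: (@sub_finite_set _ _ [set` r]); last exact: finite_seq.
move=> t; rewrite /= (crossed_mul_funE _ _ (csupp_uniq f) (@csuppP f)).
apply: contraNT => tr; apply/eqP; rewrite big_seq big1// => s sf.
have [->|gst] := eqVneq (g (s^-1 * t)%g) 0; first by rewrite raddf0 mulr0.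
case/negP: tr; apply/allpairsP; exists (s, (s^-1 * t)%g); split=> //=.
  exact: csuppP.
by rewrite mulVKg.
Qed.

(* (x, s) (y, t) = (x * s y, s t), extended biadditively. *)
Definition crossed_mul f g : crossed a := Crossed a (crossed_mul_subproof f g).

Lemma crossed_mulDl : left_distributive crossed_mul +%R.
Proof.
move=> f g h; apply/val_inj/funext => t.
pose r := undup (csupp f ++ csupp g).
have fr : [set s | f s != 0] `<=` [set` r].
  by move=> s /csuppP/=; rewrite mem_undup mem_cat => ->.
have gr : [set s | g s != 0] `<=` [set` r].
  by move=> s /csuppP/=; rewrite mem_undup mem_cat => ->; rewrite orbT.
have fgr : [set s | (f + g) s != 0] `<=` [set` r].
  move=> s /= fgs; have [f0|/fr//] := eqVneq (f s) 0.
  by apply: gr => /=; apply: contraNneq fgs => g0; apply/eqP;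
    rewrite [LHS](crossedD f g s) f0 g0 addr0.
have ur : uniq r by exact: undup_uniq.
rewrite /= !fctE /= (crossed_mul_funE _ _ ur fgr) (crossed_mul_funE _ _ ur fr).
rewrite (crossed_mul_funE _ _ ur gr) -big_split /=.
by apply: eq_bigr => s _; rewrite mulrDl.
Qed.

Lemma crossed_mulDr : right_distributive crossed_mul +%R.
Proof.
move=> f g h; apply/val_inj/funext => t; rewrite /= !fctE /=.
rewrite !(crossed_mul_funE _ _ (csupp_uniq f) (@csuppP f)) -big_split /=.
by apply: eq_bigr => s _; rewrite -mulrDr -raddfD.
Qed.

Lemma single_mulE x s g t :
  crossed_mul (single x s) g t = x * a s (g (s^-1 * t)%g).
Proof.
rewrite /= (@crossed_mul_funE [:: s]) //.
  by rewrite big_seq1 /= /single_fun eqxx.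
by move=> u /=; rewrite /single_fun inE; case: (u =P s) => // _; rewrite eqxx.
Qed.

Lemma crossed_sumE f : f = \sum_(s <- csupp f) single (f s) s.
Proof.
apply/val_inj/funext => t; rewrite /= crossed_sum /= /single_fun.
have [ft0|ft] := eqVneq (f t) 0.
  by rewrite ft0 big1// => s _; case: (t =P s) => // <-.
rewrite (bigD1_seq t) ?csupp_uniq//=; last exact: csuppP.
by rewrite eqxx big1 ?addr0// => s /negPf; rewrite eq_sym => ->.
Qed.

Lemma crossed_mul_suml I (r : seq I) (F : I -> crossed a) g :
  crossed_mul (\sum_(i <- r) F i) g = \sum_(i <- r) crossed_mul (F i) g.
Proof.
elim: r => [|i r IHr]; last by rewrite !big_cons crossed_mulDl IHr.
rewrite !big_nil; apply: (addIr (crossed_mul 0 g)).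
by rewrite -crossed_mulDl !add0r.
Qed.

Lemma crossed_mulA : associative crossed_mul.
Proof.
move=> f g h; rewrite [f]crossed_sumE !crossed_mul_suml.
apply: eq_bigr => s _; apply/val_inj/funext => t; rewrite [LHS]single_mulE.
have E u : crossed_mul (single (f s) s) g (s * u)%g = f s * a s (g u).
  by rewrite single_mulE mulKg.
have E' u : crossed_mul_fun (single (f s) s) g (s * u)%g = f s * a s (g u).
  exact: E.
rewrite [RHS](@reindex_fsbigT _ _ _ _ _ (fun u => (s * u)%g)); last first.
  by exists (fun u => (s^-1 * u)%g) => u; rewrite (mulKg, mulVKg).
rewrite [crossed_mul g h _](crossed_mul_funE _ _ (csupp_uniq g) (@csuppP g)).
rewrite rmorph_sum mulr_sumr.
rewrite -[RHS](@fsbig_widen _ _ _ _ [set` csupp g]) //; last first.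
  move=> u /= [_ gu]; rewrite E'.
  have [->|/csuppP//] := eqVneq (g u) 0.
  by rewrite raddf0 mulr0 mul0r.
rewrite -fsbig_seq ?csupp_uniq//; apply: eq_bigr => u _.
by rewrite E rmorphM ractM mulrA invgM mulgA.
Qed.

Definition crossed_one : crossed a := single 1 1%g.

Lemma crossed_mul1 : left_id crossed_one crossed_mul.
Proof.
move=> f; apply/val_inj/funext => t.
by rewrite [LHS]single_mulE mul1r ract1 invg1 mul1g.
Qed.

Lemma crossed_mulr1 : right_id crossed_one crossed_mul.
Proof.
move=> f; apply/val_inj/funext => t.
rewrite [LHS]/= (crossed_mul_funE _ _ (csupp_uniq f) (@csuppP f)).
have E s : f s * a s (crossed_one (s^-1 * t)%g) = single (f s) s t.
  rewrite /= /single_fun -(mulVg s) (can_eq (mulVKg s)).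
  by case: (t =P s) => _; rewrite ?rmorph1 ?mulr1// raddf0 mulr0.
by under eq_bigr do rewrite E; rewrite -crossed_sum -crossed_sumE.
Qed.

HB.instance Definition _ := GRing.Zmodule_isPzRing.Build (crossed a)
  crossed_mulA crossed_mul1 crossed_mulr1 crossed_mulDl crossed_mulDr.

(* The canonical action of L * G on L: (x, s) . y = x * s y. *)
Definition crossed_act (f : crossed a) (y : L) : L :=
  \sum_(s \in [set: G]) f s * a s y.

End CrossedProduct.

(* Countability ensures that the functions X -> Z that are measurable for the *)
(* discrete sigma-algebra on Z form a ring.                                   *)
Record normedCoeff (R : realType) := NormedCoeff {
  coeff_ring :> comNzRingType;
  coeff_norm : coeff_ring -> R;
  coeff_countable : countable [set: coeff_ring];
  coeff_normN : forall x, coeff_norm (- x) = coeff_norm x;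
  coeff_normD : forall x y, coeff_norm (x + y) <= coeff_norm x + coeff_norm y;
  coeff_normM : forall x y, coeff_norm (x * y) = coeff_norm x * coeff_norm y;
  coeff_norm_ge0 : forall x, 0 <= coeff_norm x
}.

Section Coefficients.
Variable R : realType.

Lemma int_coeff_normN (x : int) : `|- x|%:~R = `|x|%:~R :> R.
Proof. by rewrite normrN. Qed.

Lemma int_coeff_normD (x y : int) : `|x + y|%:~R <= `|x|%:~R + `|y|%:~R :> R.
Proof. by rewrite -intrD ler_int ler_normD. Qed.

Lemma int_coeff_normM (x y : int) : `|x * y|%:~R = `|x|%:~R * `|y|%:~R :> R.
Proof. by rewrite normrM intrM. Qed.

Lemma int_coeff_norm_ge0 (x : int) : 0 <= `|x|%:~R :> R.
Proof. by rewrite ler0z. Qed.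

Definition int_coeff : normedCoeff R :=
  @NormedCoeff R int (fun x => `|x|%:~R) (@countableP int setT)
    int_coeff_normN int_coeff_normD int_coeff_normM int_coeff_norm_ge0.

Variable F : finFieldType.

Lemma fin_coeff_normN (x : F) : (- x != 0)%:R = (x != 0)%:R :> R.
Proof. by rewrite oppr_eq0. Qed.

Lemma fin_coeff_normD (x y : F) :
  (x + y != 0)%:R <= (x != 0)%:R + (y != 0)%:R :> R.
Proof.
have [->|_] := eqVneq x 0; first by rewrite !add0r.
by rewrite (@le_trans _ _ 1) ?lern1 ?leq_b1// lerDl ler0n.
Qed.

Lemma fin_coeff_normM (x y : F) :
  (x * y != 0)%:R = (x != 0)%:R * (y != 0)%:R :> R.
Proof. by rewrite mulf_eq0 negb_or -natrM mulnb. Qed.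

Lemma fin_coeff_norm_ge0 (x : F) : 0 <= (x != 0)%:R :> R.
Proof. exact: ler0n. Qed.

Definition finField_coeff : normedCoeff R :=
  @NormedCoeff R F (fun x => (x != 0)%:R) (@countableP F setT)
    fin_coeff_normN fin_coeff_normD fin_coeff_normM fin_coeff_norm_ge0.

End Coefficients.

Section Linfty.
Variables (R : realType) (d : measure_display) (X : measurableType d).
Variables (mu : probability X R) (Z : normedCoeff R).

(* Z carries the discrete sigma-algebra. *)
Definition bmf_pred : pred (X -> Z) := fun f =>
  `[< (forall S : set Z, measurable (f @^-1` S)) /\
      exists C : R, {ae mu, forall x, coeff_norm (f x) <= C} >].

Lemma bmf_op2 (op : Z -> Z -> Z) (f g : X -> Z) :
  (forall S : set Z, measurable (f @^-1` S)) ->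
  (forall S : set Z, measurable (g @^-1` S)) ->
  forall S : set Z, measurable ((fun x => op (f x) (g x)) @^-1` S).
Proof.
move=> mf mg S; pose T := [set p : Z * Z | S (op p.1 p.2)].
have -> : (fun x => op (f x) (g x)) @^-1` S =
    \bigcup_p (f @^-1` [set p.1] `&` g @^-1` [set p.2] `&` [set _ | T p]).
  apply/seteqP; split=> [x Sx|x [[u v] _ [[/= <- <-] //]]].
  by exists (f x, g x).
apply: countable_bigcupT_measurable => [|p].
  by rewrite -setXTT; apply: countableX; exact: coeff_countable.
apply: measurableI; first exact: measurableI.
have [Tp|Tp] := pselect (T p).
  by rewrite (_ : [set _ | _] = setT)//; apply/seteqP; split.
by rewrite (_ : [set _ | _] = set0)//; apply/seteqP; split.
Qed.

Lemma bmf_cst (z : Z) : bmf_pred (fun=> z).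
Proof.
apply/asboolP; split=> [S|]; last first.
  by exists (coeff_norm z); exact: nearW.
by rewrite preimage_cst; case: ifP.
Qed.

Lemma bmf_subring_closed : subring_closed bmf_pred.
Proof.
split=> [|f g /asboolP[mf [A fA]] /asboolP[mg [B gB]]
         |f g /asboolP[mf [A fA]] /asboolP[mg [B gB]]].
- exact: bmf_cst.
- apply/asboolP; split; first exact: (@bmf_op2 (fun u v => u - v)).
  exists (A + B); near=> x; rewrite !fctE.
  rewrite (le_trans (coeff_normD _ _))// coeff_normN lerD//.
    by near: x.
  by near: x.
- apply/asboolP; split; first exact: (@bmf_op2 (fun u v => u * v)).
  exists (A * B); near=> x; rewrite !fctE coeff_normM.
  by rewrite ler_pM ?coeff_norm_ge0//; near: x.
Unshelve. all: by end_near. Qed.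

HB.instance Definition _ :=
  GRing.isSubringClosed.Build (X -> Z) bmf_pred bmf_subring_closed.

Record bmf := Bmf { bmf_val :> X -> Z; _ : bmf_pred bmf_val }.

HB.instance Definition _ := [isSub for bmf_val].
HB.instance Definition _ := [Choice of bmf by <:].
HB.instance Definition _ := 
  GRing.SubChoice_isSubComPzRing.Build (X -> Z) bmf_pred bmf bmf_subring_closed.

Lemma ae_inhabited (P : X -> Prop) : {ae mu, forall x, P x} -> exists x, P x.
Proof.
move=> aeP; apply: contrapT => /forallNP nP.
have : mu.-negligible [set: X].
  by apply: negligibleS aeP => x _ /=; exact: nP.
move=> /(negligibleP mu measurableT).
by rewrite [LHS]probability_setT => /eqP; rewrite onee_eq0.
Qed.

Lemma bmf_one_neq0 : (1 : bmf) != 0.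
Proof.
have [x _] : exists x : X, True by apply: ae_inhabited; exact: nearW.
apply/eqP => /(congr1 (fun f : bmf => f x)) /eqP.
by apply/negP; exact: (@oner_neq0 Z).
Qed.

HB.instance Definition _ := GRing.PzSemiRing_isNonZero.Build bmf bmf_one_neq0.

Definition ae0 : pred bmf := fun f => `[< {ae mu, forall x, f x = 0} >].

Lemma ae0_idealr_closed : idealr_closed ae0.
Proof.
split=> [||f g h /asboolP g0 /asboolP h0].
- by apply/asboolP; exact: nearW.
- apply/negP => /asboolP/ae_inhabited[x /eqP].
  by apply/negP; exact: (@oner_neq0 Z).
- apply/asboolP; near=> x.
  rewrite [LHS](_ : _ = f x * g x + h x)//.
  have -> : g x = 0 by near: x.
  by rewrite mulr0 add0r; near: x.
Unshelve. all: by end_near. Qed.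

HB.instance Definition _ := isIdealr.Build bmf ae0 ae0_idealr_closed.

Definition Linf : Type := {ideal_quot (ae0 : idealr bmf)}.

HB.instance Definition _ := GRing.ComNzRing.on Linf.
HB.instance Definition _ := EqQuotient.on Linf.

Definition Linf_class (f : bmf) : Linf := \pi_Linf f.

Definition Linf_cst (z : Z) : Linf := Linf_class (Bmf (bmf_cst z)).

Definition chi_fun (A : set X) : X -> Z := fun x => if x \in A then 1 else 0.

Lemma bmf_chi (A : set X) : measurable A -> bmf_pred (chi_fun A).
Proof.
move=> mA; apply/asboolP; split=> [S|]; last first.
  exists (Num.max (coeff_norm (1 : Z)) (coeff_norm (0 : Z))).
  by apply: nearW => x; rewrite /chi_fun le_max; case: ifP; rewrite lexx ?orbT.
have -> : chi_fun A @^-1` S = (A `&` [set _ | S 1]) `|` (~` A `&` [set _ | S 0]).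
  apply/seteqP; split=> x; rewrite /preimage /chi_fun /=.
    by case: ifPn; rewrite ?inE ?notin_setE; [left|right].
  by case=> -[Ax Sx]; [rewrite mem_set|rewrite memNset].
have mP (P : Prop) : measurable [set _ : X | P].
  have [p|np] := pselect P.
    by rewrite (_ : [set _ | _] = setT)//; apply/seteqP; split.
  by rewrite (_ : [set _ | _] = set0)//; apply/seteqP; split.
by apply: measurableU; apply: measurableI => //; exact: measurableC.
Qed.

(* [insubd] returns the default value 0 only when A is not measurable (see    *)
(* [bmf_chi]), a case in which [Linf_chi A] is never used.                    *)
Definition Linf_chi (A : set X) : Linf :=
  Linf_class (insubd (0 : bmf) (chi_fun A)).

Definition Linf_norm1 (u : Linf) : R :=
  fine (\int[mu]_x (coeff_norm (repr u x))%:E).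

End Linfty.

Section StandardActions.
Variable R : realType.

(* The sigma-algebra of X is the Borel sigma-algebra of a Polish space P; a   *)
(* Hausdorff pseudometric space is metric.                                    *)
Definition standard_borel (d : measure_display) (X : measurableType d) : Prop :=
  exists P : completePseudoMetricType R,
    [/\ hausdorff_space P, @second_countable P &
      exists f : X -> P, bijective f /\
        forall A : set P, <<s @open P >> A <-> measurable (f @^-1` A)].

Record standardAction (d : measure_display) (X : measurableType d)
    (mu : probability X R) (G : groupType) := StandardAction {
  sact :> G -> X -> X;
  sact1 : forall x, sact 1%g x = x;
  sactM : forall g h x, sact (g * h)%g x = sact g (sact h x);
  sact_measurable : forall g, measurable_fun [set: X] (sact g);
  sact_preserving : forall g A, measurable A -> mu (sact g @^-1` A) = mu A;
  sact_free : {ae mu, forall x, forall g, sact g x = x -> g = 1%g};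
  sact_countable : countable [set: G];
  sact_borel : standard_borel X
}.

End StandardActions.

Section LinfAction.
Variables (R : realType) (d : measure_display) (X : measurableType d).
Variables (mu : probability X R) (G : groupType) (a : standardAction mu G).
Variable Z : normedCoeff R.

Implicit Types (f g : bmf mu Z) (s t : G) (u v : Linf mu Z).

Lemma Linf_classP f g :
  Linf_class f = Linf_class g <-> {ae mu, forall x, f x = g x}.
Proof.
have E : (f - g \in (@ae0 R d X mu Z : idealr _)) = (Linf_class f == Linf_class g).
  exact: Quotient.idealrBE.
split=> [/eqP|fg].
  rewrite -E => /asboolP; apply: filterS => x /eqP.
  by rewrite subr_eq0 => /eqP.
apply/eqP; rewrite -E; apply/asboolP; apply: filterS fg => x fgx.
by apply/eqP; rewrite subr_eq0; apply/eqP.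
Qed.

Lemma reprK_Linf u : Linf_class (repr u) = u. Proof. exact: reprK. Qed.

Lemma ae_sact s (P : X -> Prop) :
  {ae mu, forall x, P x} -> {ae mu, forall x, P (a s x)}.
Proof.
move=> [N [mN N0 PN]]; exists (a s @^-1` N); split.
- by rewrite -[_ @^-1` _]setTI; exact: sact_measurable.
- by rewrite sact_preserving.
- by move=> x; exact: PN.
Qed.

Lemma bmf_shift_subproof s f : bmf_pred mu (fun x => f (a s^-1%g x)).
Proof.
case: f => f /= /asboolP[mf [C fC]]; apply/asboolP; split=> [S|].
  by have := sact_measurable a s^-1%g measurableT (mf S); rewrite setTI.
by exists C; exact: (ae_sact s^-1%g fC).
Qed.

Definition bmf_shift s f : bmf mu Z := Bmf (bmf_shift_subproof s f).

Definition Linf_shift s u : Linf mu Z := Linf_class (bmf_shift s (repr u)).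

Lemma Linf_shiftE s f : Linf_shift s (Linf_class f) = Linf_class (bmf_shift s f).
Proof.
have /Linf_classP fE : Linf_class (repr (Linf_class f)) = Linf_class f.
  by rewrite reprK_Linf.
by apply/Linf_classP; exact: (ae_sact s^-1%g fE).
Qed.

Lemma Linf_shift_zmod s : zmod_morphism (Linf_shift s).
Proof.
move=> u v; rewrite -[u]reprK_Linf -[v]reprK_Linf.
by rewrite -rmorphB !Linf_shiftE -rmorphB; congr Linf_class; exact: val_inj.
Qed.

Lemma Linf_shift_monoid s : monoid_morphism (Linf_shift s).
Proof.
split=> [|u v].
  rewrite -[1](rmorph1 (\pi_(Linf mu Z))) [LHS]Linf_shiftE.
  by congr Linf_class; exact: val_inj.
rewrite -[u]reprK_Linf -[v]reprK_Linf.
by rewrite -rmorphM !Linf_shiftE -rmorphM; congr Linf_class; exact: val_inj.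
Qed.

HB.instance Definition _ s := GRing.isZmodMorphism.Build
  (Linf mu Z) (Linf mu Z) (Linf_shift s) (Linf_shift_zmod s).
HB.instance Definition _ s := GRing.isMonoidMorphism.Build
  (Linf mu Z) (Linf mu Z) (Linf_shift s) (Linf_shift_monoid s).

Lemma Linf_shift1 u : Linf_shift 1%g u = u.
Proof.
rewrite -[RHS]reprK_Linf; congr Linf_class; apply/val_inj/funext => x /=.
by rewrite invg1 sact1.
Qed.

Lemma Linf_shiftM s t u : Linf_shift (s * t)%g u = Linf_shift s (Linf_shift t u).
Proof.
rewrite -[u]reprK_Linf !Linf_shiftE; congr Linf_class.
by apply/val_inj/funext => x /=; rewrite invgM sactM.
Qed.

Definition Linf_action : ringAction G (Linf mu Z) :=
  @RingAction G (Linf mu Z) (fun s => Linf_shift s : {rmorphism _ -> _})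
    Linf_shift1 Linf_shiftM.

End LinfAction.

Section Modules.
Variable S : pzRingType.

Definition projective_module (P : lmodType S) : Prop :=
  forall (M N : lmodType S) (p : {linear M -> N}) (f : {linear P -> N}),
    (forall y, exists x, p x = y) ->
    exists g : {linear P -> M}, forall x, p (g x) = f x.

Definition finitely_generated (M : lmodType S) : Prop :=
  exists (k : nat) (v : 'I_k -> M),
    forall x, exists c : 'I_k -> S, x = \sum_i c i *: v i.

Definition free_module (M : lmodType S) : Prop :=
  exists (I : choiceType) (b : I -> M),
    (forall x, exists c : I -> S, finite_set [set i | c i != 0] /\
       x = \sum_(i \in [set: I]) c i *: b i) /\
    (forall c : I -> S, finite_set [set i | c i != 0] ->
       \sum_(i \in [set: I]) c i *: b i = 0 -> forall i, c i = 0).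

End Modules.

(* Chain complexes of left L * G-modules augmented over L, where L * G acts   *)
(* on L by [crossed_act]; [ac_bd k] is the boundary in degree k + 1.          *)
Record augComplex (G : groupType) (L : pzRingType) (a : ringAction G L) :=
  AugComplex {
  ac_mod : nat -> lmodType (crossed a);
  ac_bd : forall k, {linear ac_mod k.+1 -> ac_mod k};
  ac_aug : ac_mod 0%N -> L;
  ac_bd_bd : forall k x, ac_bd k (ac_bd k.+1 x) = 0;
  ac_augD : forall x y, ac_aug (x + y) = ac_aug x + ac_aug y;
  ac_augZ : forall r x, ac_aug (r *: x) = crossed_act r (ac_aug x);
  ac_aug_surj : forall y, exists x, ac_aug x = y;
  ac_aug_bd : forall x, ac_aug (ac_bd 0%N x) = 0
}.

Arguments ac_mod {G L a} _ _.
Arguments ac_bd {G L a} _ _.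
Arguments ac_aug {G L a} _ _.

Definition is_resolution (G : groupType) (L : pzRingType) (a : ringAction G L)
    (C : augComplex a) : Prop :=
  (forall x, ac_aug C x = 0 -> exists y, ac_bd C 0%N y = x) /\
  (forall k x, ac_bd C k x = 0 -> exists y, ac_bd C k.+1 y = x).

Definition is_free_resolution (G : groupType) (L : pzRingType)
    (a : ringAction G L) (C : augComplex a) : Prop :=
  is_resolution C /\ forall k, free_module (ac_mod C k).

(* [crossed (trivial_ringAction G Z)] is the group ring Z G, and              *)
(* [crossed_act] is then the trivial Z G-module structure on Z.               *)
Definition type_FP (G : groupType) (m : nat) : Prop :=
  exists P : augComplex (trivial_ringAction G int),
    [/\ is_resolution P, forall k, projective_module (ac_mod P k) &
      forall k, (k <= m)%N -> finitely_generated (ac_mod P k)].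

Section MarkedModules.
Variables (R : realType) (d : measure_display) (X : measurableType d).
Variables (mu : probability X R) (G : groupType) (a : standardAction mu G).
Variable Z : normedCoeff R.

Local Notation RR := (crossed (Linf_action a Z)).

Lemma const_crossed_subproof (r : crossed (trivial_ringAction G Z)) :
  finsupp_pred (fun s => Linf_cst mu (r s)).
Proof.
apply/asboolP; apply: (sub_finite_set _ (crossed_finite r)) => s /=.
apply: contraNneq => ->; apply/eqP.
rewrite -[RHS](rmorph0 (\pi_(Linf mu Z))); congr (\pi_(Linf mu Z) _).
exact: val_inj.
Qed.

(* The inclusion of Z G into the crossed product ring. *)
Definition const_crossed (r : crossed (trivial_ringAction G Z)) : RR :=
  Crossed (Linf_action a Z) (const_crossed_subproof r).

Definition crossed_norm1 (r : RR) : R := \sum_(s \in [set: G]) Linf_norm1 (r s).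

Definition cyclic_ideal (A : set X) : set RR :=
  [set z | exists r : RR, z = r * single _ (Linf_chi mu Z A) 1%g].

Record marking (M : lmodType RR) := Marking {
  mk_idx : finType;
  mk_set : mk_idx -> set X;
  mk_measurable : forall i, measurable (mk_set i);
  mk_iso : {linear M -> {ffun mk_idx -> RR^o}};
  mk_inj : injective mk_iso;
  mk_range : forall z : {ffun mk_idx -> RR^o},
    (exists x, mk_iso x = z) <-> forall i, cyclic_ideal (mk_set i) (z i)
}.

Arguments mk_idx {M} _.
Arguments mk_set {M} _ _.
Arguments mk_iso {M} _.

Section Marking.
Variables (M : lmodType RR) (m : marking M).

(* A family B below [mk_set m] encodes the marked direct summand with these   *)
(* sets, whose elements form [mk_summand B] and whose dimension is [mk_dim B].*)
Definition mk_sub (B : mk_idx m -> set X) : Prop :=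
  forall i, measurable (B i) /\ B i `<=` mk_set m i.

Definition mk_summand (B : mk_idx m -> set X) : set M :=
  [set x | forall i, cyclic_ideal (B i) (mk_iso m x i)].

Definition mk_dim (B : mk_idx m -> set X) : R := \sum_i fine (mu (B i)).

Definition mk_norm1 (x : M) : R := \sum_i crossed_norm1 (mk_iso m x i).

Definition marked_decomposition (K : finType) (B : K -> mk_idx m -> set X) :
    Prop :=
  forall i, [/\ forall k, measurable (B k i),
    trivIset [set: K] (fun k => B k i) &
    \bigcup_(k in [set: K]) B k i = mk_set m i].

End Marking.

Definition log_plus (t : R) : R := Num.max (ln t) 0.

Section LogNorm.
Variables (M N : lmodType RR) (m : marking M) (p : marking N).
Variable f : {linear M -> N}.

(* The operator norm, rank and lognorm' of the restriction of f to the marked *)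
(* direct summand given by A; c >= 0 only matters on the zero module.         *)
Definition res_opnorm (A : mk_idx m -> set X) : R :=
  inf [set c : R | 0 <= c /\
    forall x, mk_summand A x -> mk_norm1 p (f x) <= c * mk_norm1 m x].

Definition res_rk (A : mk_idx m -> set X) : R :=
  inf [set t : R | exists B : mk_idx p -> set X,
    [/\ mk_sub B, f @` mk_summand A `<=` mk_summand B & t = mk_dim B]].

Definition res_lognorm' (A : mk_idx m -> set X) : R :=
  Num.min (mk_dim A * log_plus (res_opnorm A))
          (res_rk A * log_plus (res_opnorm A)).

Definition lognorm : R :=
  inf [set t : R | exists (K : finType) (A : K -> mk_idx m -> set X),
    marked_decomposition A /\ t = \sum_k res_lognorm' (A k)].

End LogNorm.

Record markedComplex := MarkedComplex {
  mc_complex :> augComplex (Linf_action a Z);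
  mc_marking : forall k, marking (ac_mod mc_complex k)
}.

(* A Z G-chain map C -> D in degrees <= n + 1 extending the inclusion of      *)
(* constant functions; [phi k] is irrelevant for k > n + 1.                   *)
Definition is_embedding (n : nat) (C : augComplex (trivial_ringAction G Z))
    (D : augComplex (Linf_action a Z))
    (phi : forall k, ac_mod C k -> ac_mod D k) : Prop :=
  [/\ forall k, (k <= n.+1)%N -> forall x y, phi k (x + y) = phi k x + phi k y,
      forall k, (k <= n.+1)%N -> forall r x,
        phi k (r *: x) = const_crossed r *: phi k x,
      forall k, (k <= n)%N -> forall x,
        phi k (ac_bd C k x) = ac_bd D k (phi k.+1 x) &
      forall x, ac_aug D (phi 0%N x) = Linf_cst mu (ac_aug C x)].

Definition embedding_class (n : nat) (C : augComplex (trivial_ringAction G Z))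
    (D : markedComplex) : Prop :=
  exists phi, @is_embedding n C D phi.

(* C is the fixed free resolution of Z over Z G. The infima are taken in the  *)
(* extended reals, so the infimum of an empty class is +oo.                   *)
Definition medim (n : nat) (C : augComplex (trivial_ringAction G Z)) : \bar R :=
  ereal_inf [set t | exists D : markedComplex, embedding_class n C D /\
    t = (mk_dim (mk_set (mc_marking D n)))%:E].

Definition melognorm (n : nat) (C : augComplex (trivial_ringAction G Z)) :
    \bar R :=
  ereal_inf [set t | exists D : markedComplex, embedding_class n C D /\
    t = (lognorm (mc_marking D n.+1) (mc_marking D n) (ac_bd D n))%:E].

End MarkedModules.

Definition mevol (R : realType) (d : measure_display) (X : measurableType d)
    (mu : probability X R) (G : groupType) (a : standardAction mu G) (n : nat)
    (C : augComplex (trivial_ringAction G int)) : \bar R :=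
  @melognorm R d X mu G a (int_coeff R) n C.

Section WeakBoundedOE.
Variable R : realType.

Definition cofinite (d : measure_display) (X : measurableType d)
    (mu : probability X R) (G : groupType) (a : standardAction mu G)
    (A : set X) : Prop :=
  measurable A /\ exists F : set G,
    finite_set F /\ mu.-negligible (~` \bigcup_(g in F) (a g @` A)).

Definition weakly_bounded_OE (d d' : measure_display) (X : measurableType d)
    (Y : measurableType d') (mu : probability X R) (nu : probability Y R)
    (G L : groupType) (a : standardAction mu G) (b : standardAction nu L)
    (c : R) : Prop :=
  exists (A : set X) (B : set Y) (phi : X -> Y) (psi : Y -> X),
  [/\ [/\ 0 < c, cofinite a A & cofinite b B],
    (* phi restricts to a measurable isomorphism A -> B with inverse psi *)
    [/\ measurable_fun A phi, measurable_fun B psi,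
        forall x, A x -> B (phi x) /\ psi (phi x) = x &
        forall y, B y -> A (psi y) /\ phi (psi y) = y],
    (forall S, measurable S ->
       fine (mu (A `&` phi @^-1` S)) / fine (mu A) =
       fine (nu (B `&` S)) / fine (nu B)) /\
    c = fine (mu A) / fine (nu B),
    forall g, exists F : set L, finite_set F /\
      {ae mu, forall x, A x -> A (a g x) ->
        exists2 l, F l & phi (a g x) = b l (phi x)} &
    forall l, exists E : set G, finite_set E /\
      {ae nu, forall y, B y -> B (b l y) ->
        exists2 g, E g & psi (b l y) = a g (psi y)}].

End WeakBoundedOE.

Inductive int_or_finField (R : realType) : normedCoeff R -> Prop :=
| is_int_coeff : int_or_finField (int_coeff R)
| is_finField_coeff (F : finFieldType) : int_or_finField (finField_coeff R F).

(* Main.v *)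
Require Import Defs.
From HB Require Import structures.
From mathcomp Require Import all_boot all_order all_algebra.
From mathcomp Require Import generic_quotient ring_quotient finmap.
From mathcomp Require Import all_classical all_reals all_analysis.
From mathcomp Require Import measurable_realfun zify.

(* The orbit equivalence identifies the corners chi_A R_alpha chi_A and        *)
(* chi_B R_beta chi_B of the two crossed product rings; it carries indicator  *)
(* functions to indicator functions and scales measures and 1-norms by c.     *)
(* Cofiniteness makes both corners full, so there is a Morita functor F from  *)
(* R_beta-modules to R_alpha-modules. F is exact, sends L^oo(beta) to         *)
(* L^oo(alpha), and carries marked modules to marked modules in such a way    *)
(* that dimensions are multiplied by c while operator norms do not increase.  *)
(* If D is a beta-embedding, then E -> D factors through the step functions   *)
(* L^oo(beta, Z) (x) E, which resolve L^oo(beta) because a step function is   *)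
(* lifted along a boundary map value by value. Applying F, the free           *)
(* Z G-resolution C lifts to a chain map C -> F(L^oo(beta, Z) (x) E) -> F(D). *)
(* So F(D) is an alpha-embedding, which gives one inequality; the other one   *)
(* follows from the symmetry of the hypothesis.                               *)

Set Implicit Arguments.
Unset Strict Implicit.
Unset Printing Implicit Defensive.

Import Order.TTheory GRing.Theory Num.Theory.

Local Open Scope classical_set_scope.
Local Open Scope ring_scope.
Local Open Scope quotient_scope.

(** * Crossed products *)

(** By essential freeness, the two action groupoids restricted to A and B are identified by phi, and
    conditions (b) and (c) say that each group element meets only finitely many elements of the
    other group. The identification therefore acts on finite sums: [theta] sends a term (u, g) to a
    finite sum over the matching h. It is multiplicative once the idempotent e = chi_A is inserted
    ([thetaM]), and following it by its mirror image compresses to the corner of e ([thetaK]). The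
    structure used for this is abstracted as a [coupling]; [oe_coupling] builds it from the
    equivalence.

    Finitely many translates of A cover X. Cutting them down to a partition gives elements a_i, a'_i
    with sum_i a'_i a_i = 1 and e a_i = a_i ([uf_sum_a'a], [uf_ea]), so the corner of e is full.
    Then r |-> theta (a_i r a'_j) is a matrix representation of R_alpha over R_beta ([theta_mxM]),
    and pulling back along it is a functor F from R_beta-modules to R_alpha-modules. F preserves
    exactness ([mmap_exact]), and [maug] identifies F(L^oo(beta)) with L^oo(alpha).

    Let the Y_l partition Y with h_l Y_l inside B. Then F(<C>) is the sum of the modules <A cap
    phi^-1(h_l (C cap Y_l))>. As phi scales measures by c, dimensions are multiplied by c
    ([mpull_dim]), and the 1-norm of an element is c times the sum of the 1-norms of its components
    ([mpull_norm]). This factor cancels in operator norms, while dimensions and ranks grow at most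
    by c; hence lognorm(F f) <= c lognorm(f) ([mpull_lognorm]).

    It remains that F(D) is again an embedding. D need not be exact, so the free resolution C cannot
    be compared with F(D) directly. It is compared with F of the step functions with values in the
    resolution E, which is exact ([smap_exact], [mpull_resolution], [free_chain_lift]); the given
    map from E to D extends to step functions ([step_map]), and [mpull_embedding] composes the two.
    The inverse data have index 1/c ([oe_sym]), so the same inequality with the roles exchanged
    gives equality. *)

Section Crossed.
Variables (G : groupType) (L : pzRingType) (a : ringAction G L).
Implicit Types (x y : crossed a) (u v : L) (s t : G).

Lemma singleE u s t : single a u s t = if t == s then u else 0.
Proof. by []. Qed.

Lemma crossed_ext x y : (forall s, x s = y s) -> x = y.
Proof. by move=> xy; apply/val_inj/funext. Qed.

Lemma single0 s : single a 0 s = 0.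
Proof. by apply: crossed_ext => t; rewrite singleE crossed0; case: ifP. Qed.

Lemma singleD u v s : single a (u + v) s = single a u s + single a v s.
Proof.
apply: crossed_ext => t; rewrite crossedD !singleE.
by case: ifP => // _; rewrite addr0.
Qed.

Lemma single_sum I (r : seq I) (F : I -> L) s :
  single a (\sum_(i <- r) F i) s = \sum_(i <- r) single a (F i) s.
Proof.
elim: r => [|i r IHr]; first by rewrite !big_nil single0.
by rewrite !big_cons singleD IHr.
Qed.

Lemma singleME u s y t : (single a u s * y) t = u * a s (y (s^-1 * t)%g).
Proof. exact: single_mulE. Qed.

Lemma singleM u s v t : single a u s * single a v t = single a (u * a s v) (s * t)%g.
Proof.
apply: crossed_ext => w; rewrite singleME !singleE.
have -> : ((s^-1 * w)%g == t) = (w == (s * t)%g).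
  by apply/eqP/eqP => [<-|->]; rewrite ?mulVKg ?mulKg.
by case: ifP => // _; rewrite rmorph0 mulr0.
Qed.

Lemma single1M u v : single a u 1%g * single a v 1%g = single a (u * v) 1%g.
Proof. by rewrite singleM ract1 mulg1. Qed.

Lemma single11 : single a 1 1%g = 1. Proof. by []. Qed.

Lemma mul_single1E u x s : (single a u 1%g * x) s = u * x s.
Proof. by rewrite singleME invg1 mul1g ract1. Qed.

Lemma mulr_singleE x u t s : (x * single a u t) s = x (s * t^-1)%g * a (s * t^-1)%g u.
Proof.
rewrite [x]crossed_sumE mulr_suml !crossed_sum big_distrl.
apply: eq_bigr => w _; rewrite singleM !singleE.
have -> : (s == (w * t)%g) = ((s * t^-1)%g == w).
  by apply/eqP/eqP => [->|<-]; rewrite ?mulgK ?mulgVK.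
by case: eqP => [->|_] //=; rewrite mul0r.
Qed.

Lemma mulr_single1E x u s : (x * single a u 1%g) s = x s * a s u.
Proof. by rewrite mulr_singleE invg1 mulg1. Qed.

Lemma crossed_ind (P : crossed a -> Prop) :
  P 0 -> (forall x y, P x -> P y -> P (x + y)) ->
  (forall u s, P (single a u s)) -> forall x, P x.
Proof. by move=> P0 PD P1 x; rewrite [x]crossed_sumE; apply: big_ind. Qed.

Section Ext.
Variables (V : zmodType) (h : L -> G -> V).
Hypothesis hD : forall s u v, h (u + v) s = h u s + h v s.

Lemma ext_h0 s : h 0 s = 0.
Proof. by apply: (addIr (h 0 s)); rewrite -hD !add0r. Qed.

(** The additive map on the crossed product with prescribed values on single terms; [theta] and the
    module actions are instances. *)
Definition ext x : V := \sum_(s <- csupp x) h (x s) s.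

Lemma ext_widen (r : seq G) x : uniq r -> [set s | x s != 0] `<=` [set` r] ->
  ext x = \sum_(s <- r) h (x s) s.
Proof.
move=> ur xr; rewrite /ext.
rewrite (bigID (fun s => x s == 0)) big1 /= ?add0r => [|s /eqP->]; last exact: ext_h0.
rewrite [RHS](bigID (fun s => x s == 0)) [X in _ = X + _]big1 /= ?add0r => [|s /eqP->];
  last exact: ext_h0.
rewrite -!(big_filter _ (fun s => x s != 0)); apply: perm_big; apply: uniq_perm.
- exact/filter_uniq/csupp_uniq.
- exact: filter_uniq.
move=> s; rewrite !mem_filter; case: (boolP (x s != 0)) => //= xs.
by have /= -> := xr _ xs; have /= -> := csuppP xs.
Qed.

Lemma extD x y : ext (x + y) = ext x + ext y.
Proof.
pose r := undup (csupp x ++ csupp y).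
have ur : uniq r by exact: undup_uniq.
have xr : [set s | x s != 0] `<=` [set` r].
  by move=> s /csuppP/=; rewrite mem_undup mem_cat => ->.
have yr : [set s | y s != 0] `<=` [set` r].
  by move=> s /csuppP/=; rewrite mem_undup mem_cat => ->; rewrite orbT.
have xyr : [set s | (x + y) s != 0] `<=` [set` r].
  move=> s; rewrite /mkset crossedD; have [->|/xr//] := eqVneq (x s) 0.
  by rewrite add0r => /yr.
rewrite (ext_widen ur xr) (ext_widen ur yr) (ext_widen ur xyr) -big_split /=.
by apply: eq_bigr => s _; rewrite -hD.
Qed.

Lemma ext0 : ext 0 = 0.
Proof. by apply: (addIr (ext 0)); rewrite -extD !add0r. Qed.

Lemma ext_suml I (r : seq I) (F : I -> crossed a) :
  ext (\sum_(i <- r) F i) = \sum_(i <- r) ext (F i).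
Proof. by apply: big_morph; [exact: extD|exact: ext0]. Qed.

Lemma ext_single u s : ext (single a u s) = h u s.
Proof.
rewrite (@ext_widen [:: s]) //; first by rewrite big_seq1 singleE eqxx.
by move=> t /=; rewrite /single_fun inE; case: (t =P s) => // _; rewrite eqxx.
Qed.

End Ext.

Lemma crossed_actE x m : crossed_act x m = ext (fun u s => u * a s m) x.
Proof.
rewrite /crossed_act /ext -(fsbig_widen [set` csupp x]) //; last first.
  move=> s /= [_ nxs]; have [->|/csuppP//] := eqVneq (x s) 0.
  by rewrite mul0r.
by rewrite -fsbig_seq ?csupp_uniq.
Qed.

Lemma crossed_actDl x x' m : crossed_act (x + x') m = crossed_act x m + crossed_act x' m.
Proof. by rewrite !crossed_actE extD // => s u v; rewrite mulrDl. Qed.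

Lemma crossed_act_single u s m : crossed_act (single a u s) m = u * a s m.
Proof. by rewrite crossed_actE ext_single // => t v w; rewrite mulrDl. Qed.

Lemma crossed_act0l m : crossed_act (0 : crossed a) m = 0.
Proof. by rewrite -(single0 1%g) crossed_act_single mul0r. Qed.

Lemma crossed_actDr x m m' : crossed_act x (m + m') = crossed_act x m + crossed_act x m'.
Proof.
by rewrite !crossed_actE /ext -big_split; apply: eq_bigr => s _; rewrite rmorphD mulrDr.
Qed.

Lemma crossed_actr0 x : crossed_act x 0 = 0.
Proof. by apply: (addIr (crossed_act x 0)); rewrite -crossed_actDr !add0r. Qed.

Lemma crossed_act_sumr I (r : seq I) (F : I -> L) x :
  crossed_act x (\sum_(i <- r) F i) = \sum_(i <- r) crossed_act x (F i).
Proof. by apply: big_morph; [exact: crossed_actDr|exact: crossed_actr0]. Qed.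

Lemma crossed_act_suml I (r : seq I) (F : I -> crossed a) m :
  crossed_act (\sum_(i <- r) F i) m = \sum_(i <- r) crossed_act (F i) m.
Proof.
by apply: (big_morph (fun x => crossed_act x m)) => [x x'|];
  [exact: crossed_actDl|exact: crossed_act0l].
Qed.

Lemma crossed_actM x x' m : crossed_act (x * x') m = crossed_act x (crossed_act x' m).
Proof.
elim/crossed_ind: x => [|x1 x2 IH1 IH2|u s]; first by rewrite mul0r !crossed_act0l.
  by rewrite mulrDl !crossed_actDl IH1 IH2.
elim/crossed_ind: x' => [|x1 x2 IH1 IH2|v t].
- by rewrite mulr0 !crossed_act0l crossed_actr0.
- by rewrite mulrDr !crossed_actDl IH1 IH2 crossed_actDr.
by rewrite singleM !crossed_act_single rmorphM ractM mulrA.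
Qed.

Lemma crossed_act1 m : crossed_act (1 : crossed a) m = m.
Proof. by rewrite -single11 crossed_act_single mul1r ract1. Qed.

End Crossed.

(** * Couplings of crossed products *)

(* [cell g h] is the indicator of the set of points of the second space at    *)
(* which the arrow g of the first groupoid corresponds to the arrow h of the  *)
(* second one; [pull 1] and [push 1] are the indicators of the two sets that  *)
(* are identified with each other.                                            *)
Record coupling (G H : groupType) (L1 L2 : comPzRingType)
    (a : ringAction G L1) (b : ringAction H L2) := Coupling {
  push : L1 -> L2;
  pull : L2 -> L1;
  cell : G -> H -> L2;
  rows : G -> seq H;
  cols : H -> seq G;
  pushD : forall u v, push (u + v) = push u + push v;
  pushM : forall u v, push (u * v) = push u * push v;
  pullD : forall u v, pull (u + v) = pull u + pull v;
  pullM : forall u v, pull (u * v) = pull u * pull v;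
  push_pull : forall v, push (pull v) = push 1 * v;
  pull_push : forall u, pull (push u) = pull 1 * u;
  rows_uniq : forall g, uniq (rows g);
  cols_uniq : forall h, uniq (cols h);
  cell_rows : forall g h, h \notin rows g -> cell g h = 0;
  cell_cols : forall g h, g \notin cols h -> cell g h = 0;
  cell_rowM : forall g h h', cell g h * cell g h' = if h == h' then cell g h else 0;
  cell_colM : forall g g' h, cell g h * cell g' h = if g == g' then cell g h else 0;
  sum_rows : forall g, \sum_(h <- rows g) cell g h = push (a g (pull 1));
  sum_cols : forall h, \sum_(g <- cols h) pull (cell g h) = pull (b h (push 1));
  cell_push : forall g h u, cell g h * b h (push u) = cell g h * push (a g u);
  cell_trans : forall g g' h h',
    cell g h * b h (cell g' h') = cell g h * cell (g * g')%g (h * h')%g;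
  cell11 : cell 1%g 1%g = push 1
}.

Section Theta.
Variables (G H : groupType) (L1 L2 : comPzRingType).
Variables (a : ringAction G L1) (b : ringAction H L2) (c : coupling a b).

Lemma push0 : push c 0 = 0.
Proof. by apply: (addIr (push c 0)); rewrite -pushD !add0r. Qed.

Lemma pull0 : pull c 0 = 0.
Proof. by apply: (addIr (pull c 0)); rewrite -pullD !add0r. Qed.

Lemma push_sum I (r : seq I) (F : I -> L1) :
  push c (\sum_(i <- r) F i) = \sum_(i <- r) push c (F i).
Proof. by apply: big_morph; [exact: pushD|exact: push0]. Qed.

Lemma pull_sum I (r : seq I) (F : I -> L2) :
  pull c (\sum_(i <- r) F i) = \sum_(i <- r) pull c (F i).
Proof. by apply: big_morph; [exact: pullD|exact: pull0]. Qed.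

Lemma push1M u : push c 1 * push c u = push c u.
Proof. by rewrite -pushM mul1r. Qed.

Lemma pull1M v : pull c 1 * pull c v = pull c v.
Proof. by rewrite -pullM mul1r. Qed.

Lemma pull_push1 : pull c (push c 1) = pull c 1.
Proof. by rewrite pull_push mulr1. Qed.

Lemma cellM g h : cell c g h * cell c g h = cell c g h.
Proof. by rewrite cell_rowM eqxx. Qed.

(** A row of cells is orthogonal with sum [push (g (pull 1))], so every cell is absorbed by an
    element in the image of [push]. *)
Lemma push1_cell g h : push c 1 * cell c g h = cell c g h.
Proof.
have [hr|/cell_rows->] := boolP (h \in rows c g); last by rewrite mulr0.
have E : cell c g h = cell c g h * push c (a g (pull c 1)).
  rewrite -sum_rows mulr_sumr (bigD1_seq h) ?rows_uniq //= cellM big1 ?addr0 // => i.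
  by rewrite eq_sym cell_rowM => /negPf ->.
by rewrite E mulrCA push1M.
Qed.

Lemma cell_shift1 g h : cell c g h * b h (push c 1) = cell c g h.
Proof. by rewrite cell_push rmorph1 mulrC push1_cell. Qed.

(** The cell of the two units already fills [push 1], and the other cells of this row are orthogonal
    to it. *)
Lemma cell1 h : cell c 1%g h = if h == 1%g then push c 1 else 0.
Proof.
case: eqP => [->|/eqP h1]; first exact: cell11.
by rewrite -push1_cell -cell11 cell_rowM eq_sym (negPf h1).
Qed.

(** Over the cell of the pair (g, h), the arrow g is read as h. *)
Definition theta_gen (u : L1) (g : G) : crossed b :=
  \sum_(h <- rows c g) single b (cell c g h * push c u) h.

Lemma theta_genD g u v : theta_gen (u + v) g = theta_gen u g + theta_gen v g.
Proof.
rewrite /theta_gen -big_split /=; apply: eq_bigr => h _.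
by rewrite -singleD -mulrDr -pushD.
Qed.

Definition theta : crossed a -> crossed b := ext theta_gen.

Lemma theta_single u g :
  theta (single a u g) = \sum_(h <- rows c g) single b (cell c g h * push c u) h.
Proof. exact: (ext_single _ theta_genD). Qed.

Lemma thetaD x y : theta (x + y) = theta x + theta y.
Proof. exact: (extD theta_genD). Qed.

Lemma theta0 : theta 0 = 0. Proof. exact: (ext0 _ theta_genD). Qed.

Lemma theta_sum I (r : seq I) (F : I -> crossed a) :
  theta (\sum_(i <- r) F i) = \sum_(i <- r) theta (F i).
Proof. exact: (ext_suml theta_genD). Qed.

Lemma theta_singleE u g h : theta (single a u g) h = cell c g h * push c u.
Proof.
rewrite theta_single crossed_sum.
have [hr|hr] := boolP (h \in rows c g).
  rewrite (bigD1_seq h) ?rows_uniq // singleE eqxx big1 => [|i ih]; first exact: addr0.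
  by rewrite singleE eq_sym (negPf ih).
rewrite (cell_rows hr) mul0r big_seq big1 // => i ir.
by rewrite singleE; case: eqP => // hi; rewrite hi ir in hr.
Qed.

Lemma theta_single1 u : theta (single a u 1%g) = single b (push c u) 1%g.
Proof.
apply: crossed_ext => h; rewrite theta_singleE cell1 singleE.
by case: ifP => _; rewrite ?push1M ?mul0r.
Qed.

(* theta annihilates the complement of the corner of [pull 1], so it is       *)
(* multiplicative only up to inserting this idempotent.                       *)
Lemma thetaM x y : theta (x * single a (pull c 1) 1%g * y) = theta x * theta y.
Proof.
elim/crossed_ind: x => [|x1 x2 IH1 IH2|u g].
- by rewrite !mul0r !theta0 mul0r.
- by rewrite !mulrDl !thetaD mulrDl IH1 IH2.
elim/crossed_ind: y => [|y1 y2 IH1 IH2|v k].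
- by rewrite !mulr0 !theta0 mulr0.
- by rewrite !mulrDr !thetaD mulrDr IH1 IH2.
rewrite !singleM mulg1; apply: crossed_ext => h.
rewrite theta_singleE [theta (single a u g)]theta_single mulr_suml crossed_sum.
transitivity (\sum_(m <- rows c g) cell c g m *
    (push c u * (cell c (g * k)%g h * push c (a g v)))).
  rewrite -mulr_suml sum_rows !pushM.
  by rewrite -mulrA mulrCA [RHS]mulrCA; congr (_ * _); rewrite mulrCA.
apply: eq_bigr => m _; rewrite singleME theta_singleE rmorphM.
rewrite [RHS]mulrACA cell_trans mulVKg [RHS]mulrACA [X in _ = _ * X]mulrC.
by rewrite [RHS]mulrACA cell_push -!mulrA; congr (_ * _); rewrite [RHS]mulrC mulrA.
Qed.

(** The identification of the corners intertwines the canonical actions as well; this is what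
    transports augmentations. *)
Lemma crossed_act_theta x v : crossed_act (theta x) v = push c (crossed_act x (pull c v)).
Proof.
elim/crossed_ind: x => [|x1 x2 IH1 IH2|u g].
- by rewrite theta0 !crossed_act0l push0.
- by rewrite thetaD !crossed_actDl pushD IH1 IH2.
rewrite theta_single crossed_act_suml crossed_act_single pushM -(pull1M v) rmorphM pushM.
rewrite -sum_rows mulr_suml mulr_sumr; apply: eq_bigr => h _.
rewrite crossed_act_single -cell_push push_pull rmorphM.
by rewrite [cell _ _ _ * (_ * _)]mulrA cell_shift1 mulrCA mulrA.
Qed.

(** The mirror image of [cell_push], needed to exchange the roles of the two sides. *)
Lemma cell_pull_push g h u : pull c (cell c g h) * a g (pull c u) =
  pull c (cell c g h) * pull c (b h u).
Proof.
rewrite -[pull c (cell c g h)]pull1M [pull c 1 * _]mulrC -mulrA -pull_push.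
by rewrite -!pullM -cell_push push_pull rmorphM mulrA cell_shift1 mulr1.
Qed.

End Theta.

Section Sym.
Variables (G H : groupType) (L1 L2 : comPzRingType).
Variables (a : ringAction G L1) (b : ringAction H L2) (c : coupling a b).

Let cell' h g := pull c (cell c g h).

Lemma push_cell' g h : push c (cell' h g) = cell c g h.
Proof. by rewrite push_pull push1_cell. Qed.

Lemma sym_rowM h g g' : cell' h g * cell' h g' = if g == g' then cell' h g else 0.
Proof. by rewrite /cell' -pullM cell_colM; case: ifP; rewrite // pull0. Qed.

Lemma sym_colM h h' g : cell' h g * cell' h' g = if h == h' then cell' h g else 0.
Proof. by rewrite /cell' -pullM cell_rowM; case: ifP; rewrite // pull0. Qed.

Lemma sym_rows h g : g \notin cols c h -> cell' h g = 0.
Proof. by move=> /cell_cols E; rewrite /cell' E pull0. Qed.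

Lemma sym_cols h g : h \notin rows c g -> cell' h g = 0.
Proof. by move=> /cell_rows E; rewrite /cell' E pull0. Qed.

Lemma sym_sum_cols g :
  \sum_(h <- rows c g) push c (cell' h g) = push c (a g (pull c 1)).
Proof. by rewrite -sum_rows; apply: eq_bigr => h _; rewrite push_cell'. Qed.

Lemma sym_trans h h' g g' :
  cell' h g * a g (cell' h' g') = cell' h g * cell' (h * h')%g (g * g')%g.
Proof. by rewrite /cell' cell_pull_push -pullM cell_trans pullM. Qed.

Lemma sym11 : cell' 1%g 1%g = pull c 1.
Proof. by rewrite /cell' cell11 pull_push1. Qed.

Definition coupling_sym : coupling b a :=
  @Coupling H G L2 L1 b a (pull c) (push c) cell' (cols c) (rows c)
    (pullD c) (pullM c) (pushD c) (pushM c) (pull_push c) (push_pull c)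
    (cols_uniq c) (rows_uniq c) sym_rows sym_cols sym_rowM
    (fun h h' g => sym_colM h h' g) (sum_cols c) sym_sum_cols
    (fun h g u => cell_pull_push c g h u) sym_trans sym11.

(** Orthogonality in the columns returns the piece over each cell to its original arrow g; the
    pieces add up to the row sum, which cuts down to the corner. *)
Lemma thetaK x : theta coupling_sym (theta c x) =
  single a (pull c 1) 1%g * x * single a (pull c 1) 1%g.
Proof.
elim/crossed_ind: x => [|x1 x2 IH1 IH2|u g].
- by rewrite !theta0 mulr0 mul0r.
- by rewrite !thetaD mulrDr mulrDl IH1 IH2.
rewrite !singleM mul1g mulg1 ract1 theta_single theta_sum.
transitivity (\sum_(h <- rows c g) single a (pull c (cell c g h) * (pull c 1 * u)) g).
  apply: eq_big_seq => h hr; apply: crossed_ext => k.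
  rewrite theta_singleE singleE [cell _ _ _]/= [push _ _]/= pullM mulrA.
  rewrite /cell' -pullM cell_colM pull_push.
  by case: eqP => [->|_] //; rewrite pull0 mul0r.
rewrite -single_sum -mulr_suml -pull_sum sum_rows pull_push.
by rewrite mulrACA pull1M mulrA mulrAC.
Qed.

End Sym.

(** * Pull-backs of modules *)

Record matrep (P Q : pzRingType) := Matrep {
  mr_idx : finType;
  mr :> P -> mr_idx -> mr_idx -> Q;
  mrD : forall x y i j, mr (x + y) i j = mr x i j + mr y i j;
  mrM : forall x y i k, mr (x * y) i k = \sum_j mr x i j * mr y j k
}.

Section Mpull.
Variables (P Q : pzRingType) (t : matrep P Q) (M : lmodType Q).
Local Notation I := (mr_idx t).

Definition mact (r : P) (u : {ffun I -> M}) : {ffun I -> M} :=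
  [ffun i => \sum_j t r i j *: u j].

Lemma mactDl r s u : mact (r + s) u = mact r u + mact s u.
Proof.
apply/ffunP => i; rewrite !ffunE -big_split; apply: eq_bigr => j _.
by rewrite mrD scalerDl.
Qed.

Lemma mactDr r u v : mact r (u + v) = mact r u + mact r v.
Proof.
apply/ffunP => i; rewrite !ffunE -big_split; apply: eq_bigr => j _.
by rewrite ffunE scalerDr.
Qed.

Lemma mactM r s u : mact (r * s) u = mact r (mact s u).
Proof.
apply/ffunP => i; rewrite !ffunE.
under eq_bigr do rewrite mrM scaler_suml.
rewrite exchange_big; apply: eq_bigr => j _.
by rewrite ffunE scaler_sumr; apply: eq_bigr => k _; rewrite scalerA.
Qed.

Definition mpull_pred : pred {ffun I -> M} := fun u => mact 1 u == u.

Lemma mpull_zmod_closed : zmod_closed mpull_pred.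
Proof.
have D := mactDr 1.
split=> [|u v /eqP uu /eqP vv]; apply/eqP.
  by apply: (addIr (mact 1 0)); rewrite -D !add0r.
by apply: (addIr (mact 1 v)); rewrite -D subrK uu vv subrK.
Qed.

HB.instance Definition _ :=
  GRing.isZmodClosed.Build {ffun I -> M} mpull_pred mpull_zmod_closed.

(* Since t need not be unital, P acts through t only on the image of the      *)
(* idempotent matrix t 1.                                                     *)
Record mpull := Mpull { mpull_val :> {ffun I -> M}; _ : mpull_pred mpull_val }.

HB.instance Definition _ := [isSub for mpull_val].
HB.instance Definition _ := [Choice of mpull by <:].
HB.instance Definition _ := [SubChoice_isSubZmodule of mpull by <:].

Lemma mpull_subproof r u : mpull_pred (mact r u).
Proof. by apply/eqP; rewrite -mactM mul1r. Qed.

Definition mpull_mk r u : mpull := Mpull (mpull_subproof r u).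

Definition mpull_scale (r : P) (u : mpull) : mpull := mpull_mk r u.

Lemma mact1 (u : mpull) : mact 1 u = u.
Proof. by case: u => u /= /eqP. Qed.

Lemma mpull_scaleA r s u : mpull_scale r (mpull_scale s u) = mpull_scale (r * s) u.
Proof. by apply: val_inj; rewrite /= mactM. Qed.

Lemma mpull_scale1 : left_id 1 mpull_scale.
Proof. by move=> u; apply: val_inj; rewrite /= mact1. Qed.

Lemma mpull_scaleDr : right_distributive mpull_scale +%R.
Proof. by move=> r u v; apply: val_inj; rewrite /= mactDr. Qed.

Lemma mpull_scaleDl u : {morph mpull_scale^~ u : r s / r + s}.
Proof. by move=> r s; apply: val_inj; rewrite /= mactDl. Qed.

HB.instance Definition _ := GRing.Zmodule_isLmodule.Build P mpull
  mpull_scaleA mpull_scale1 mpull_scaleDr mpull_scaleDl.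

Lemma mpullP (u v : mpull) : (forall i, u i = v i) <-> u = v.
Proof. by split=> [uv|->//]; apply/val_inj/ffunP. Qed.

Lemma mpull0E i : (0 : mpull) i = 0. Proof. by rewrite [LHS]ffunE. Qed.

Lemma mpullDE (u v : mpull) i : (u + v) i = u i + v i.
Proof. by rewrite [LHS]ffunE. Qed.

Lemma mpullZE (r : P) (u : mpull) i : (r *: u) i = \sum_j t r i j *: u j.
Proof. by rewrite [LHS]ffunE. Qed.

Lemma mpull_mkE r (u : {ffun I -> M}) i : mpull_mk r u i = \sum_j t r i j *: u j.
Proof. by rewrite [LHS]ffunE. Qed.

Lemma mpull1E (u : mpull) i : \sum_j t 1 i j *: u j = u i.
Proof. by rewrite -[in RHS](mact1 u) ffunE. Qed.

End Mpull.

Section Mmap.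
Variables (P Q : pzRingType) (t : matrep P Q) (M N : lmodType Q).
Variable f : {linear M -> N}.

Lemma mmap_subproof (u : mpull t M) : mpull_pred [ffun i => f (u i)].
Proof.
apply/eqP/ffunP => i; rewrite !ffunE -[in RHS](mpull1E u) linear_sum.
by apply: eq_bigr => j _; rewrite ffunE linearZ.
Qed.

Definition mmap (u : mpull t M) : mpull t N := Mpull (mmap_subproof u).

Lemma mmapE u i : mmap u i = f (u i). Proof. by rewrite [LHS]ffunE. Qed.

Lemma mmap_is_linear : linear mmap.
Proof.
move=> r u v; apply/mpullP => i; rewrite mmapE !mpullDE !mpullZE linearD linear_sum.
rewrite mmapE; congr (_ + _); apply: eq_bigr => j _.
by rewrite linearZ mmapE.
Qed.

HB.instance Definition _ :=
  GRing.isLinear.Build P (mpull t M) (mpull t N) _ mmap mmap_is_linear.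

End Mmap.

Lemma mmap_exact (P Q : pzRingType) (t : matrep P Q) (M N O : lmodType Q)
    (f : {linear M -> N}) (g : {linear N -> O}) :
  (forall x, g x = 0 -> exists y, f y = x) ->
  forall u : mpull t N, mmap g u = 0 -> exists v, mmap f v = u.
Proof.
move=> ex u gu0.
have /choice[v fv] : forall i, exists y, f y = u i.
  by move=> i; apply: ex; rewrite -mmapE gu0 mpull0E.
(* The chosen components need not be fixed by the idempotent matrix [t 1]. Projecting with it
   repairs this and does not change their image, because [u] is fixed. *)
exists (mpull_mk 1 [ffun i => v i]); apply/mpullP => i.
rewrite mmapE mpull_mkE linear_sum -[RHS]mpull1E.
by apply: eq_bigr => j _; rewrite linearZ ffunE fv.
Qed.

(* A finite partition of unity whose parts are dominated by translates of the *)
(* idempotent e; it exists when the corner of e is full.                      *)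
Record unitfam (G : groupType) (L : comPzRingType) (a : ringAction G L) (e : L) :=
  Unitfam {
  uf_idx : finType;
  uf_p : uf_idx -> L;
  uf_g : uf_idx -> G;
  uf_orth : forall i j, uf_p i * uf_p j = if i == j then uf_p i else 0;
  uf_sum : \sum_i uf_p i = 1;
  uf_sub : forall i, uf_p i * a (uf_g i)^-1%g e = uf_p i
}.

Section Unitfam.
Variables (G : groupType) (L : comPzRingType) (a : ringAction G L) (e : L).
Variable F : unitfam a e.
Local Notation p := (@uf_p _ _ _ _ F).
Local Notation g := (@uf_g _ _ _ _ F).

(** [uf_a i] and [uf_a' i] are mutually inverse partial isometries between the part [p i] and its
    translate, which lies under [e]. *)
Definition uf_a (i : uf_idx F) : crossed a := single a (a (g i) (p i)) (g i).
Definition uf_a' (i : uf_idx F) : crossed a := single a (p i) (g i)^-1%g.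

Lemma uf_ppE i : p i * p i = p i. Proof. by rewrite uf_orth eqxx. Qed.

Lemma uf_act_sub i : e * a (g i) (p i) = a (g i) (p i).
Proof.
rewrite -[in RHS](uf_sub i) rmorphM -ractM mulgV ract1.
by rewrite mulrC.
Qed.

Lemma uf_a'a i : uf_a' i * uf_a i = single a (p i) 1%g.
Proof. by rewrite singleM -ractM mulVg ract1 uf_ppE. Qed.

(** As [uf_a i] equals [e] times itself, this puts 1 into the two-sided ideal generated by [e]: the
    corner is full. *)
Lemma uf_sum_a'a : \sum_(i : uf_idx F) uf_a' i * uf_a i = 1.
Proof. by under eq_bigr do rewrite uf_a'a; rewrite -single_sum uf_sum. Qed.

Lemma uf_aa' i j : uf_a i * uf_a' j =
  if i == j then single a (a (g i) (p i)) 1%g else 0.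
Proof.
rewrite singleM -rmorphM uf_orth; case: eqP => [<-|_]; first by rewrite mulgV.
by rewrite rmorph0 single0.
Qed.

Lemma uf_ea i : single a e 1%g * uf_a i = uf_a i.
Proof. by rewrite singleM ract1 mul1g uf_act_sub. Qed.

Lemma uf_a'e i : uf_a' i * single a e 1%g = uf_a' i.
Proof. by rewrite singleM mulg1 uf_sub. Qed.

End Unitfam.

(** * The Morita functor of a coupling and the transport of augmentations *)

Section Theta.
Variables (G H : groupType) (L1 L2 : comPzRingType).
Variables (a : ringAction G L1) (b : ringAction H L2) (c : coupling a b).
Variable F : unitfam a (pull c 1).
Local Notation K := (uf_idx F).
Local Notation A := (@uf_a _ _ _ _ F).
Local Notation A' := (@uf_a' _ _ _ _ F).

(** The elements [A i] and [A' j] turn r into a matrix over the corner, whose entries [theta] reads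
    in the other crossed product. *)
Definition theta_mx (r : crossed a) (i j : K) : crossed b := theta c (A i * r * A' j).

Lemma theta_mxD r s i j : theta_mx (r + s) i j = theta_mx r i j + theta_mx s i j.
Proof. by rewrite /theta_mx mulrDr mulrDl thetaD. Qed.

Lemma theta_mul_a x y i : theta c (x * A' i) * theta c (A i * y) =
  theta c (x * A' i * A i * y).
Proof. by rewrite -thetaM -!mulrA [single _ _ _ * (A i * y)]mulrA uf_ea. Qed.

(** Insert 1, written as the sum of the [A' j * A j], between r and s; each [A j] absorbs the
    idempotent that [thetaM] demands. *)
Lemma theta_mxM r s i k : theta_mx (r * s) i k = \sum_j theta_mx r i j * theta_mx s j k.
Proof.
rewrite /theta_mx -{1}[r]mulr1 -(uf_sum_a'a F) mulr_sumr mulr_suml mulr_sumr mulr_suml.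
rewrite theta_sum; apply: eq_bigr => j _.
by rewrite -[A j * s * _]mulrA theta_mul_a !mulrA.
Qed.

Definition theta_rep : matrep (crossed a) (crossed b) :=
  @Matrep _ _ K theta_mx theta_mxD theta_mxM.

Lemma theta_mx_sum r s i : \sum_j theta_mx r i j * theta c (A j * s) = theta c (A i * r * s).
Proof.
rewrite -{2}[r]mulr1 -(uf_sum_a'a F) mulr_sumr mulr_sumr mulr_suml theta_sum.
by apply: eq_bigr => j _; rewrite theta_mul_a !mulrA.
Qed.

Section Aug.
Variables (M : lmodType (crossed b)) (h : M -> L2).
Hypotheses (hD : forall x y, h (x + y) = h x + h y).
Hypotheses (hZ : forall r x, h (r *: x) = crossed_act r (h x)).

(** Identifies the pull-back of [L2] with [L1]: the component at [i] is pulled into the corner and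
    moved onto the part [p i] by [A' i]. By [push_act_maug] the components can be recovered. *)
Definition maug (u : mpull theta_rep M) : L1 :=
  \sum_i crossed_act (A' i) (pull c (h (u i))).

Lemma maugD u v : maug (u + v) = maug u + maug v.
Proof.
rewrite /maug -big_split; apply: eq_bigr => i _.
by rewrite mpullDE hD pullD crossed_actDr.
Qed.

Lemma h_sum I (r : seq I) (E : I -> M) : h (\sum_(i <- r) E i) = \sum_(i <- r) h (E i).
Proof.
apply: big_morph; first exact: hD.
by apply: (addIr (h 0)); rewrite -hD !add0r.
Qed.

Lemma crossed_act_a'_pull i v :
  crossed_act (A' i) (pull c 1 * v) = crossed_act (A' i) v.
Proof.
have -> : pull c 1 * v = crossed_act (single a (pull c 1) 1%g) v.
  by rewrite crossed_act_single ract1.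
by rewrite -crossed_actM uf_a'e.
Qed.

Lemma maugZ r u : maug (r *: u) = crossed_act r (maug u).
Proof.
rewrite /maug crossed_act_sumr.
transitivity (\sum_i \sum_j crossed_act (A' i * A i * r * A' j) (pull c (h (u j)))).
  apply: eq_bigr => i _; rewrite mpullZE h_sum pull_sum crossed_act_sumr.
  apply: eq_bigr => j _; rewrite hZ crossed_act_theta pull_push crossed_act_a'_pull.
  by rewrite -crossed_actM !mulrA.
rewrite exchange_big; apply: eq_bigr => j _.
rewrite -crossed_act_suml -!mulr_suml uf_sum_a'a mul1r.
by rewrite crossed_actM.
Qed.

Lemma push_act_maug u j : push c (crossed_act (A j) (maug u)) = h (u j).
Proof.
rewrite /maug crossed_act_sumr push_sum -[in RHS](mpull1E u) h_sum.
apply: eq_bigr => i _; rewrite hZ -crossed_actM.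
by rewrite -crossed_act_theta /= /theta_mx mulr1.
Qed.

Lemma maug_surj : (forall y, exists x, h x = y) -> forall y, exists u, maug u = y.
Proof.
move=> hs y.
(* The values of [h] on the components of a preimage of [y] are forced by [push_act_maug]. *)
have /choice[u uE] : forall i, exists x, h x = push c (crossed_act (A i) y).
  by move=> i; exact: hs.
exists (mpull_mk (t := theta_rep) 1 [ffun i => u i]).
transitivity (\sum_i crossed_act (A' i * A i) y); last first.
  by rewrite -crossed_act_suml uf_sum_a'a crossed_act1.
apply: eq_bigr => i _; rewrite mpull_mkE h_sum.
transitivity (crossed_act (A' i) (pull c (push c (crossed_act (A i) y)))); last first.
  by rewrite pull_push crossed_act_a'_pull crossed_actM.
congr (crossed_act _ (pull c _)).
transitivity (\sum_j push c (crossed_act (A i * A' j * A j) y)).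
  apply: eq_bigr => j _; rewrite hZ ffunE uE crossed_act_theta pull_push.
  by rewrite mulr1 !crossed_actM crossed_act_a'_pull.
rewrite -push_sum -crossed_act_suml.
by under eq_bigr do rewrite -mulrA; rewrite -mulr_sumr uf_sum_a'a mulr1.
Qed.

End Aug.

End Theta.

(** * Lifting along resolutions *)

Lemma finite_set_seq (I : choiceType) (A : set I) : finite_set A ->
  exists2 r : seq I, uniq r & A `<=` [set` r].
Proof.
move=> fA; exists (fset_set A); first exact: fset_uniq.
by move=> i Ai; rewrite /= in_fset_set // inE.
Qed.

Lemma fsbig_seq_widen (I : choiceType) (V : nmodType) (F : I -> V) (r : seq I) :
  uniq r -> [set i | F i != 0] `<=` [set` r] ->
  \sum_(i \in [set: I]) F i = \sum_(i <- r) F i.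
Proof.
move=> ur Fr; rewrite -(fsbig_widen [set` r]) // -?fsbig_seq //.
by move=> i /= [_ ir]; apply: contrapT => /eqP /Fr.
Qed.

(** The target is a bare additive group with an operation [sc], so that one statement serves the
    boundary maps and also the augmentation, whose target is a coefficient ring with
    [crossed_act]. *)
Lemma free_semilinear_lift (S P : pzRingType) (iota : S -> P)
    (C : lmodType S) (N : lmodType P) (V : zmodType) (sc : P -> V -> V)
    (g : N -> V) (f : C -> V) :
  (forall r s, iota (r + s) = iota r + iota s) ->
  (forall r s, iota (r * s) = iota r * iota s) ->
  (forall x y, g (x + y) = g x + g y) ->
  (forall r x, g (r *: x) = sc r (g x)) ->
  (forall x y, f (x + y) = f x + f y) ->
  (forall r x, f (r *: x) = sc (iota r) (f x)) ->
  free_module C -> (forall x, exists w, g w = f x) ->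
  exists f' : C -> N,
    [/\ forall x y, f' (x + y) = f' x + f' y,
        forall r x, f' (r *: x) = iota r *: f' x &
        forall x, g (f' x) = f x].
Proof.
move=> iD iM gD gZ fD fZ [I [b [gen ind]]] ex.
have i0 : iota 0 = 0 by apply: (addIr (iota 0)); rewrite -iD !add0r.
have g0 : g 0 = 0 by apply: (addIr (g 0)); rewrite -gD !add0r.
have f0 : f 0 = 0 by apply: (addIr (f 0)); rewrite -fD !add0r.
have /choice[w gw] : forall i, exists w, g w = f (b i) by move=> i; exact: ex.
have /choice[c cP] := gen.
pose sumb (d : I -> S) : C := \sum_(i \in [set: I]) d i *: b i.
have sumbE (d : I -> S) r : uniq r -> [set i | d i != 0] `<=` [set` r] ->
    sumb d = \sum_(i <- r) d i *: b i.
  move=> ur dr; apply: fsbig_seq_widen => // i /= di.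
  by apply: dr => /=; apply: contraNneq di => ->; rewrite scale0r.
have fin x y : exists2 r : seq I, uniq r & forall i, c x i != 0 \/ c y i != 0 -> i \in r.
  have [|r ur rP] := @finite_set_seq I ([set i | c x i != 0] `|` [set i | c y i != 0]).
    by rewrite finite_setU; split; [case: (cP x)|case: (cP y)].
  by exists r => // i ci; exact: rP.
have fin1 x : exists2 r : seq I, uniq r & forall i, c x i != 0 -> i \in r.
  by have [r ur rP] := fin x x; exists r => // i ci; apply: rP; left.
(* Independence of the basis makes the chosen coordinates unique; this is what makes them additive
   and linear in x ([cD], [cZ] below). *)
have uniqc x (d : I -> S) : finite_set [set i | d i != 0] -> x = sumb d -> c x = d.
  move=> fd xd; apply/funext => i; apply/eqP; rewrite -subr_eq0; apply/eqP.
  have [fc xc] := cP x.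
  have [|r ur rP] := @finite_set_seq I ([set i | c x i != 0] `|` [set i | d i != 0]).
    by rewrite finite_setU.
  have sub : [set i | c x i - d i != 0] `<=` [set` r].
    move=> j cdj; apply: rP; have [cj|] := eqVneq (c x j) 0; last by left.
    by right; move: cdj; rewrite /= cj sub0r oppr_eq0.
  apply: (ind (fun j => c x j - d j)) => //.
    by apply: sub_finite_set sub _; exact: finite_seq.
  rewrite [LHS](sumbE _ r ur sub).
  under eq_bigr do rewrite scalerBl.
  rewrite sumrB -!sumbE // -?xd /sumb -?xc ?subrr //.
    by move=> j cj; apply: rP; right.
  by move=> j cj; apply: rP; left.
pose f' x := \sum_(i \in [set: I]) iota (c x i) *: w i.
have f'E x r : uniq r -> (forall i, c x i != 0 -> i \in r) ->
    f' x = \sum_(i <- r) iota (c x i) *: w i.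
  move=> ur xr; apply: fsbig_seq_widen => // i /= ci.
  by apply: xr; apply: contraNneq ci => ->; rewrite i0 scale0r.
exists f'; split=> [x y|s x|x].
- have [r ur rP] := fin x y.
  have xr i : c x i != 0 -> i \in r by move=> ?; apply: rP; left.
  have yr i : c y i != 0 -> i \in r by move=> ?; apply: rP; right.
  have cD : c (x + y) = (fun i => c x i + c y i).
    have sub : [set i | c x i + c y i != 0] `<=` [set` r].
      move=> j /= cdj; apply: rP; have [cj|] := eqVneq (c x j) 0; last by left.
      by right; move: cdj; rewrite cj add0r.
    apply: uniqc; first by apply: sub_finite_set sub _; exact: finite_seq.
    rewrite (sumbE _ r ur sub) {1}(proj2 (cP x)) {1}(proj2 (cP y)).
    rewrite -/(sumb _) -/(sumb _) (sumbE _ r ur xr) (sumbE _ r ur yr) -big_split /=.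
    by apply: eq_bigr => i _; rewrite scalerDl.
  rewrite (f'E x r ur xr) (f'E y r ur yr) (f'E (x + y) r ur) => [|i].
    by rewrite -big_split; apply: eq_bigr => i _; rewrite cD iD scalerDl.
  by rewrite cD => cdj; apply: rP; have [cj|] := eqVneq (c x i) 0;
    [right; move: cdj; rewrite cj add0r|left].
- have [r ur rP] := fin1 x.
  have cZ : c (s *: x) = (fun i => s * c x i).
    have sub : [set i | s * c x i != 0] `<=` [set` r].
      by move=> j /= cj; apply: rP; apply: contraNneq cj => ->; rewrite mulr0.
    apply: uniqc; first by apply: sub_finite_set sub _; exact: finite_seq.
    rewrite (sumbE _ r ur sub) {1}(proj2 (cP x)) -/(sumb _) (sumbE _ r ur rP).
    by rewrite scaler_sumr; apply: eq_bigr => i _; rewrite scalerA.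
  rewrite (f'E x r ur rP) (f'E (s *: x) r ur) => [|i].
    by rewrite scaler_sumr; apply: eq_bigr => i _; rewrite cZ iM scalerA.
  by rewrite cZ => cj; apply: rP; apply: contraNneq cj => ->; rewrite mulr0.
- have [r ur rP] := fin1 x.
  rewrite (f'E x r ur rP) [in RHS](proj2 (cP x)) -/(sumb _) (sumbE _ r ur rP).
  rewrite (big_morph g gD g0) (big_morph f fD f0).
  by apply: eq_bigr => i _; rewrite gZ gw fZ.
Qed.

Section Lift.
Variables (G : groupType) (Z L : pzRingType) (a0 : ringAction G Z) (a : ringAction G L).
Variables (iota : crossed a0 -> crossed a) (kappa : Z -> L).
Hypotheses (iD : forall r s, iota (r + s) = iota r + iota s).
Hypotheses (iM : forall r s, iota (r * s) = iota r * iota s).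
Hypotheses (kD : forall y z, kappa (y + z) = kappa y + kappa z).
Hypotheses (kZ : forall r z, kappa (crossed_act r z) = crossed_act (iota r) (kappa z)).
Variables (C : augComplex a0) (N : augComplex a).

Definition semilinear k (f : ac_mod C k -> ac_mod N k) : Prop :=
  (forall x y, f (x + y) = f x + f y) /\ forall r x, f (r *: x) = iota r *: f x.

(** The comparison theorem for a free complex and a resolution, with scalars changed along [iota]
    and [kappa]. *)
Lemma free_chain_lift : (forall k, free_module (ac_mod C k)) -> is_resolution N ->
  exists phi : forall k, ac_mod C k -> ac_mod N k,
    [/\ forall k, semilinear (phi k),
        forall k x, phi k (ac_bd C k x) = ac_bd N k (phi k.+1 x) &
        forall x, ac_aug N (phi 0%N x) = kappa (ac_aug C x)].
Proof.
move=> fC [ex0 exS].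
have [f0 [f0D f0Z f0E]] : exists f0 : ac_mod C 0%N -> ac_mod N 0%N,
    [/\ forall x y, f0 (x + y) = f0 x + f0 y,
        forall r x, f0 (r *: x) = iota r *: f0 x &
        forall x, ac_aug N (f0 x) = kappa (ac_aug C x)].
  apply: (@free_semilinear_lift _ _ iota _ _ _ (fun r y => crossed_act r y)
           (ac_aug N) (fun x => kappa (ac_aug C x))) => //.
  - exact: ac_augD.
  - exact: ac_augZ.
  - by move=> x y; rewrite ac_augD kD.
  - by move=> r x; rewrite ac_augZ kZ.
  - by move=> x; exact: ac_aug_surj.
(* A stage of the recursion keeps two consecutive maps together with their commutation, which is
   what shows that the next map has to lift cycles. *)
pose st k := {p : (ac_mod C k -> ac_mod N k) * (ac_mod C k.+1 -> ac_mod N k.+1) |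
  [/\ semilinear p.1, semilinear p.2 & forall x, p.1 (ac_bd C k x) = ac_bd N k (p.2 x)]}.
have step k (f : ac_mod C k -> ac_mod N k) : semilinear f ->
    (forall x, exists w, ac_bd N k w = f (ac_bd C k x)) ->
    exists g : ac_mod C k.+1 -> ac_mod N k.+1,
      semilinear g /\ forall x, f (ac_bd C k x) = ac_bd N k (g x).
  move=> [fD fZ] ex.
  have [g [gD gZ gE]] : exists g : ac_mod C k.+1 -> ac_mod N k.+1,
      [/\ forall x y, g (x + y) = g x + g y,
          forall r x, g (r *: x) = iota r *: g x &
          forall x, ac_bd N k (g x) = f (ac_bd C k x)].
    apply: (@free_semilinear_lift _ _ iota _ _ _ (fun r y => r *: y)
           (ac_bd N k) (fun x => f (ac_bd C k x))) => //.
    - exact: linearD.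
    - by move=> r x; rewrite linearZ.
    - by move=> x y; rewrite linearD fD.
    - by move=> r x; rewrite linearZ fZ.
  by exists g; split=> [//|x]; rewrite gE.
have [f1 [f1L f1E]] : exists g : ac_mod C 1%N -> ac_mod N 1%N,
      semilinear g /\ forall x, f0 (ac_bd C 0%N x) = ac_bd N 0%N (g x).
  apply: step => // x; apply: ex0; rewrite f0E ac_aug_bd.
  by apply: (addIr (kappa 0)); rewrite -kD !add0r.
have nextP k (p : st k) : exists q : st k.+1, (sval q).1 = (sval p).2.
  case: p => -[p q] /= [pL qL pq].
  have [x|g [gL gE]] := step k.+1 q qL.
    apply: exS; rewrite -pq ac_bd_bd; apply: (addIr (p 0)).
    by rewrite -(proj1 pL) !add0r.
  by exists (exist _ (q, g) (And3 qL gL gE)).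
pose next k p := projT1 (cid (nextP k p)).
pose s0 : st 0%N := exist _ (f0, f1) (And3 (conj f0D f0Z) f1L f1E).
pose s := fix s k : st k := if k is j.+1 then next j (s j) else s0.
exists (fun k => (sval (s k)).1); split.
- by move=> k; case: (svalP (s k)).
- move=> k x; have [_ _ ->] := svalP (s k).
  by rewrite /= /next; case: cid => q /= ->.
- exact: f0E.
Qed.

End Lift.

(** * The ring of essentially bounded functions *)

Section LinfTheory.
Variables (R : realType) (d : measure_display) (X : measurableType d).
Variables (mu : probability X R) (Z : normedCoeff R).
Implicit Types (f g : bmf mu Z) (A B : set X) (u v : Linf mu Z).

Lemma Linf_class_eq f g : {ae mu, forall x, f x = g x} -> Linf_class f = Linf_class g.
Proof.
move=> fg; have E : (f - g \in (@ae0 R d X mu Z : idealr _)) = (Linf_class f == Linf_class g).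
  exact: Quotient.idealrBE.
apply/eqP; rewrite -E; apply/asboolP; apply: filterS fg => x fgx.
by apply/eqP; rewrite subr_eq0; apply/eqP.
Qed.

Lemma Linf_class_inj f g : Linf_class f = Linf_class g -> {ae mu, forall x, f x = g x}.
Proof.
have E : (f - g \in (@ae0 R d X mu Z : idealr _)) = (Linf_class f == Linf_class g).
  exact: Quotient.idealrBE.
move/eqP; rewrite -E => /asboolP; apply: filterS => x /eqP.
by rewrite subr_eq0 => /eqP.
Qed.

Lemma reprK_ae f : {ae mu, forall x, repr (Linf_class f) x = f x}.
Proof. by apply: Linf_class_inj; exact: reprK. Qed.

Lemma Linf_repr u : Linf_class (repr u) = u. Proof. exact: reprK. Qed.

Lemma Linf_classD f g : Linf_class (f + g) = Linf_class f + Linf_class g.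
Proof. exact: (rmorphD (\pi_(Linf mu Z))). Qed.

Lemma Linf_classM f g : Linf_class (f * g) = Linf_class f * Linf_class g.
Proof. exact: (rmorphM (\pi_(Linf mu Z))). Qed.

Lemma Linf_class0 : Linf_class (0 : bmf mu Z) = 0.
Proof. exact: (rmorph0 (\pi_(Linf mu Z))). Qed.

Lemma Linf_class1 : Linf_class (1 : bmf mu Z) = 1.
Proof. exact: (rmorph1 (\pi_(Linf mu Z))). Qed.

Lemma bmfDE f g x : (f + g) x = f x + g x. Proof. by []. Qed.
Lemma bmfME f g x : (f * g) x = f x * g x. Proof. by []. Qed.
Lemma bmf0E x : (0 : bmf mu Z) x = 0. Proof. by []. Qed.
Lemma bmf1E x : (1 : bmf mu Z) x = 1. Proof. by []. Qed.

Lemma Linf_ext u v : {ae mu, forall x, repr u x = repr v x} -> u = v.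
Proof. by move=> uv; rewrite -[u]Linf_repr -[v]Linf_repr; exact: Linf_class_eq. Qed.

Lemma repr_add u v : {ae mu, forall x, repr (u + v) x = repr u x + repr v x}.
Proof.
have := reprK_ae (repr u + repr v).
by rewrite Linf_classD !Linf_repr; apply: filterS => x ->; rewrite bmfDE.
Qed.

Lemma repr_mul u v : {ae mu, forall x, repr (u * v) x = repr u x * repr v x}.
Proof.
have := reprK_ae (repr u * repr v).
by rewrite Linf_classM !Linf_repr; apply: filterS => x ->; rewrite bmfME.
Qed.

Lemma repr_zero : {ae mu, forall x, repr (0 : Linf mu Z) x = 0}.
Proof. by have := reprK_ae 0; rewrite Linf_class0; apply: filterS => x ->; rewrite bmf0E. Qed.

Lemma repr_one : {ae mu, forall x, repr (1 : Linf mu Z) x = 1}.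
Proof. by have := reprK_ae 1; rewrite Linf_class1; apply: filterS => x ->; rewrite bmf1E. Qed.

Lemma Linf_chiE A (mA : measurable A) : Linf_chi mu Z A = Linf_class (Bmf (bmf_chi mu Z mA)).
Proof.
rewrite /Linf_chi; congr Linf_class; apply: val_inj.
by rewrite val_insubd (bmf_chi mu Z mA).
Qed.

Lemma repr_chi A : measurable A ->
  {ae mu, forall x, repr (Linf_chi mu Z A) x = chi_fun Z A x}.
Proof.
move=> mA; rewrite Linf_chiE.
by apply: filterS (reprK_ae (Bmf (bmf_chi mu Z mA))) => x ->.
Qed.

Lemma chi_funT A x : A x -> chi_fun Z A x = 1.
Proof. by move=> Ax; rewrite /chi_fun mem_set. Qed.

Lemma chi_funF A x : ~ A x -> chi_fun Z A x = 0.
Proof. by move=> Ax; rewrite /chi_fun memNset. Qed.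

Lemma chi_ae A B : measurable A -> measurable B ->
  {ae mu, forall x, A x <-> B x} -> Linf_chi mu Z A = Linf_chi mu Z B.
Proof.
move=> mA mB AB; apply: Linf_ext.
apply: filterS3 (repr_chi mA) (repr_chi mB) AB => x -> -> [AxB BxA].
have [Ax|Ax] := pselect (A x); first by rewrite !chi_funT//; exact: AxB.
by rewrite !chi_funF// => /BxA.
Qed.

Lemma chiM A B : measurable A -> measurable B ->
  Linf_chi mu Z A * Linf_chi mu Z B = Linf_chi mu Z (A `&` B).
Proof.
move=> mA mB; have mAB : measurable (A `&` B) by exact: measurableI.
apply: Linf_ext; apply: filterS3 (repr_mul (Linf_chi mu Z A) (Linf_chi mu Z B))
  (repr_chi mA) (filterI (repr_chi mB) (repr_chi mAB)) => x -> -> [-> ->].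
have [Ax|Ax] := pselect (A x); last first.
  by rewrite [in LHS]chi_funF // mul0r chi_funF // => -[].
rewrite [in LHS]chi_funT // mul1r; have [Bx|Bx] := pselect (B x).
  by rewrite !chi_funT.
by rewrite !chi_funF // => -[].
Qed.

Lemma chi_setT : Linf_chi mu Z setT = 1.
Proof.
by apply: Linf_ext; apply: filterS2 (repr_chi measurableT) repr_one => x -> ->;
  rewrite chi_funT.
Qed.

Lemma chi_set0 : Linf_chi mu Z set0 = 0.
Proof.
by apply: Linf_ext; apply: filterS2 (repr_chi measurable0) repr_zero => x -> ->;
  rewrite chi_funF.
Qed.

Lemma chi_null A : measurable A -> {ae mu, forall x, ~ A x} -> Linf_chi mu Z A = 0.
Proof.
move=> mA A0; rewrite -chi_set0; apply: chi_ae => //.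
by apply: filterS A0 => x nA; split.
Qed.

Lemma chi_mul_eq A u v : measurable A ->
  {ae mu, forall x, A x -> repr u x = repr v x} ->
  Linf_chi mu Z A * u = Linf_chi mu Z A * v.
Proof.
move=> mA uv; apply: Linf_ext; apply: filterS3 (repr_mul (Linf_chi mu Z A) u)
  (repr_mul (Linf_chi mu Z A) v) (filterI (repr_chi mA) uv) => x -> -> [->].
have [Ax ->//|Ax _] := pselect (A x).
by rewrite chi_funF // !mul0r.
Qed.

Lemma chi_sum I (r : seq I) (F : I -> set X) B : measurable B ->
  (forall i, measurable (F i)) ->
  {ae mu, forall x, B x -> \sum_(i <- r) chi_fun Z (F i) x = 1} ->
  {ae mu, forall x, ~ B x -> forall i, ~ F i x} ->
  \sum_(i <- r) Linf_chi mu Z (F i) = Linf_chi mu Z B.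
Proof.
move=> mB mF FB nFB; apply: Linf_ext.
have : {ae mu, forall x, repr (\sum_(i <- r) Linf_chi mu Z (F i)) x =
    \sum_(i <- r) chi_fun Z (F i) x}.
  elim: r {FB} => [|i r IHr].
    by rewrite big_nil; apply: filterS repr_zero => x ->; rewrite big_nil.
  rewrite big_cons; apply: filterS3 IHr (repr_chi (mF i))
    (repr_add (Linf_chi mu Z (F i)) (\sum_(j <- r) Linf_chi mu Z (F j))) => x Er Ei ->.
  by rewrite big_cons Er Ei.
move=> E; apply: filterS3 E (repr_chi mB) (filterI FB nFB) => x -> -> [H1 H2].
have [Bx|Bx] := pselect (B x); first by rewrite H1 // chi_funT.
by rewrite chi_funF // big1 // => i _; rewrite chi_funF //; exact: H2.
Qed.

Lemma Linf_cstD y z : Linf_cst mu (y + z) = Linf_cst mu y + Linf_cst mu z :> Linf mu Z.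
Proof. by rewrite /Linf_cst -Linf_classD; congr Linf_class; apply: val_inj. Qed.

Lemma Linf_cstM y z : Linf_cst mu (y * z) = Linf_cst mu y * Linf_cst mu z :> Linf mu Z.
Proof. by rewrite /Linf_cst -Linf_classM; congr Linf_class; apply: val_inj. Qed.

Lemma Linf_cst1 : Linf_cst mu 1 = 1 :> Linf mu Z.
Proof. by rewrite /Linf_cst -Linf_class1; congr Linf_class; apply: val_inj. Qed.

Lemma Linf_cst0 : Linf_cst mu 0 = 0 :> Linf mu Z.
Proof. by rewrite /Linf_cst -Linf_class0; congr Linf_class; apply: val_inj. Qed.

Lemma repr_cst z : {ae mu, forall x, repr (Linf_cst mu z : Linf mu Z) x = z}.
Proof. by apply: filterS (reprK_ae (Bmf (bmf_cst mu z))) => x ->. Qed.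

End LinfTheory.

Section LinfAction.
Variables (R : realType) (d : measure_display) (X : measurableType d).
Variables (mu : probability X R) (G : groupType) (a : standardAction mu G).
Variable Z : normedCoeff R.
Local Notation b := (Linf_action a Z).

Lemma repr_shift s (u : Linf mu Z) :
  {ae mu, forall x, repr (b s u) x = repr u (a s^-1%g x)}.
Proof. exact: reprK_ae. Qed.

Lemma sactK s : cancel (a s) (a s^-1%g).
Proof. by move=> x; rewrite -sactM mulVg sact1. Qed.

Lemma sactVK s : cancel (a s^-1%g) (a s).
Proof. by move=> x; rewrite -sactM mulgV sact1. Qed.

Lemma sact_preimage_measurable s A : measurable A -> measurable (a s @^-1` A).
Proof. by move=> mA; rewrite -[_ @^-1` _]setTI; exact: sact_measurable. Qed.

Lemma shift_chi s A : measurable A ->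
  b s (Linf_chi mu Z A) = Linf_chi mu Z (a s^-1%g @^-1` A).
Proof.
move=> mA; apply: Linf_ext.
have H := ae_sact a s^-1%g (repr_chi mu Z mA).
apply: filterS3 (repr_shift s (Linf_chi mu Z A)) H
  (repr_chi mu Z (sact_preimage_measurable s^-1%g mA)) => x -> -> ->.
by [].
Qed.

Lemma shift_cst s z : b s (Linf_cst mu z) = Linf_cst mu z.
Proof.
apply: Linf_ext; apply: filterS3 (repr_shift s (Linf_cst mu z))
  (ae_sact a s^-1%g (repr_cst mu z)) (repr_cst mu z) => x -> -> -> //.
Qed.

Local Notation ZG := (crossed (trivial_ringAction G Z)).

Lemma const_crossedE (r : ZG) s : const_crossed a r s = Linf_cst mu (r s).
Proof. by []. Qed.

Lemma const_crossed_single z s :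
  const_crossed a (single (trivial_ringAction G Z) z s) = single b (Linf_cst mu z) s.
Proof.
apply: crossed_ext => t; rewrite const_crossedE !singleE.
by case: ifP => // _; rewrite Linf_cst0.
Qed.

Lemma const_crossedD (r r' : ZG) :
  const_crossed a (r + r') = const_crossed a r + const_crossed a r'.
Proof.
by apply: crossed_ext => t; rewrite crossedD !const_crossedE crossedD Linf_cstD.
Qed.

Lemma const_crossed0 : const_crossed a (0 : ZG) = 0.
Proof. by rewrite -(single0 _ 1%g) const_crossed_single Linf_cst0 single0. Qed.

Lemma const_crossedM (r r' : ZG) :
  const_crossed a (r * r') = const_crossed a r * const_crossed a r'.
Proof.
elim/crossed_ind: r => [|x1 x2 IH1 IH2|u g].
- by rewrite mul0r const_crossed0 mul0r.
- by rewrite mulrDl !const_crossedD IH1 IH2 mulrDl.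
elim/crossed_ind: r' => [|x1 x2 IH1 IH2|v k].
- by rewrite mulr0 const_crossed0 mulr0.
- by rewrite mulrDr !const_crossedD IH1 IH2 mulrDr.
by rewrite singleM !const_crossed_single singleM shift_cst Linf_cstM.
Qed.

Lemma const_crossed_act (r : ZG) z :
  Linf_cst mu (crossed_act r z) = crossed_act (const_crossed a r) (Linf_cst mu z).
Proof.
elim/crossed_ind: r => [|x1 x2 IH1 IH2|u g].
- by rewrite const_crossed0 !crossed_act0l Linf_cst0.
- by rewrite const_crossedD !crossed_actDl Linf_cstD IH1 IH2.
by rewrite const_crossed_single !crossed_act_single shift_cst Linf_cstM.
Qed.

End LinfAction.

(** * Modules over a crossed product from covariant pairs of actions *)

Section Covariant.
Variables (G : groupType) (L : pzRingType) (a : ringAction G L) (V : zmodType).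
Variables (lsc : L -> V -> V) (rho : G -> V -> V).
Hypotheses (lscDl : forall u v x, lsc (u + v) x = lsc u x + lsc v x).
Hypotheses (lscDr : forall u x y, lsc u (x + y) = lsc u x + lsc u y).
Hypotheses (lscM : forall u v x, lsc (u * v) x = lsc u (lsc v x)).
Hypotheses (lsc1 : forall x, lsc 1 x = x).
Hypotheses (rhoD : forall s x y, rho s (x + y) = rho s x + rho s y).
Hypotheses (rhoM : forall s t x, rho (s * t)%g x = rho s (rho t x)).
Hypotheses (rho1 : forall x, rho 1%g x = x).
Hypotheses (rhoZ : forall s u x, rho s (lsc u x) = lsc (a s u) (rho s x)).

Definition cov_scale (r : crossed a) (x : V) : V := ext (fun u s => lsc u (rho s x)) r.

Lemma cov_single u s x : cov_scale (single a u s) x = lsc u (rho s x).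
Proof. by apply: ext_single => t v w; exact: lscDl. Qed.

Lemma cov_scaleDl x : {morph cov_scale^~ x : r s / r + s}.
Proof. by move=> r s; apply: extD => t v w; exact: lscDl. Qed.

Lemma cov_scale0l x : cov_scale 0 x = 0.
Proof. by apply: (addIr (cov_scale 0 x)); rewrite -cov_scaleDl !add0r. Qed.

Lemma cov_scaleDr : right_distributive cov_scale +%R.
Proof.
move=> r x y; rewrite /cov_scale /ext -big_split; apply: eq_bigr => s _.
by rewrite rhoD lscDr.
Qed.

Lemma cov_scale0r r : cov_scale r 0 = 0.
Proof. by apply: (addIr (cov_scale r 0)); rewrite -cov_scaleDr !add0r. Qed.

Lemma cov_scale1 : left_id 1 cov_scale.
Proof. by move=> x; rewrite -single11 cov_single rho1 lsc1. Qed.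

Lemma cov_scaleA r s x : cov_scale r (cov_scale s x) = cov_scale (r * s) x.
Proof.
elim/crossed_ind: r => [|x1 x2 IH1 IH2|u g].
- by rewrite mul0r !cov_scale0l.
- by rewrite mulrDl !cov_scaleDl IH1 IH2.
elim/crossed_ind: s => [|x1 x2 IH1 IH2|v k].
- by rewrite mulr0 !cov_scale0l cov_scale0r.
- by rewrite mulrDr !cov_scaleDl cov_scaleDr IH1 IH2.
by rewrite singleM !cov_single rhoZ rhoM lscM.
Qed.

End Covariant.

(** * Functions with finitely many values *)

Section Simple.
Variables (R : realType) (d : measure_display) (X : measurableType d).
Variables (mu : probability X R).

Definition simple_range (T : choiceType) (v : X -> T) (s : seq T) : Prop :=
  uniq s /\ forall x, v x \in s.

(** With finite range and measurable fibers, composing with an arbitrary map of values stays simple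
    although [T] carries no sigma-algebra. Lifting step functions value by value rests on this. *)
Definition simple (T : choiceType) (v : X -> T) : Prop :=
  (exists s : seq T, simple_range v s) /\ forall t, measurable (v @^-1` [set t]).

Definition asimple (T : choiceType) (u : X -> T) : Prop :=
  exists2 v, simple v & {ae mu, forall x, u x = v x}.

Lemma simple_preimage (T : choiceType) (v : X -> T) (S : set T) :
  simple v -> measurable (v @^-1` S).
Proof.
move=> [[s [us vs]] mv].
have -> : v @^-1` S = \bigcup_(t in [set t | t \in s /\ S t]) (v @^-1` [set t]).
  by apply/seteqP; split=> [x Sx|x [t [_ St] vxt]]; [exists (v x)|rewrite /preimage /= vxt].
apply: fin_bigcup_measurable => // .
by apply: (@sub_finite_set _ _ [set` s]) => [t []|]; last exact: finite_seq.
Qed.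

Lemma simple_cst (T : choiceType) (t : T) : simple (fun=> t).
Proof.
split; first by exists [:: t]; split => // x; rewrite inE.
by move=> t'; rewrite preimage_cst; case: ifP.
Qed.

Lemma simple_op2 (T1 T2 T : choiceType) (op : T1 -> T2 -> T) v w :
  simple v -> simple w -> simple (fun x => op (v x) (w x)).
Proof.
move=> [[s [us vs]] mv] [[s' [us' ws]] mw]; split.
  exists (undup [seq op t t' | t <- s, t' <- s']); split; first exact: undup_uniq.
  move=> x; rewrite mem_undup; apply/allpairsP; exists (v x, w x).
  by split=> //; [exact: vs|exact: ws].
move=> t.
have -> : (fun x => op (v x) (w x)) @^-1` [set t] =
    \bigcup_(p in [set p | p \in [seq (p, p') | p <- s, p' <- s'] /\ op p.1 p.2 = t])
      (v @^-1` [set p.1] `&` w @^-1` [set p.2]).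
  apply/seteqP; split=> [x xt|x [[p p'] [_ /= <-] [/= <- <-]] //].
  exists (v x, w x) => //; split => //; apply/allpairsP; exists (v x, w x).
  by split=> //; [exact: vs|exact: ws].
apply: fin_bigcup_measurable => [|p _]; last exact: measurableI.
apply: (@sub_finite_set _ _ [set` [seq (p, p') | p <- s, p' <- s']]) => [p []//|].
exact: finite_seq.
Qed.

Lemma simple_comp (T T' : choiceType) (f : T -> T') v : simple v -> simple (f \o v).
Proof. by move=> sv; exact: (simple_op2 (fun t _ => f t) sv sv). Qed.

Lemma asimple_simple (T : choiceType) (v : X -> T) : simple v -> asimple v.
Proof. by move=> sv; exists v => //; exact: nearW. Qed.

Lemma asimple_op2 (T1 T2 T : choiceType) (op : T1 -> T2 -> T) u u' :
  asimple u -> asimple u' -> asimple (fun x => op (u x) (u' x)).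
Proof.
move=> [v sv uv] [w sw uw]; exists (fun x => op (v x) (w x)); first exact: simple_op2.
by apply: filterS2 uv uw => x -> ->.
Qed.

Lemma asimple_comp (T T' : choiceType) (f : T -> T') u : asimple u -> asimple (f \o u).
Proof. by move=> su; exact: (asimple_op2 (fun t _ => f t) su su). Qed.

Lemma asimple_shift (G : groupType) (a : standardAction mu G) s (T : choiceType) u :
  @asimple T u -> @asimple T (u \o a s).
Proof.
move=> [v [[r [ur vr]] mv] uv]; exists (v \o a s); last exact: (ae_sact a s uv).
split; first by exists r; split => // x; exact: vr.
by move=> t; rewrite comp_preimage; exact: sact_preimage_measurable.
Qed.

Variable Z : normedCoeff R.

Definition finite_balls : Prop := forall C : R, finite_set [set z : Z | coeff_norm z <= C].

(** Off a null set the values lie in one ball of the coefficients, and balls are finite. *)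
Lemma bmf_asimple (f : bmf mu Z) : finite_balls -> asimple f.
Proof.
move=> fb; case: f => f /= /asboolP[mf [C fC]].
exists (fun x => if coeff_norm (f x) <= C then f x else 0); last first.
  by apply: filterS fC => x ->.
split.
  exists (undup (0 :: fset_set [set z : Z | coeff_norm z <= C])); split.
    exact: undup_uniq.
  move=> x; rewrite mem_undup inE; case: ifPn => [fx|_]; last by rewrite eqxx.
  rewrite in_fset_set; last exact: fb.
  by rewrite (mem_set (fx : [set z : Z | coeff_norm z <= C] (f x))) orbT.
move=> t; have := mf [set z | (if coeff_norm z <= C then z else 0) = t].
by [].
Qed.

Lemma simple_bmf (v : X -> Z) : simple v -> bmf_pred mu v.
Proof.
move=> sv; apply/asboolP; split; first by move=> S; exact: simple_preimage.
have [[s [us vs]] _] := sv.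
exists (\sum_(z <- s) coeff_norm z); apply: nearW => x.
rewrite (bigD1_seq (v x)) //= lerDl sumr_ge0 // => z _.
exact: coeff_norm_ge0.
Qed.

Lemma chi_split (T : choiceType) (v : X -> T) s A : simple v -> simple_range v s ->
  measurable A ->
  Linf_chi mu Z A = \sum_(t <- s) Linf_chi mu Z (A `&` v @^-1` [set t]).
Proof.
move=> [_ mv] [us vs] mA; apply/esym/chi_sum => //.
- by move=> t; exact: measurableI.
- apply: nearW => x Ax; rewrite (bigD1_seq (v x)) //= chi_funT // big1 ?addr0 // => t.
  by move=> /eqP tv; rewrite chi_funF // => -[_] /esym.
- by apply: nearW => x Ax t [].
Qed.

End Simple.

(** * Step functions with values in a module *)

Section StepFunctions.
Variables (R : realType) (d : measure_display) (X : measurableType d).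
Variables (mu : probability X R).

Section Def.
Variable E : zmodType.

Definition asimple_pred : pred (X -> E) := fun u => `[< asimple mu u >].

Lemma asimple_zmod_closed : zmod_closed asimple_pred.
Proof.
split=> [|u v /asboolP su /asboolP sv]; apply/asboolP.
  by apply: asimple_simple; exact: simple_cst.
exact: (asimple_op2 (fun x y => x - y) su sv).
Qed.

HB.instance Definition _ :=
  GRing.isZmodClosed.Build (X -> E) asimple_pred asimple_zmod_closed.

Record stepfun := Stepfun { stepfun_val :> X -> E; _ : asimple_pred stepfun_val }.

HB.instance Definition _ := [isSub for stepfun_val].
HB.instance Definition _ := [Choice of stepfun by <:].
HB.instance Definition _ := [SubChoice_isSubZmodule of stepfun by <:].

Definition stepfun0 : {pred stepfun} := fun u => `[< {ae mu, forall x, u x = 0} >].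

Lemma stepfun0_zmod_closed : zmod_closed stepfun0.
Proof.
split=> [|u v /asboolP u0 /asboolP v0]; apply/asboolP; first exact: nearW.
by apply: filterS2 u0 v0 => x ux vx; rewrite [LHS](_ : _ = u x - v x) // ux vx subr0.
Qed.

HB.instance Definition _ := GRing.isZmodClosed.Build stepfun stepfun0 stepfun0_zmod_closed.

(* Measurable functions to E with finite range modulo almost everywhere       *)
(* equality, a model of the tensor product of L^oo(X, Z) and E.               *)
Definition steps : Type := {ideal_quot (stepfun0 : zmodClosed stepfun)}.

HB.instance Definition _ := GRing.Zmodule.on steps.
HB.instance Definition _ := EqQuotient.on steps.

Definition steps_class (u : stepfun) : steps := \pi_steps u.

Lemma steps_class_eq (u v : stepfun) :
  {ae mu, forall x, u x = v x} -> steps_class u = steps_class v.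
Proof.
move=> uv; have E0 : (u - v \in (stepfun0 : zmodClosed stepfun)) = (steps_class u == steps_class v).
  exact: Quotient.idealrBE.
apply/eqP; rewrite -E0; apply/asboolP; apply: filterS uv => x uvx.
by apply/eqP; rewrite subr_eq0; apply/eqP.
Qed.

Lemma steps_class_inj (u v : stepfun) :
  steps_class u = steps_class v -> {ae mu, forall x, u x = v x}.
Proof.
have E0 : (u - v \in (stepfun0 : zmodClosed stepfun)) = (steps_class u == steps_class v).
  exact: Quotient.idealrBE.
move/eqP; rewrite -E0 => /asboolP; apply: filterS => x /eqP.
by rewrite subr_eq0 => /eqP.
Qed.

Lemma stepfunP (u : stepfun) : asimple mu u. Proof. by case: u => u /= /asboolP. Qed.

Definition steps_of (u : X -> E) (su : asimple mu u) : steps :=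
  steps_class (Stepfun (asboolT su)).

Lemma repr_steps_of u (su : asimple mu u) : {ae mu, forall x, repr (steps_of su) x = u x}.
Proof.
have /steps_class_inj : steps_class (repr (steps_of su)) = steps_class (Stepfun (asboolT su)).
  exact: reprK.
exact.
Qed.

Lemma steps_ext (x y : steps) : {ae mu, forall p, repr x p = repr y p} -> x = y.
Proof.
move=> xy; have K z : steps_class (repr z) = z by exact: reprK.
by rewrite -[x]K -[y]K; exact: steps_class_eq.
Qed.

Lemma repr_stepsD (x y : steps) : {ae mu, forall p, repr (x + y) p = repr x p + repr y p}.
Proof.
have K z : steps_class (repr z) = z by exact: reprK.
have -> : x + y = steps_class (repr x + repr y).
  by rewrite -{1}[x]K -{1}[y]K; symmetry; exact: (raddfD (\pi_steps)).
by apply: filterS (steps_class_inj (reprK (steps_class (repr x + repr y)))) => p ->.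
Qed.

Lemma repr_steps0 : {ae mu, forall p, repr (0 : steps) p = 0}.
Proof.
have -> : (0 : steps) = steps_class 0 by symmetry; exact: (raddf0 (\pi_steps)).
by apply: filterS (steps_class_inj (reprK (steps_class 0))) => p ->.
Qed.

Lemma repr_steps_simple (x : steps) : exists v : X -> E,
  simple v /\ {ae mu, forall p, repr x p = v p}.
Proof. by have [v sv xv] := stepfunP (repr x); exists v. Qed.

End Def.

End StepFunctions.

(* a and fb do not occur in the carrier; they determine the module structure. *)
Definition smod (R : realType) (d : measure_display) (X : measurableType d)
    (mu : probability X R) (G : groupType) (a : standardAction mu G)
    (Z : normedCoeff R) (fb : finite_balls Z)
    (E : lmodType (crossed (trivial_ringAction G Z))) : Type := steps mu E.

Section StepModule.
Variables (R : realType) (d : measure_display) (X : measurableType d).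
Variables (mu : probability X R) (G : groupType) (a : standardAction mu G).
Variables (Z : normedCoeff R) (fb : finite_balls Z).
Local Notation tr := (trivial_ringAction G Z).
Local Notation b := (Linf_action a Z).
Local Notation zsc z e := (single tr z 1%g *: e).
Local Notation gsc s e := (single tr 1 s *: e).

Section Def.
Variable E : lmodType (crossed tr).
Local Notation V := (steps mu E).

Lemma steps_scale_subproof (u : Linf mu Z) (x : V) :
  asimple mu (fun p => zsc (repr u p) (repr x p)).
Proof.
exact: (asimple_op2 (fun z e => zsc z e) (bmf_asimple (repr u) fb) (stepfunP (repr x))).
Qed.

Definition steps_scale u x : V := steps_of (steps_scale_subproof u x).

Lemma steps_shift_subproof s (x : V) :
  asimple mu (fun p => gsc s (repr x (a s^-1%g p))).
Proof.
exact: (asimple_comp (fun e : E => gsc s e) (asimple_shift a s^-1%g (stepfunP (repr x)))).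
Qed.

Definition steps_shift s x : V := steps_of (steps_shift_subproof s x).

Lemma repr_steps_scale u x :
  {ae mu, forall p, repr (steps_scale u x) p = zsc (repr u p) (repr x p)}.
Proof. exact: repr_steps_of. Qed.

Lemma repr_steps_shift s x :
  {ae mu, forall p, repr (steps_shift s x) p = gsc s (repr x (a s^-1%g p))}.
Proof. exact: repr_steps_of. Qed.

Lemma steps_scaleDl u v x : steps_scale (u + v) x = steps_scale u x + steps_scale v x.
Proof.
apply: steps_ext.
apply: filterS3 (repr_steps_scale (u + v) x) (repr_stepsD (steps_scale u x) (steps_scale v x))
  (filterI (repr_add u v) (filterI (repr_steps_scale u x) (repr_steps_scale v x)))
  => p -> -> [-> [-> ->]].
by rewrite -scalerDl -singleD.
Qed.

Lemma steps_scaleDr u x y : steps_scale u (x + y) = steps_scale u x + steps_scale u y.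
Proof.
apply: steps_ext.
apply: filterS3 (repr_steps_scale u (x + y)) (repr_stepsD (steps_scale u x) (steps_scale u y))
  (filterI (repr_stepsD x y) (filterI (repr_steps_scale u x) (repr_steps_scale u y)))
  => p -> -> [-> [-> ->]].
by rewrite scalerDr.
Qed.

Lemma steps_scaleM u v x : steps_scale (u * v) x = steps_scale u (steps_scale v x).
Proof.
apply: steps_ext.
apply: filterS3 (repr_steps_scale (u * v) x) (repr_steps_scale u (steps_scale v x))
  (filterI (repr_mul u v) (repr_steps_scale v x)) => p -> -> [-> ->].
by rewrite scalerA singleM mulg1.
Qed.

Lemma steps_scale1 x : steps_scale 1 x = x.
Proof.
apply: steps_ext; apply: filterS2 (repr_steps_scale 1 x) (repr_one mu Z) => p -> ->.
by rewrite single11 scale1r.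
Qed.

Lemma steps_shiftD s x y : steps_shift s (x + y) = steps_shift s x + steps_shift s y.
Proof.
apply: steps_ext.
apply: filterS3 (repr_steps_shift s (x + y)) (repr_stepsD (steps_shift s x) (steps_shift s y))
  (filterI (ae_sact a s^-1%g (repr_stepsD x y))
    (filterI (repr_steps_shift s x) (repr_steps_shift s y))) => p -> -> [-> [-> ->]].
by rewrite scalerDr.
Qed.

Lemma steps_shiftM s t x : steps_shift (s * t)%g x = steps_shift s (steps_shift t x).
Proof.
apply: steps_ext.
apply: filterS3 (repr_steps_shift (s * t)%g x) (repr_steps_shift s (steps_shift t x))
  (ae_sact a s^-1%g (repr_steps_shift t x)) => p -> -> ->.
by rewrite scalerA singleM mulr1 invgM sactM.
Qed.

Lemma steps_shift1 x : steps_shift 1%g x = x.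
Proof.
apply: steps_ext; apply: filterS (repr_steps_shift 1%g x) => p ->.
by rewrite invg1 sact1 single11 scale1r.
Qed.

Lemma steps_shiftZ s u x : steps_shift s (steps_scale u x) = steps_scale (b s u) (steps_shift s x).
Proof.
apply: steps_ext.
apply: filterS3 (repr_steps_shift s (steps_scale u x)) (repr_steps_scale (b s u) (steps_shift s x))
  (filterI (ae_sact a s^-1%g (repr_steps_scale u x))
    (filterI (repr_shift a s u) (repr_steps_shift s x))) => p -> -> [-> [-> ->]].
by rewrite !scalerA !singleM mulg1 mul1g mulr1 mul1r.
Qed.

Local Notation smod := (smod a fb E).

HB.instance Definition _ := GRing.Zmodule.on smod.

HB.instance Definition _ := GRing.Zmodule_isLmodule.Build (crossed b) smod
  (cov_scaleA steps_scaleDl steps_scaleDr steps_scaleM steps_shiftD steps_shiftM steps_shiftZ)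
  (cov_scale1 b steps_scaleDl steps_scale1 steps_shift1)
  (cov_scaleDr steps_scaleDr steps_shiftD)
  (cov_scaleDl steps_shift steps_scaleDl).

Lemma smod_single (u : Linf mu Z) s (x : smod) :
  single b u s *: x = steps_scale u (steps_shift s x).
Proof. exact: (cov_single b _ steps_scaleDl). Qed.

End Def.

Local Notation smod E := (smod a fb E).

Section Map.
Variables (E E' : lmodType (crossed tr)) (f : {linear E -> E'}).

Definition smap (x : smod E) : smod E' := steps_of (asimple_comp f (stepfunP (repr x))).

Lemma repr_smap x : {ae mu, forall p, repr (smap x) p = f (repr x p)}.
Proof. by apply: filterS (repr_steps_of (asimple_comp f (stepfunP (repr x)))) => p ->. Qed.

Lemma smapD x y : smap (x + y) = smap x + smap y.
Proof.
apply: steps_ext.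
apply: filterS3 (repr_smap (x + y)) (repr_stepsD (smap x) (smap y))
  (filterI (repr_stepsD x y) (filterI (repr_smap x) (repr_smap y))) => p -> -> [-> [-> ->]].
by rewrite linearD.
Qed.

Lemma smap_scale u x : smap (steps_scale u x) = steps_scale u (smap x).
Proof.
apply: steps_ext.
apply: filterS3 (repr_smap (steps_scale u x)) (repr_steps_scale u (smap x))
  (filterI (repr_steps_scale u x) (repr_smap x)) => p -> -> [-> ->].
by rewrite linearZ.
Qed.

Lemma smap_shift s x : smap (steps_shift s x) = steps_shift s (smap x).
Proof.
apply: steps_ext.
apply: filterS3 (repr_smap (steps_shift s x)) (repr_steps_shift s (smap x))
  (filterI (repr_steps_shift s x) (ae_sact a s^-1%g (repr_smap x))) => p -> -> [-> ->].
by rewrite linearZ.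
Qed.

Lemma smapZ r x : smap (r *: x) = r *: smap x.
Proof.
elim/crossed_ind: r => [|r1 r2 IH1 IH2|u s].
- rewrite !scale0r; apply: (addIr (smap 0)); rewrite -smapD !add0r //.
- by rewrite !scalerDl smapD IH1 IH2.
by rewrite !smod_single smap_scale smap_shift.
Qed.

Lemma smap_is_linear : linear smap.
Proof. by move=> r x y; rewrite smapD smapZ. Qed.

HB.instance Definition _ :=
  GRing.isLinear.Build (crossed b) (smod E) (smod E') _ smap smap_is_linear.

End Map.

(** A set-theoretic choice of preimages on the kernel of [g] is applied to the finitely many values;
    the result is again a step function. *)
Lemma smap_exact (E E' E'' : lmodType (crossed tr)) (f : {linear E -> E'})
    (g : {linear E' -> E''}) :
  (forall x, g x = 0 -> exists y, f y = x) ->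
  forall x, smap g x = 0 -> exists y, smap f y = x.
Proof.
move=> ex x gx0.
have /choice[h hP] : forall e, exists y, g e = 0 -> f y = e.
  by move=> e; have [/ex[y <-]|ne] := pselect (g e = 0); [exists y|exists 0].
exists (steps_of (asimple_comp h (stepfunP (repr x)))); apply: steps_ext.
have H : {ae mu, forall p, g (repr x p) = 0}.
  apply: filterS2 (repr_smap g x) (repr_steps0 mu E'') => p.
  by rewrite gx0 => -> ->.
apply: filterS3 (repr_smap f (steps_of (asimple_comp h (stepfunP (repr x)))))
  (repr_steps_of (asimple_comp h (stepfunP (repr x)))) H => p -> -> Hp.
by rewrite hP.
Qed.

End StepModule.

(** * Extending a Z G-linear map to step functions *)

Section StepMap.
Variables (R : realType) (d : measure_display) (X : measurableType d).
Variables (mu : probability X R) (G : groupType) (a : standardAction mu G).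
Variables (Z : normedCoeff R) (fb : finite_balls Z).
Local Notation tr := (trivial_ringAction G Z).
Local Notation b := (Linf_action a Z).
Local Notation chi := (Linf_chi mu Z).
Local Notation "u *~: m" := (single b u 1%g *: m) (at level 40).

Lemma single1Z0 (M : lmodType (crossed b)) (m : M) : 0 *~: m = 0.
Proof. by rewrite single0 scale0r. Qed.

Lemma single1Z_sum (M : lmodType (crossed b)) I (r : seq I) F (m : M) :
  (\sum_(i <- r) F i) *~: m = \sum_(i <- r) F i *~: m.
Proof. by rewrite single_sum scaler_suml. Qed.

Lemma single1ZM (M : lmodType (crossed b)) u v (m : M) : u *~: (v *~: m) = (u * v) *~: m.
Proof. by rewrite scalerA singleM ract1 mulg1. Qed.

Lemma single1Z1 (M : lmodType (crossed b)) (m : M) : 1 *~: m = m.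
Proof. by rewrite single11 scale1r. Qed.

Lemma chi_split_eq (M : lmodType (crossed b)) (T : choiceType) (v : X -> T) A (m m' : M) :
  simple v -> measurable A ->
  (forall t, chi (A `&` v @^-1` [set t]) *~: m = chi (A `&` v @^-1` [set t]) *~: m') ->
  chi A *~: m = chi A *~: m'.
Proof.
move=> sv mA eqs; have [[s sP] _] := sv.
rewrite (chi_split mu Z sv sP mA) !single1Z_sum.
by apply: eq_bigr => t _; exact: eqs.
Qed.

Variables (E : lmodType (crossed tr)).

Section Represents.
Variables (M : lmodType (crossed b)) (psi : E -> M).
Hypothesis psiD : forall e e', psi (e + e') = psi e + psi e'.
Hypothesis psiZ : forall r e, psi (r *: e) = const_crossed a r *: psi e.

(* m is the section of M that equals psi e where the step function u equals e *)
Definition represents (u : X -> E) (m : M) : Prop :=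
  forall A e, measurable A -> {ae mu, forall x, A x -> u x = e} ->
    chi A *~: m = chi A *~: psi e.

Lemma represents_ae u u' m : {ae mu, forall x, u x = u' x} ->
  represents u m -> represents u' m.
Proof.
move=> uu' um A e mA u'e; apply: um => //.
by apply: filterS2 uu' u'e => x ->.
Qed.

Lemma represents_fiber u m e : simple u -> represents u m ->
  chi (u @^-1` [set e]) *~: m = chi (u @^-1` [set e]) *~: psi e.
Proof. by move=> su um; apply: um; [exact: simple_preimage|exact: nearW]. Qed.

(** Reduces the condition over all [A] and [e] to the fibers of one simple function: a fiber on
    which the value is not [e] meets [A] in a null set. *)
Lemma represents_fine (T : choiceType) (t : X -> T) (h : T -> E) u m : simple t ->
  {ae mu, forall x, u x = h (t x)} ->
  (forall i, chi (t @^-1` [set i]) *~: m = chi (t @^-1` [set i]) *~: psi (h i)) ->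
  represents u m.
Proof.
move=> st uh tm A e mA ue; apply: (chi_split_eq st mA) => i.
set B := t @^-1` [set i]; have mB : measurable B by exact: simple_preimage.
have [<-|hie] := eqVneq (h i) e.
  by rewrite -chiM // -!single1ZM tm.
rewrite chi_null ?single1Z0 //; first exact: measurableI.
apply: filterS2 uh ue => x uhx uex [Ax Bx].
by move/eqP: hie; apply; rewrite -(uex Ax) uhx Bx.
Qed.

Lemma represents_unique u m m' : asimple mu u ->
  represents u m -> represents u m' -> m = m'.
Proof.
move=> [v sv uv] /(represents_ae uv) vm /(represents_ae uv) vm'.
rewrite -[m]single1Z1 -[m']single1Z1 -chi_setT.
by apply: (chi_split_eq sv) => // e; rewrite setTI !represents_fiber.
Qed.

Lemma represents_exists u : asimple mu u -> exists m, represents u m.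
Proof.
move=> [v sv uv]; have [[s [us vs]] mv] := sv.
exists (\sum_(e <- s) chi (v @^-1` [set e]) *~: psi e).
have vu : {ae mu, forall x, v x = u x} by apply: filterS uv => x ->.
apply: (represents_ae vu); apply: (@represents_fine _ v id _ _ sv) => [|e].
  exact: nearW.
have mE e' : measurable (v @^-1` [set e']) by exact: mv.
have [es|es] := boolP (e \in s); last first.
  rewrite chi_null ?single1Z0 //; apply: nearW => x vxe.
  by move/negP: es; apply; rewrite -(vxe : v x = e).
rewrite (bigD1_seq e) //= scalerDr single1ZM chiM // setIid scaler_sumr.
rewrite big1 ?addr0 // => e' /eqP ee'; rewrite single1ZM chiM // chi_null ?single1Z0 //.
  exact: measurableI.
by apply: nearW => x [xe xe']; apply: ee'; rewrite -(xe : v x = e) -(xe' : v x = e').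
Qed.

Lemma represents_add u u' m m' : asimple mu u -> asimple mu u' ->
  represents u m -> represents u' m' -> represents (fun x => u x + u' x) (m + m').
Proof.
move=> [v sv uv] [v' sv' uv'] /(represents_ae uv) vm /(represents_ae uv') vm'.
apply: (@represents_fine _ (fun x => (v x, v' x)) (fun p => p.1 + p.2)).
- exact: simple_op2.
- by apply: filterS2 uv uv' => x -> ->.
move=> [e e']; rewrite psiD !scalerDr.
have mB : measurable ((fun x => (v x, v' x)) @^-1` [set (e, e')]).
  by apply: simple_preimage; exact: simple_op2.
by congr (_ + _); [apply: vm|apply: vm'] => //; apply: nearW => x [].
Qed.

Lemma represents_scale u m f : asimple mu u -> represents u m ->
  represents (fun x => single tr (repr (f : Linf mu Z) x) 1%g *: u x) (f *~: m).
Proof.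
move=> [v sv uv] /(represents_ae uv) vm.
(* The level sets are refined by the values of [f]. On each piece [f] is almost everywhere a
   constant, and constants act through Z G, where [psi] is linear. *)
have [w sw fw] := bmf_asimple (repr f) fb.
apply: (@represents_fine _ (fun x => (w x, v x)) (fun p => single tr p.1 1%g *: p.2)).
- exact: simple_op2.
- by apply: filterS2 uv fw => x -> ->.
move=> [z e]; set B := _ @^-1` _.
have mB : measurable B by apply: simple_preimage; exact: simple_op2.
rewrite psiZ const_crossed_single !single1ZM.
transitivity (f *~: (chi B *~: m)); first by rewrite single1ZM mulrC.
rewrite (vm B e mB) ?single1ZM; last by apply: nearW => x [].
congr (single b _ 1%g *: _); rewrite mulrC; apply: chi_mul_eq => //.
by apply: filterS2 fw (repr_cst mu z) => x -> -> [].
Qed.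

Lemma represents_shift u m s : represents u m ->
  represents (fun x => single tr 1 s *: u (a s^-1%g x)) (single b 1 s *: m).
Proof.
move=> um A e mA ue.
have E1 (m' : M) : chi A *~: (single b 1 s *: m') =
    single b 1 s *: (chi (a s @^-1` A) *~: m').
  rewrite !scalerA !singleM mulg1 mul1g mul1r ract1 mulr1.
  rewrite shift_chi; last exact: sact_preimage_measurable.
  congr (single b (chi _) s *: _); apply/seteqP.
  by split => x; rewrite /preimage /= sactVK.
have -> : psi e = single b 1 s *: psi (single tr 1 s^-1%g *: e).
  rewrite psiZ const_crossed_single Linf_cst1 scalerA singleM rmorph1 mulr1 mulgV.
  by rewrite single1Z1.
rewrite !E1; congr (_ *: _); apply: um; first exact: sact_preimage_measurable.
apply: filterS (ae_sact a s ue) => x ux /ux.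
by rewrite sactK => <-; rewrite scalerA singleM mulVg mulr1 single11 scale1r.
Qed.

(** The extension of [psi] that sends the tensor of f and e to f times [psi e]. Defining it by the
    property [represents] lets additivity and linearity follow from uniqueness, with no presentation
    of x by a sum to choose. *)
Definition step_map (x : smod a fb E) : M :=
  projT1 (cid (represents_exists (stepfunP (repr x)))).

Lemma step_mapP (x : smod a fb E) : represents (repr x) (step_map x).
Proof. by rewrite /step_map; case: cid. Qed.

Lemma step_map_unique (x : smod a fb E) u m : {ae mu, forall p, repr x p = u p} ->
  represents u m -> step_map x = m.
Proof.
move=> xu um; apply: (represents_unique (stepfunP (repr x))); first exact: step_mapP.
by apply: represents_ae um; apply: filterS xu => p ->.
Qed.

Lemma step_mapD x y : step_map (x + y) = step_map x + step_map y.
Proof.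
apply: step_map_unique (repr_stepsD x y) _.
by apply: represents_add; [exact: stepfunP|exact: stepfunP|exact: step_mapP|exact: step_mapP].
Qed.

Lemma step_mapZ r x : step_map (r *: x) = r *: step_map x.
Proof.
elim/crossed_ind: r => [|r1 r2 IH1 IH2|u s].
- by rewrite !scale0r; apply: (addIr (step_map 0)); rewrite -step_mapD !add0r.
- by rewrite !scalerDl step_mapD IH1 IH2.
rewrite smod_single.
have -> : step_map (steps_scale fb u (steps_shift a s x)) =
    u *~: step_map (steps_shift a s x).
  apply: step_map_unique (repr_steps_scale fb u (steps_shift a s x)) _.
  by apply: represents_scale; [exact: stepfunP|exact: step_mapP].
have -> : step_map (steps_shift a s x) = single b 1 s *: step_map x.
  apply: step_map_unique (repr_steps_shift a s x) _.
  by apply: represents_shift; exact: step_mapP.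
by rewrite scalerA singleM rmorph1 mulr1 mul1g.
Qed.

Lemma step_map_is_linear : linear step_map.
Proof. by move=> r x y; rewrite step_mapD step_mapZ. Qed.

Definition step_map_lin : {linear smod a fb E -> M} :=
  HB.pack step_map (GRing.isLinear.Build (crossed b) (smod a fb E) M _ step_map step_map_is_linear).

End Represents.
End StepMap.

Section StepNat.
Variables (R : realType) (d : measure_display) (X : measurableType d).
Variables (mu : probability X R) (G : groupType) (a : standardAction mu G).
Variables (Z : normedCoeff R) (fb : finite_balls Z).
Local Notation tr := (trivial_ringAction G Z).
Local Notation b := (Linf_action a Z).
Local Notation chi := (Linf_chi mu Z).

Lemma step_map_natural (E E' : lmodType (crossed tr)) (M M' : lmodType (crossed b))
    (psi : E -> M) (psi' : E' -> M') (f : {linear E -> E'}) (g : {linear M -> M'}) :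
  (forall e, psi' (f e) = g (psi e)) ->
  forall x : smod a fb E, step_map psi' (smap f x : smod a fb E') = g (step_map psi x).
Proof.
move=> fg x; apply: step_map_unique (repr_smap f x) _.
have [v [sv xv]] := repr_steps_simple x.
have vm := represents_ae xv (step_mapP psi (x := x)).
apply: (represents_fine (t := v) (h := f) sv) => [|e]; first by apply: filterS xv => p ->.
have gZ r m : g (r *: m) = r *: g m by rewrite linearZ.
by rewrite fg -!gZ; congr (g _); exact: represents_fiber.
Qed.

Section Aug.
Variables (E : lmodType (crossed tr)) (aug : E -> Z).
Hypothesis augD : forall x y, aug (x + y) = aug x + aug y.
Hypothesis augZ : forall r x, aug (r *: x) = crossed_act r (aug x).

Lemma saug_subproof (x : smod a fb E) : exists f : bmf mu Z,
  {ae mu, forall p, f p = aug (repr x p)}.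
Proof.
have [v [sv xv]] := repr_steps_simple x.
exists (Bmf (simple_bmf mu (simple_comp aug sv))).
by apply: filterS xv => p ->.
Qed.

Definition saug (x : smod a fb E) : Linf mu Z := Linf_class (projT1 (cid (saug_subproof x))).

Lemma repr_saug x : {ae mu, forall p, repr (saug x) p = aug (repr x p)}.
Proof.
rewrite /saug; case: cid => f /= fx.
by apply: filterS2 fx (reprK_ae f) => p <- ->.
Qed.

Lemma saugD x y : saug (x + y) = saug x + saug y.
Proof.
apply: Linf_ext; apply: filterS3 (repr_saug (x + y)) (repr_add (saug x) (saug y))
  (filterI (repr_stepsD x y) (filterI (repr_saug x) (repr_saug y))) => p -> -> [-> [-> ->]].
by rewrite augD.
Qed.

Lemma saugZ r x : saug (r *: x) = crossed_act r (saug x).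
Proof.
elim/crossed_ind: r => [|r1 r2 IH1 IH2|u s].
- rewrite scale0r crossed_act0l; apply: (addIr (saug 0)).
  by rewrite -saugD !add0r.
- by rewrite scalerDl saugD crossed_actDl IH1 IH2.
rewrite smod_single crossed_act_single; apply: Linf_ext.
apply: filterS3 (repr_saug (steps_scale fb u (steps_shift a s x)))
  (filterI (repr_mul u (b s (saug x))) (repr_shift a s (saug x)))
  (filterI (repr_steps_scale fb u (steps_shift a s x)) (filterI (repr_steps_shift a s x)
    (ae_sact a s^-1%g (repr_saug x)))) => p -> [-> ->] [-> [-> ->]].
by rewrite !augZ !crossed_act_single mul1r.
Qed.

Lemma saug_surj : (forall z, exists e, aug e = z) -> forall u, exists x, saug x = u.
Proof.
move=> /choice[h hP] u.
exists (steps_of (asimple_comp h (bmf_asimple (repr u) fb))); apply: Linf_ext.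
apply: filterS2 (repr_saug (steps_of (asimple_comp h (bmf_asimple (repr u) fb))))
  (repr_steps_of (asimple_comp h (bmf_asimple (repr u) fb))) => p -> ->.
by rewrite hP.
Qed.

Lemma saug_exact (E' : lmodType (crossed tr)) (f : {linear E' -> E}) :
  (forall x, aug x = 0 -> exists y, f y = x) ->
  forall x, saug x = 0 -> exists y, smap f y = x.
Proof.
move=> ex x x0.
have /choice[h hP] : forall e, exists y, aug e = 0 -> f y = e.
  by move=> e; have [/ex[y <-]|ne] := pselect (aug e = 0); [exists y|exists 0].
exists (steps_of (asimple_comp h (stepfunP (repr x)))); apply: steps_ext.
have H : {ae mu, forall p, aug (repr x p) = 0}.
  apply: filterS2 (repr_saug x) (repr_zero mu Z) => p.
  by rewrite x0 => -> ->.
apply: filterS3 (repr_smap (a := a) (fb := fb) f (steps_of (asimple_comp h (stepfunP (repr x)))))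
  (repr_steps_of (asimple_comp h (stepfunP (repr x)))) H => p -> -> Hp.
by rewrite hP.
Qed.

Lemma saug_smap (E' : lmodType (crossed tr)) (f : {linear E' -> E}) :
  (forall x, aug (f x) = 0) -> forall x : smod a fb E', saug (smap f x) = 0.
Proof.
move=> f0 x; apply: Linf_ext.
apply: filterS3 (repr_saug (smap f x)) (repr_smap f x) (repr_zero mu Z) => p -> -> ->.
by rewrite f0.
Qed.

(** On the level set where the step function is [e], both sides are the constant [aug e]. *)
Lemma saug_step_map (M : lmodType (crossed b)) (psi : E -> M) (h : M -> Linf mu Z) :
  (forall r x, h (r *: x) = crossed_act r (h x)) ->
  (forall e, h (psi e) = Linf_cst mu (aug e)) ->
  forall x, h (step_map psi x) = saug x.
Proof.
move=> hZ hpsi x.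
have [v [sv xv]] := repr_steps_simple x.
have vm := represents_ae xv (step_mapP psi (x := x)).
have [[s sP] _] := sv.
rewrite -[LHS]mul1r -[RHS]mul1r -chi_setT (chi_split mu Z sv sP measurableT) !mulr_suml.
apply: eq_bigr => e _; rewrite setTI.
have mB : measurable (v @^-1` [set e]) by exact: simple_preimage.
have E1 (m : M) : chi (v @^-1` [set e]) * h m =
    h (single b (chi (v @^-1` [set e])) 1%g *: m).
  by rewrite hZ crossed_act_single ract1.
rewrite E1 (represents_fiber e sv vm) -E1 hpsi; apply: chi_mul_eq => //.
by apply: filterS3 (repr_cst mu (aug e)) (repr_saug x) xv => p -> -> -> ->.
Qed.

End Aug.
End StepNat.

(** * The coupling of a weak bounded orbit equivalence *)

(** The sets come from a countable base of the Polish topology: a Hausdorff space has an open set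
    that contains x but not y, and a basic set around x fits inside it. *)
Lemma standard_borel_separating (R : realType) (d : measure_display) (X : measurableType d) :
  standard_borel R X -> exists U : nat -> set X,
  (forall n, measurable (U n)) /\ forall x y, x <> y -> exists n, U n x /\ ~ U n y.
Proof.
move=> [P [hP [B /countable_injP[h injh] [Bo Bx]] [f [[g fK gK] fB]]]].
(* An enumeration of the base; indices that code no basic set get the empty set. *)
pose V n := xget set0 [set W | B W /\ h W = n].
have VE W : B W -> V (h W) = W.
  move=> BW; have [BV hV] : [set W' | B W' /\ h W' = h W] (V (h W)).
    by apply: (xgetPex set0); exists W.
  by apply: injh; rewrite ?inE.
have oV n : open (V n).
  by rewrite /V; case: xgetP => [W _ [BW _]|_]; [exact: Bo|exact: open0].
exists (fun n => f @^-1` V n); split.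
  by move=> n; apply/fB; apply: sub_sigma_algebra; exact: oV.
move=> x y xy.
have fxy : f x != f y by apply/eqP => /(can_inj fK).
have [A [oA]] := hausdorff_accessible hP fxy; rewrite !inE => Ax Ay.
have [W [BW Wx] WA] : filter_from [set U | B U /\ U (f x)] id A.
  by apply: Bx; exact: open_nbhs_nbhs.
by exists (h W); rewrite /preimage /= VE //; split => // /WA.
Qed.

(** The two maps differ at t exactly when one of countably many separating sets contains f t and
    misses g t. *)
Lemma coincidence_measurable (R : realType) (d d' : measure_display) (T : measurableType d)
    (X : measurableType d') (D : set T) (f g : T -> X) :
  standard_borel R X -> measurable D ->
  (forall S, measurable S -> measurable (D `&` f @^-1` S)) ->
  (forall S, measurable S -> measurable (D `&` g @^-1` S)) ->
  measurable (D `&` [set t | f t = g t]).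
Proof.
move=> /standard_borel_separating[U [mU sU]] mD mf mg.
have -> : D `&` [set t | f t = g t] =
    D `\` \bigcup_n ((D `&` f @^-1` U n) `\` (D `&` g @^-1` U n)).
  apply/seteqP; split=> t [Dt].
    move=> fg; split=> // -[n _ [[_ ft] nt]]; apply: nt; split => //.
    by rewrite /preimage /= -(fg : f t = g t).
  move=> nt; split => //=; apply: contrapT => /sU[n [ft gt]]; apply: nt.
  by exists n => //; split => // -[].
apply: measurableD => //; apply: bigcup_measurable => n _.
by apply: measurableD; [exact: mf|exact: mg].
Qed.

Section OE.
Variable R : realType.

(** A weak bounded orbit equivalence in the form used below: the scaling of measures is freed from
    normalisation, and the finite sets of (b) and (c) are duplicate-free lists. *)
Record oe_data (d d' : measure_display) (X : measurableType d) (Y : measurableType d')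
    (mu : probability X R) (nu : probability Y R) (G H : groupType)
    (al : standardAction mu G) (be : standardAction nu H)
    (A : set X) (B : set Y) (phi : X -> Y) (psi : Y -> X) (c : R) : Prop := OEData {
  oe_c : 0 < c;
  oe_mA : measurable A;
  oe_mB : measurable B;
  oe_mphi : measurable_fun A phi;
  oe_mpsi : measurable_fun B psi;
  oe_phi : forall x, A x -> B (phi x);
  oe_phiK : forall x, A x -> psi (phi x) = x;
  oe_psi : forall y, B y -> A (psi y);
  oe_psiK : forall y, B y -> phi (psi y) = y;
  oe_scale : forall S, measurable S -> (mu (A `&` phi @^-1` S) = c%:E * nu (B `&` S))%E;
  oe_fwd : forall g, exists2 F : seq H, uniq F &
    {ae mu, forall x, A x -> A (al g x) -> exists2 h, h \in F & phi (al g x) = be h (phi x)};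
  oe_bwd : forall h, exists2 F : seq G, uniq F &
    {ae nu, forall y, B y -> B (be h y) -> exists2 g, g \in F & psi (be h y) = al g (psi y)}
}.

(** The data are symmetric up to inverting the index, so constructions made in one direction apply
    in both; the reverse inequality of the theorem comes from here. *)
Lemma oe_sym d d' (X : measurableType d) (Y : measurableType d')
    (mu : probability X R) (nu : probability Y R) (G H : groupType)
    (al : standardAction mu G) (be : standardAction nu H) A B phi psi c :
  oe_data al be A B phi psi c -> oe_data be al B A psi phi c^-1.
Proof.
case=> c0 mA mB mphi mpsi phB phK psA psK sc fw bw; split => //; first by rewrite invr_gt0.
move=> S mS; have mBS : measurable (B `&` psi @^-1` S) by exact: mpsi.
have := sc _ mBS.
have -> : A `&` phi @^-1` (B `&` psi @^-1` S) = A `&` S.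
  apply/seteqP; split=> x [Ax].
    by move=> [_ Sx]; split => //; move: Sx; rewrite /preimage /= phK.
  by move=> Sx; split => //; split; [exact: phB|rewrite /preimage /= phK].
have -> : B `&` (B `&` psi @^-1` S) = B `&` psi @^-1` S by rewrite setIA setIid.
move=> ->; rewrite muleA -EFinM mulVf ?mul1e //.
by rewrite gt_eqF.
Qed.

Section Push.
Variables (d d' : measure_display) (X : measurableType d) (Y : measurableType d').
Variables (mu : probability X R) (nu : probability Y R) (G H : groupType).
Variables (al : standardAction mu G) (be : standardAction nu H).
Variables (A : set X) (B : set Y) (phi : X -> Y) (psi : Y -> X) (c : R).
Hypothesis oe : oe_data al be A B phi psi c.
Variable Z : normedCoeff R.

Let mA := oe_mA oe.
Let mB := oe_mB oe.

(** By the scaling of measures, the preimage in [B] of a null set under [psi] is null. *)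
Lemma oe_null (P : X -> Prop) : {ae mu, forall x, P x} ->
  {ae nu, forall y, B y -> P (psi y)}.
Proof.
move=> [N [mN N0 PN]].
exists (B `&` psi @^-1` N); split; first exact: (oe_mpsi oe).
- have /(_ N mN) := oe_scale (oe_sym oe).
  move=> ->; rewrite (subset_measure0 _ _ _ N0) ?mule0 //.
  exact: measurableI.
- move=> y /= nP; apply: contrapT => nBN; apply: nP => By.
  by apply: contrapT => nPy; apply: nBN; split => //; apply: PN.
Qed.

Lemma oe_push_subproof (u : bmf mu Z) :
  bmf_pred nu (fun y => if y \in B then u (psi y) else 0).
Proof.
case: u => u /= /asboolP[mu' [C uC]]; apply/asboolP; split.
  move=> S; set f := (fun y => _).
  have -> : f @^-1` S = (B `&` psi @^-1` (u @^-1` S)) `|` (~` B `&` [set _ | S 0]).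
    apply/seteqP; split=> y; rewrite /preimage /f /=.
      by have [By|By] := pselect (B y); [rewrite mem_set //; left|rewrite memNset //; right].
    by case=> -[By Sy]; [rewrite mem_set|rewrite memNset].
  apply: measurableU; first exact: (oe_mpsi oe).
  apply: measurableI; first exact: measurableC.
  have [S0|S0] := pselect (S 0).
    by rewrite (_ : [set _ | _] = setT) //; apply/seteqP; split.
  by rewrite (_ : [set _ | _] = set0) //; apply/seteqP; split.
exists (Num.max C (coeff_norm (0 : Z))); apply: filterS (oe_null uC) => y uy.
rewrite le_max; have [By|By] := pselect (B y); first by rewrite mem_set // uy.
by rewrite memNset // lexx orbT.
Qed.

Definition oe_push (u : Linf mu Z) : Linf nu Z := Linf_class (Bmf (oe_push_subproof (repr u))).

Lemma repr_push u :
  {ae nu, forall y, repr (oe_push u) y = if y \in B then repr u (psi y) else 0}.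
Proof. by apply: filterS (reprK_ae (Bmf (oe_push_subproof (repr u)))) => y ->. Qed.

Lemma oe_pushD u v : oe_push (u + v) = oe_push u + oe_push v.
Proof.
apply: Linf_ext; apply: filterS3 (repr_push (u + v)) (repr_add (oe_push u) (oe_push v))
  (filterI (oe_null (repr_add u v)) (filterI (repr_push u) (repr_push v)))
  => y -> -> [uv [-> ->]].
by have [/set_mem/uv//|_] := boolP (y \in B); rewrite addr0.
Qed.

Lemma oe_pushM u v : oe_push (u * v) = oe_push u * oe_push v.
Proof.
apply: Linf_ext; apply: filterS3 (repr_push (u * v)) (repr_mul (oe_push u) (oe_push v))
  (filterI (oe_null (repr_mul u v)) (filterI (repr_push u) (repr_push v)))
  => y -> -> [uv [-> ->]].
by have [/set_mem/uv//|_] := boolP (y \in B); rewrite mulr0.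
Qed.

Lemma repr_push1 : {ae nu, forall y, repr (oe_push 1) y = if y \in B then 1 else 0}.
Proof.
apply: filterS2 (repr_push 1) (oe_null (repr_one mu Z)) => y -> Hy.
by case: ifPn => // /set_mem/Hy.
Qed.

Lemma oe_push_chi S : measurable S ->
  oe_push (Linf_chi mu Z S) = Linf_chi nu Z (B `&` psi @^-1` S).
Proof.
move=> mS; have mBS : measurable (B `&` psi @^-1` S) by exact: (oe_mpsi oe).
apply: Linf_ext; apply: filterS3 (repr_push (Linf_chi mu Z S)) (oe_null (repr_chi mu Z mS))
  (repr_chi nu Z mBS) => y -> Hy ->.
have [By|By] := pselect (B y); last by rewrite memNset // chi_funF // => -[].
rewrite mem_set // Hy //; have [Sy|Sy] := pselect (S (psi y)).
  by rewrite !chi_funT.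
by rewrite !chi_funF // => -[].
Qed.

(** The arrow g ends at psi(y) and starts at g^-1 psi(y); it matches h when phi takes this source to
    h^-1 y. Inverses occur because g translates functions through g^-1. *)
Definition oe_cell (g : G) (h : H) : set Y :=
  [set y | [/\ B y, A (al g^-1%g (psi y)) & phi (al g^-1%g (psi y)) = be h^-1%g y]].

Definition oe_dom (g : G) : set Y := B `&` psi @^-1` (al g^-1%g @^-1` A).

Lemma oe_dom_measurable g : measurable (oe_dom g).
Proof. by apply: (oe_mpsi oe) => //; exact: sact_preimage_measurable. Qed.

(** A cell is a coincidence set of two measurable maps into [Y]; the standard Borel structure of [Y]
    makes it measurable. *)
Lemma oe_cell_measurable g h : measurable (oe_cell g h).
Proof.
have -> : oe_cell g h = oe_dom g `&`
    [set y | phi (al g^-1%g (psi y)) = be h^-1%g y].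
  by apply/seteqP; split=> y; [case|case=> -[]].
apply: (coincidence_measurable (sact_borel be)) => [|S mS|S mS].
- exact: oe_dom_measurable.
- have -> : oe_dom g `&` (fun y => phi (al g^-1%g (psi y))) @^-1` S =
      B `&` psi @^-1` (al g^-1%g @^-1` (A `&` phi @^-1` S)).
    by apply/seteqP; split=> y; [case=> -[? ?] ?|case=> ? [? ?]]; split.
  apply: (oe_mpsi oe) => //; apply: sact_preimage_measurable.
  exact: (oe_mphi oe).
- by apply: measurableI; [exact: oe_dom_measurable|exact: sact_preimage_measurable].
Qed.

Definition oe_rows (g : G) : seq H := projT1 (cid2 (oe_fwd oe g)).

Lemma oe_rows_uniq g : uniq (oe_rows g).
Proof. by rewrite /oe_rows; case: cid2. Qed.

(** Condition (b) for [g], used at the point g^-1 psi(y), which [g] takes to psi(y). *)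
Lemma oe_rowsP g :
  {ae nu, forall y, oe_dom g y -> exists2 h, h \in oe_rows g & oe_cell g h y}.
Proof.
rewrite /oe_rows; case: cid2 => F /= _ HF.
have := oe_null (ae_sact al g^-1%g HF).
apply: filterS => y Hy [By Ay].
have [//||h hF] := Hy By; first by rewrite sactVK; exact: (oe_psi oe).
rewrite sactVK (oe_psiK oe) // => yE; exists h => //.
by split => //; rewrite {2}yE sactK.
Qed.

Lemma oe_free : {ae nu, forall y, forall h h', be h y = be h' y -> h = h'}.
Proof.
apply: filterS (sact_free be) => y Hy h h' hh'.
have /Hy : be (h'^-1 * h)%g y = y by rewrite sactM hh' sactK.
by move=> /(congr1 (fun k => h' * k)%g); rewrite mulVKg mulg1.
Qed.

(** Two matches h, h' of the same g would give h^-1 y = h'^-1 y, which essential freeness excludes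
    outside a null set. *)
Lemma oe_cell_free : {ae nu, forall y, forall g h h',
  oe_cell g h y -> oe_cell g h' y -> h = h'}.
Proof.
apply: filterS oe_free => y Hy g h h' [_ _ E1] [_ _ E2].
by apply: invg_inj; apply: Hy; rewrite -E1 -E2.
Qed.

Lemma oe_cell_rows g h : h \notin oe_rows g -> Linf_chi nu Z (oe_cell g h) = 0.
Proof.
move=> hr; apply: chi_null; first exact: oe_cell_measurable.
apply: filterS2 (oe_rowsP g) oe_cell_free => y Hy fr yc.
have [|h' h'r yc'] := Hy; first by case: yc => ? ? _; split.
by move: hr; rewrite (fr _ _ _ yc yc') h'r.
Qed.

Lemma oe_cell_rowM g h h' : Linf_chi nu Z (oe_cell g h) * Linf_chi nu Z (oe_cell g h') =
  if h == h' then Linf_chi nu Z (oe_cell g h) else 0.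
Proof.
have m1 := oe_cell_measurable g h; have m2 := oe_cell_measurable g h'.
rewrite chiM //; case: eqP => [<-|hh']; first by rewrite setIid.
apply: chi_null; first exact: measurableI.
by apply: filterS oe_cell_free => y fr [y1 y2]; apply: hh'; exact: fr y1 y2.
Qed.

Lemma oe_push_shift1 g : oe_push (Linf_action al Z g (Linf_chi mu Z A)) =
  Linf_chi nu Z (oe_dom g).
Proof. by rewrite shift_chi // oe_push_chi //; exact: sact_preimage_measurable. Qed.

Lemma oe_sum_rows g : \sum_(h <- oe_rows g) Linf_chi nu Z (oe_cell g h) =
  Linf_chi nu Z (oe_dom g).
Proof.
apply: chi_sum.
- exact: oe_dom_measurable.
- by move=> h; exact: oe_cell_measurable.
- apply: filterS2 (oe_rowsP g) oe_cell_free => y Hy fr /Hy[h hr yc].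
  rewrite (bigD1_seq h) ?oe_rows_uniq //= chi_funT // big1 ?addr0 // => i /eqP ih.
  by rewrite chi_funF // => yi; apply: ih; exact: fr yi yc.
- by apply: nearW => y ny h [By Ay _]; apply: ny; split.
Qed.

Lemma oe_cell_push g h u :
  Linf_chi nu Z (oe_cell g h) * Linf_action be Z h (oe_push u) =
  Linf_chi nu Z (oe_cell g h) * oe_push (Linf_action al Z g u).
Proof.
apply: chi_mul_eq; first exact: oe_cell_measurable.
apply: filterS3 (repr_shift be h (oe_push u)) (ae_sact be h^-1%g (repr_push u))
  (filterI (repr_push (Linf_action al Z g u)) (oe_null (repr_shift al g u)))
  => y -> -> [-> Hy] [By Ay E].
rewrite (mem_set By) Hy // -E mem_set; last exact: (oe_phi oe).
by rewrite (oe_phiK oe).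
Qed.

(** Compatibility with composition of arrows: where g matches h at y, the pair (g', h') matches at
    h^-1 y exactly when the products match at y. *)
Lemma oe_cell_trans g g' h h' :
  Linf_chi nu Z (oe_cell g h) * Linf_action be Z h (Linf_chi nu Z (oe_cell g' h')) =
  Linf_chi nu Z (oe_cell g h) * Linf_chi nu Z (oe_cell (g * g')%g (h * h')%g).
Proof.
have m1 := oe_cell_measurable g h; have m2 := oe_cell_measurable g' h'.
have m3 := oe_cell_measurable (g * g')%g (h * h')%g.
rewrite shift_chi // !chiM //; last exact: sact_preimage_measurable.
congr (Linf_chi _ _ _); apply/seteqP.
split=> y [[By Ay E]]; rewrite /preimage /oe_cell /= -E !invgM !sactM (oe_phiK oe) // -E.
  by case=> ? ? ?; split.
by case=> ? ? ?; split => //; split => //; exact: (oe_phi oe).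
Qed.

Lemma oe_cell11 : Linf_chi nu Z (oe_cell 1%g 1%g) = oe_push 1.
Proof.
rewrite -chi_setT oe_push_chi //; congr (Linf_chi _ _ _); apply/seteqP.
split=> y; first by case.
case=> By _; split => //; rewrite !invg1 !sact1 ?(oe_psiK oe) //.
exact: (oe_psi oe).
Qed.

Lemma oe_chiB : Linf_chi nu Z B = oe_push 1.
Proof. by rewrite -chi_setT oe_push_chi // preimage_setT setIT. Qed.

End Push.

Section Coupling.
Variables (d d' : measure_display) (X : measurableType d) (Y : measurableType d').
Variables (mu : probability X R) (nu : probability Y R) (G H : groupType).
Variables (al : standardAction mu G) (be : standardAction nu H).
Variables (A : set X) (B : set Y) (phi : X -> Y) (psi : Y -> X) (c : R).
Hypothesis oe : oe_data al be A B phi psi c.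
Variable Z : normedCoeff R.
Let oe' := oe_sym oe.

Lemma oe_push_pull v : oe_push oe (oe_push oe' v : Linf mu Z) = oe_push oe (1 : Linf mu Z) * v.
Proof.
apply: Linf_ext; apply: filterS3 (repr_push oe (oe_push oe' v)) (oe_null oe (repr_push oe' v))
  (filterI (repr_mul (oe_push oe (1 : Linf mu Z)) v) (repr_push1 oe Z)) => y -> Hy [-> ->].
have [By|By] := pselect (B y); last by rewrite !memNset // mul0r.
rewrite mem_set // Hy // mem_set ?mul1r; last exact: (oe_psi oe).
by rewrite (oe_psiK oe).
Qed.

Local Notation cell := (oe_cell al be A B phi psi).
Local Notation cell' := (oe_cell be al B A psi phi).

Lemma oe_pull_push u : oe_push oe' (oe_push oe u : Linf nu Z) = oe_push oe' (1 : Linf nu Z) * u.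
Proof.
apply: Linf_ext; apply: filterS3 (repr_push oe' (oe_push oe u)) (oe_null oe' (repr_push oe u))
  (filterI (repr_mul (oe_push oe' (1 : Linf nu Z)) u) (repr_push1 oe' Z)) => x -> Hx [-> ->].
have [Ax|Ax] := pselect (A x); last by rewrite !memNset // mul0r.
rewrite mem_set // Hx // mem_set ?mul1r; last exact: (oe_phi oe).
by rewrite (oe_phiK oe).
Qed.

Lemma oe_pull_cell g h : oe_push oe' (Linf_chi nu Z (cell g h)) = Linf_chi mu Z (cell' h g).
Proof.
rewrite oe_push_chi; last exact: oe_cell_measurable oe _ _.
congr (Linf_chi _ _ _); apply/seteqP; split=> x.
  move=> [Ax [Bx]]; rewrite (oe_phiK oe) // => Ax' E; split=> //.
    by rewrite -E; exact: (oe_phi oe).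
  by rewrite -E (oe_phiK oe).
move=> [Ax Bx E]; split => //; split.
- exact: (oe_phi oe).
- by rewrite (oe_phiK oe) // -E; exact: (oe_psi oe).
- by rewrite (oe_phiK oe) // -E (oe_psiK oe).
Qed.

Lemma oe_push_cell g h : oe_push oe (Linf_chi mu Z (cell' h g)) = Linf_chi nu Z (cell g h).
Proof.
rewrite oe_push_chi; last exact: oe_cell_measurable oe' _ _.
congr (Linf_chi _ _ _); apply/seteqP; split=> x.
  move=> [Ax [Bx]]; rewrite (oe_psiK oe) // => Ax' E; split=> //.
    by rewrite -E; exact: (oe_psi oe).
  by rewrite -E (oe_psiK oe).
move=> [Ax Bx E]; split => //; split.
- exact: (oe_psi oe).
- by rewrite (oe_psiK oe) // -E; exact: (oe_phi oe).
- by rewrite (oe_psiK oe) // -E (oe_phiK oe).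
Qed.

Lemma oe_push_0 : oe_push oe (0 : Linf mu Z) = 0.
Proof. by apply: (addIr (oe_push oe (0 : Linf mu Z))); rewrite -oe_pushD !add0r. Qed.

Lemma oe_cell_cols g h : g \notin oe_rows oe' h -> Linf_chi nu Z (cell g h) = 0.
Proof. by move=> gr; rewrite -oe_push_cell (oe_cell_rows Z gr) oe_push_0. Qed.

Lemma oe_cell_colM g g' h : Linf_chi nu Z (cell g h) * Linf_chi nu Z (cell g' h) =
  if g == g' then Linf_chi nu Z (cell g h) else 0.
Proof.
rewrite -!oe_push_cell -oe_pushM (oe_cell_rowM oe').
by case: ifP; rewrite // oe_push_0.
Qed.

Lemma oe_coupling_sum_rows g : \sum_(h <- oe_rows oe g) Linf_chi nu Z (cell g h) =
  oe_push oe (Linf_action al Z g (oe_push oe' (1 : Linf nu Z))).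
Proof. by rewrite -oe_chiB oe_push_shift1; exact: oe_sum_rows. Qed.

Lemma oe_coupling_sum_cols h :
  \sum_(g <- oe_rows oe' h) oe_push oe' (Linf_chi nu Z (cell g h)) =
  oe_push oe' (Linf_action be Z h (oe_push oe (1 : Linf mu Z))).
Proof.
rewrite -oe_chiB oe_push_shift1 -(oe_sum_rows oe').
by apply: eq_bigr => g _; exact: oe_pull_cell.
Qed.

Definition oe_coupling : coupling (Linf_action al Z) (Linf_action be Z) :=
  @Coupling G H (Linf mu Z) (Linf nu Z) (Linf_action al Z) (Linf_action be Z)
    (oe_push oe (Z := Z)) (oe_push oe' (Z := Z)) (fun g h => Linf_chi nu Z (cell g h))
    (oe_rows oe) (oe_rows oe') (oe_pushD oe (Z := Z)) (oe_pushM oe (Z := Z))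
    (oe_pushD oe' (Z := Z)) (oe_pushM oe' (Z := Z)) oe_push_pull oe_pull_push
    (oe_rows_uniq oe) (oe_rows_uniq oe')
    (@oe_cell_rows _ _ _ _ _ _ _ _ _ _ _ _ _ _ _ oe Z) oe_cell_cols
    (oe_cell_rowM oe Z) oe_cell_colM oe_coupling_sum_rows oe_coupling_sum_cols
    (oe_cell_push oe (Z := Z)) (oe_cell_trans oe Z) (oe_cell11 oe Z).

End Coupling.
End OE.

(** * Markings of pull-backs *)

Section Miso.
Variables (G H : groupType) (L1 L2 : comPzRingType).
Variables (a : ringAction G L1) (b : ringAction H L2) (c : coupling a b).
Variables (F : unitfam a (pull c 1)) (E : unitfam b (push c 1)).
Local Notation c' := (coupling_sym c).
Local Notation e := (single a (pull c 1) 1%g).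
Local Notation f := (single b (push c 1) 1%g).
Local Notation A := (@uf_a _ _ _ _ F).
Local Notation A' := (@uf_a' _ _ _ _ F).
Local Notation B := (@uf_a _ _ _ _ E).
Local Notation B' := (@uf_a' _ _ _ _ E).
Local Notation h := (@uf_g _ _ _ _ E).
Local Notation y := (@uf_p _ _ _ _ E).

Lemma theta_sym_sym x : theta (coupling_sym c') x = theta c x.
Proof.
elim/crossed_ind: x => [|x1 x2 IH1 IH2|u g]; first by rewrite !theta0.
  by rewrite !thetaD IH1 IH2.
apply: crossed_ext => k; rewrite !theta_singleE.
by congr (_ * _); exact: push_cell'.
Qed.

Lemma thetaK' z : theta c (theta c' z) = f * z * f.
Proof. by rewrite -theta_sym_sym thetaK. Qed.

Lemma theta_e x z : e * z = z -> theta c (x * z) = theta c x * theta c z.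
Proof. by move=> ez; rewrite -thetaM -mulrA ez. Qed.

Lemma mul_f_theta x : f * theta c x = theta c x.
Proof.
elim/crossed_ind: x => [|x1 x2 IH1 IH2|u g]; first by rewrite theta0 mulr0.
  by rewrite thetaD mulrDr IH1 IH2.
apply: crossed_ext => k; rewrite mul_single1E theta_singleE.
by rewrite mulrCA push1M.
Qed.

Lemma mul_theta_f x : theta c x * f = theta c x.
Proof.
elim/crossed_ind: x => [|x1 x2 IH1 IH2|u g]; first by rewrite theta0 mul0r.
  by rewrite thetaD mulrDl IH1 IH2.
apply: crossed_ext => k; rewrite mulr_single1E theta_singleE.
by rewrite mulrAC cell_shift1.
Qed.

Lemma mul_e_theta' z : e * theta c' z = theta c' z.
Proof.
elim/crossed_ind: z => [|x1 x2 IH1 IH2|u g]; first by rewrite theta0 mulr0.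
  by rewrite thetaD mulrDr IH1 IH2.
apply: crossed_ext => k; rewrite mul_single1E theta_singleE.
by rewrite mulrCA; congr (_ * _); exact: pull1M.
Qed.

Lemma theta'_single1 v : theta c' (single b v 1%g) = single a (pull c v) 1%g.
Proof. exact: theta_single1. Qed.

Lemma theta'_thetaM x z : theta c' (theta c x * z) = e * x * theta c' z.
Proof.
transitivity (theta c' (theta c x * f * z)); first by rewrite mul_theta_f.
transitivity (theta c' (theta c x) * theta c' z); first exact: (thetaM c').
by rewrite thetaK -mulrA mul_e_theta'.
Qed.

Lemma theta'_mulf x v : theta c' (x * f * single b v 1%g) =
  theta c' x * single a (pull c v) 1%g.
Proof. by rewrite -theta'_single1; exact: (thetaM c'). Qed.

Section Iso.
Variables (M : lmodType (crossed b)) (I : finType).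
Variable iso : {linear M -> {ffun I -> (crossed b)^o}}.
Hypothesis iso_inj : injective iso.
Local Notation T := (theta_rep F).
Local Notation J := (I * uf_idx E)%type.

Lemma theta_repE r k m : T r k m = theta c (A k * r * A' m). Proof. by []. Qed.

(** Right multiplication by [B' l] cuts out the part of the coordinate over [y l] and moves it under
    [f], where the inverse [theta c'] applies; the factors [A' k] glue the components of u into one
    element. So every coordinate of M yields one coordinate for each l. *)
Definition miso_fun (u : mpull T M) (il : J) : crossed a :=
  \sum_(k : uf_idx F) A' k * theta c' ((iso (u k) il.1 : crossed b) * B' il.2).

Definition miso (u : mpull T M) : {ffun J -> (crossed a)^o} := [ffun il => miso_fun u il].

Lemma isoD x z i : iso (x + z) i = iso x i + iso z i.
Proof. by rewrite linearD ffunE. Qed.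

Lemma isoZ r x i : iso (r *: x) i = r * (iso x i : crossed b).
Proof. by rewrite linearZ ffunE. Qed.

Lemma iso_sum (K : Type) (s : seq K) (P : K -> M) i :
  iso (\sum_(k <- s) P k) i = \sum_(k <- s) iso (P k) i.
Proof. by rewrite linear_sum sum_ffunE. Qed.

Lemma miso_is_linear : linear miso.
Proof.
move=> r u v; apply/ffunP => -[i l]; rewrite !ffunE /miso_fun [(i, l).1]/= [(i, l).2]/=.
under eq_bigr do rewrite mpullDE isoD mulrDl thetaD mulrDr.
rewrite big_split; congr (_ + _).
transitivity (\sum_k \sum_m A' k * A k * (r * A' m) *
    theta c' ((iso (u m) i : crossed b) * B' l)).
  apply: eq_bigr => k _; rewrite mpullZE iso_sum mulr_suml theta_sum mulr_sumr.
  apply: eq_bigr => m _; rewrite isoZ theta_repE -!mulrA theta'_thetaM.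
  by rewrite !mulrA uf_a'e.
rewrite exchange_big /=; under eq_bigr do rewrite -!mulr_suml uf_sum_a'a mul1r -mulrA.
by rewrite -mulr_sumr.
Qed.

Definition miso_lin : {linear mpull T M -> {ffun J -> (crossed a)^o}} :=
  HB.pack miso (GRing.isLinear.Build (crossed a) (mpull T M)
    {ffun J -> (crossed a)^o} _ miso miso_is_linear).

(** Recovers the coordinates of [u j] piece by piece; summing against [B l] gives the inverse
    formula [iso_miso], hence injectivity and the shape of preimages. *)
Lemma theta_a_miso u j i l :
  theta c (A j * miso_fun u (i, l)) = (iso (u j) i : crossed b) * B' l.
Proof.
rewrite /miso_fun mulr_sumr theta_sum -[in RHS](mpull1E u) iso_sum mulr_suml.
apply: eq_bigr => k _; rewrite isoZ mulrA theta_e ?mul_e_theta' // thetaK'.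
rewrite !mulrA mul_theta_f -!mulrA uf_a'e mulrA.
by rewrite theta_repE mulr1 -mulrA.
Qed.

Lemma iso_miso (u : mpull T M) j i :
  iso (u j) i = \sum_l theta c (A j * miso_fun u (i, l)) * B l :> crossed b.
Proof.
under eq_bigr do rewrite theta_a_miso -mulrA.
by rewrite -mulr_sumr uf_sum_a'a mulr1.
Qed.

Lemma miso_inj : injective miso.
Proof.
move=> u v uv; apply/mpullP => j; apply: iso_inj; apply/ffunP => i.
rewrite [LHS]iso_miso [RHS]iso_miso; apply: eq_bigr => l _.
by have /ffunP/(_ (i, l)) := uv; rewrite !ffunE => ->.
Qed.

Section Fixed.
Variable s : I -> L2.
Hypothesis sid : forall i, s i * s i = s i.
Local Notation w i l := (b (h l) (s i * y l)).

Definition miso_set (i : I) (l : uf_idx E) : L1 := pull c (w i l).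

Lemma B'_set i l : B' l * single b (w i l) 1%g = single b (s i) 1%g * B' l.
Proof.
rewrite !singleM ract1 mulg1 mul1g -ractM mulVg ract1.
by rewrite mulrCA uf_ppE.
Qed.

Lemma set_B i l : single b (push c (miso_set i l)) 1%g * B l =
  B l * single b (s i) 1%g.
Proof.
rewrite !singleM ract1 mulg1 mul1g push_pull -mulrA -rmorphM -mulrA uf_ppE.
by rewrite rmorphM mulrCA uf_act_sub mulrC.
Qed.

(** A marked summand consists of the elements whose coordinates are fixed by right multiplication
    with its idempotents. Moving [s i] past [B' l] ([B'_set]) or [B l] ([set_B]) replaces it by its
    translated piece over [l]. *)
Lemma miso_fixed (u : mpull T M) :
  (forall k i, (iso (u k) i : crossed b) * single b (s i) 1%g = iso (u k) i) <->
  (forall i l, miso_fun u (i, l) * single a (miso_set i l) 1%g = miso_fun u (i, l)).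
Proof.
split=> fixed.
  move=> i l; rewrite /miso_fun mulr_suml; apply: eq_bigr => k _.
  rewrite -mulrA -theta'_mulf; congr (_ * theta _ _).
  by rewrite -[_ * B' l * f]mulrA uf_a'e -mulrA B'_set mulrA fixed.
move=> j i; rewrite iso_miso mulr_suml; apply: eq_bigr => l _.
rewrite -mulrA -set_B mulrA -theta_single1 -theta_e.
  by rewrite -mulrA fixed.
by rewrite singleM ract1 mulg1 pull1M.
Qed.

(** The components [m k] are the ones that [iso_miso] forces on a preimage of [r]; the claim [E1]
    checks that the idempotent matrix of the pull-back already fixes them. *)
Lemma miso_surj (r : J -> crossed a) (m : uf_idx F -> M) :
  (forall i l, r (i, l) * single a (miso_set i l) 1%g = r (i, l)) ->
  (forall k i, iso (m k) i = \sum_l theta c (A k * r (i, l)) * B l) ->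
  exists u, miso u = [ffun il => r il].
Proof.
move=> fixed mE; exists (mpull_mk (t := T) 1 [ffun k => m k]).
have E1 k : (mpull_mk (t := T) 1 [ffun k => m k]) k = m k.
  rewrite mpull_mkE; apply: iso_inj; apply/ffunP => i.
  rewrite iso_sum mE; under eq_bigr do rewrite isoZ ffunE mE mulr_sumr.
  rewrite exchange_big; apply: eq_bigr => l _.
  under eq_bigr do rewrite mulrA; rewrite -mulr_suml; congr (_ * _).
  by rewrite [LHS](theta_mx_sum 1) mulr1.
apply/ffunP => -[i l]; rewrite !ffunE /miso_fun /=.
have sE : push c (miso_set i l) * b (h l) (y l) = push c (miso_set i l).
  by rewrite push_pull -mulrA -rmorphM -mulrA uf_ppE.
have tE : miso_set i l * pull c 1 = miso_set i l by rewrite mulrC pull1M.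
have rB k : theta c (A k * r (i, l)) * single b (b (h l) (y l)) 1%g =
    theta c (A k * r (i, l)).
  rewrite -fixed mulrA theta_e; last by rewrite single1M pull1M.
  by rewrite theta_single1 -[LHS]mulrA single1M sE.
transitivity (\sum_k A' k * theta c' (theta c (A k * r (i, l)))).
  apply: eq_bigr => k _; congr (_ * theta _ _); rewrite E1 mE mulr_suml.
  rewrite (bigD1 l) //= big1 ?addr0 => [|l' ll'].
    by rewrite -mulrA uf_aa' eqxx rB.
  by rewrite -mulrA uf_aa' (negPf ll') mulr0.
transitivity (\sum_k A' k * A k * r (i, l)); last by rewrite -mulr_suml uf_sum_a'a mul1r.
apply: eq_bigr => k _; rewrite thetaK !mulrA uf_a'e -!mulrA.
have -> // : r (i, l) * e = r (i, l).
by rewrite -fixed -[LHS]mulrA single1M tE.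
Qed.

End Fixed.
End Iso.
End Miso.

(** * Norms *)

(** The features of the 1-norm on essentially bounded functions that the norm computations use;
    [rn_idem] is additivity over a set and its complement. *)
Record ringnorm (R : realDomainType) (G : groupType) (L : comPzRingType)
    (a : ringAction G L) := Ringnorm {
  rn :> L -> R;
  rn0 : rn 0 = 0;
  rn_ge0 : forall u, 0 <= rn u;
  rnD : forall u v, rn (u + v) <= rn u + rn v;
  rn_idem : forall p u, p * p = p -> rn u = rn (p * u) + rn ((1 - p) * u);
  rn_shift : forall s u, rn (a s u) = rn u;
  rn_mul : forall v, exists2 C, 0 <= C & forall u, rn (u * v) <= C * rn u
}.

Section Cnorm.
Variables (R : realDomainType) (G : groupType) (L : comPzRingType).
Variables (a : ringAction G L) (N : ringnorm R a).

Implicit Types (x y : crossed a) (u v : L) (s t : G).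

Definition cnorm (x : crossed a) : R := \sum_(s \in [set: G]) N (x s).

Lemma cnormE (r : seq G) x : uniq r -> [set s | x s != 0] `<=` [set` r] ->
  cnorm x = \sum_(s <- r) N (x s).
Proof.
move=> ur xr; apply: fsbig_seq_widen => // s /= Ns; apply: xr => /=.
by apply: contraNneq Ns => ->; rewrite rn0.
Qed.

Lemma cnorm_csupp x : cnorm x = \sum_(s <- csupp x) N (x s).
Proof. by apply: cnormE; [exact: csupp_uniq|exact: csuppP]. Qed.

Lemma cnorm_ge0 x : 0 <= cnorm x.
Proof. by rewrite cnorm_csupp sumr_ge0 // => s _; exact: rn_ge0. Qed.

Lemma cnorm0 : cnorm 0 = 0.
Proof. by rewrite (@cnormE [::]) ?big_nil // => s; rewrite /mkset crossed0 eqxx. Qed.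

Lemma cnorm_single u s : cnorm (single a u s) = N u.
Proof.
rewrite (@cnormE [:: s]) ?big_seq1 ?singleE ?eqxx // => t.
by rewrite /mkset singleE inE; case: (t =P s) => //; rewrite eqxx.
Qed.

Lemma support_union (x y : crossed a) : exists2 r : seq G, uniq r &
  [set s | x s != 0] `<=` [set` r] /\ [set s | y s != 0] `<=` [set` r].
Proof.
exists (undup (csupp x ++ csupp y)); first exact: undup_uniq.
by split=> s /csuppP/=; rewrite mem_undup mem_cat => ->; rewrite ?orbT.
Qed.

Lemma cnormD x y : cnorm (x + y) <= cnorm x + cnorm y.
Proof.
have [r ur [xr yr]] := support_union x y.
rewrite (cnormE ur xr) (cnormE ur yr) (@cnormE r) //.
  by rewrite -big_split; apply: ler_sum => s _; rewrite crossedD; exact: rnD.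
move=> s; rewrite /mkset crossedD; have [->|/xr//] := eqVneq (x s) 0.
by rewrite add0r => /yr.
Qed.

Lemma cnorm_sum I (r : seq I) (F : I -> crossed a) :
  cnorm (\sum_(i <- r) F i) <= \sum_(i <- r) cnorm (F i).
Proof.
elim: r => [|i r IHr]; first by rewrite !big_nil cnorm0.
by rewrite !big_cons (le_trans (cnormD _ _)) // lerD2l.
Qed.

Lemma cnorm_mulr y : exists2 C, 0 <= C & forall x, cnorm (x * y) <= C * cnorm x.
Proof.
elim/crossed_ind: y => [|y1 y2 [C1 C10 H1] [C2 C20 H2]|v t].
- by exists 0 => // x; rewrite mulr0 cnorm0 mul0r.
- exists (C1 + C2); first exact: addr_ge0.
  by move=> x; rewrite mulrDr mulrDl (le_trans (cnormD _ _)) // lerD.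
have [C C0 HC] := rn_mul N v.
exists C => // x; rewrite {1}[x]crossed_sumE mulr_suml.
rewrite (le_trans (cnorm_sum _ _)) // cnorm_csupp mulr_sumr.
apply: ler_sum => s _; rewrite singleM cnorm_single.
rewrite -(rn_shift N s^-1%g) rmorphM -ractM mulVg ract1.
by rewrite (le_trans (HC _)) // rn_shift.
Qed.

Lemma rn_orth (I : eqType) (r : seq I) (p : I -> L) u : uniq r ->
  (forall i j, p i * p j = if i == j then p i else 0) ->
  N ((\sum_(i <- r) p i) * u) = \sum_(i <- r) N (p i * u).
Proof.
move=> + pp; elim: r => [|i r IHr] => [_|/andP[ir ur]].
  by rewrite !big_nil mul0r rn0.
have pi0 : p i * (\sum_(j <- r) p j) = 0.
  rewrite mulr_sumr big_seq big1 // => j jr; rewrite pp.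
  by case: eqP => // ij; rewrite ij jr in ir.
rewrite !big_cons (@rn_idem _ _ _ _ N (p i)); last by rewrite pp eqxx.
rewrite !mulrA -IHr // mulrDr pi0 addr0 pp eqxx; congr (_ + N (_ * _)).
by rewrite mulrBl mul1r mulrDr pp eqxx pi0 addr0 addrAC subrr add0r.
Qed.

Lemma rn_orth_sum (I : finType) (p : I -> L) u :
  (forall i j, p i * p j = if i == j then p i else 0) -> \sum_i p i = 1 ->
  N u = \sum_i N (p i * u).
Proof.
by move=> pp p1; rewrite -(rn_orth _ (index_enum_uniq I) pp) p1 mul1r.
Qed.

Lemma cnorm_left (I : finType) (p : I -> L) x :
  (forall i j, p i * p j = if i == j then p i else 0) -> \sum_i p i = 1 ->
  cnorm x = \sum_i cnorm (single a (p i) 1%g * x).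
Proof.
move=> pp p1; rewrite cnorm_csupp.
under eq_bigr do rewrite (rn_orth_sum _ pp p1).
rewrite exchange_big; apply: eq_bigr => i _ /=.
rewrite (cnormE (csupp_uniq x)) => [|s].
  by apply: eq_bigr => s _; rewrite mul_single1E.
by rewrite /mkset mul_single1E => H; apply: csuppP; apply: contraNneq H => ->; rewrite mulr0.
Qed.

Lemma cnorm_right (I : finType) (p : I -> L) x :
  (forall i j, p i * p j = if i == j then p i else 0) -> \sum_i p i = 1 ->
  cnorm x = \sum_i cnorm (x * single a (p i) 1%g).
Proof.
move=> pp p1; rewrite cnorm_csupp.
have pps s i j : a s (p i) * a s (p j) = if i == j then a s (p i) else 0.
  by rewrite -rmorphM pp; case: ifP; rewrite // rmorph0.
have p1s s : \sum_i a s (p i) = 1 by rewrite -rmorph_sum p1 rmorph1.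
under eq_bigr => s _ do rewrite (rn_orth_sum _ (pps s) (p1s s)).
rewrite exchange_big; apply: eq_bigr => i _ /=.
rewrite (cnormE (csupp_uniq x)) => [|s].
  by apply: eq_bigr => s _; rewrite mulr_single1E mulrC.
by rewrite /mkset mulr_single1E => H; apply: csuppP; apply: contraNneq H => ->; rewrite mul0r.
Qed.

Lemma cnorm_transl s x : cnorm (single a 1 s * x) = cnorm x.
Proof.
rewrite [RHS]cnorm_csupp (@cnormE [seq (s * t)%g | t <- csupp x]).
- rewrite big_map; apply: eq_bigr => t _.
  by rewrite singleME mulKg mul1r rn_shift.
- by rewrite map_inj_uniq ?csupp_uniq //; exact: mulgI.
move=> t; rewrite /mkset singleME mul1r => H.
apply/mapP; exists (s^-1 * t)%g; last by rewrite mulVKg.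
by apply: csuppP => /=; apply: contraNneq H => ->; rewrite rmorph0.
Qed.

Lemma cnorm_transr s x : cnorm (x * single a 1 s) = cnorm x.
Proof.
rewrite [RHS]cnorm_csupp (@cnormE [seq (t * s)%g | t <- csupp x]).
- rewrite big_map; apply: eq_bigr => t _.
  by rewrite mulr_singleE mulgK rmorph1 mulr1.
- by rewrite map_inj_uniq ?csupp_uniq //; exact: mulIg.
move=> t; rewrite /mkset mulr_singleE rmorph1 mulr1 => H.
by apply/mapP; exists (t * s^-1)%g; [exact: csuppP|rewrite mulgVK].
Qed.

Section Fam.
Variables (e : L) (F : unitfam a e).
Local Notation A := (@uf_a _ _ _ _ F).
Local Notation A' := (@uf_a' _ _ _ _ F).

(** The summands [A' k * z k] live over the disjoint parts [p k], and on the part that supports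
    [z k] the factor [A' k] is a mere translation. *)
Lemma cnorm_glue (z : uf_idx F -> crossed a) :
  (forall k, A k * A' k * z k = z k) ->
  cnorm (\sum_k A' k * z k) = \sum_k cnorm (z k).
Proof.
move=> zE; rewrite (cnorm_left _ (@uf_orth _ _ _ _ F) (uf_sum F)).
apply: eq_bigr => k _; rewrite -uf_a'a -mulrA mulr_sumr.
rewrite (bigD1 k) //= big1 ?addr0 => [|j jk]; last first.
  by rewrite mulrA uf_aa' eq_sym (negPf jk) mul0r.
rewrite [A k * _]mulrA zE -[RHS](cnorm_transl (uf_g k)^-1%g) -[in RHS]zE mulrA.
rewrite uf_aa' eqxx singleM mul1r mulg1 -ractM mulVg ract1.
by [].
Qed.

(** Multiplying by [A' l] on the right restricts to the part [p l] and then translates, and the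
    parts add up to 1. *)
Lemma cnorm_spread x : \sum_l cnorm (x * A' l) = cnorm x.
Proof.
rewrite (cnorm_right _ (@uf_orth _ _ _ _ F) (uf_sum F)).
apply: eq_bigr => l _; rewrite -(cnorm_transr (uf_g l)) -mulrA singleM mulVg rmorph1.
by rewrite mulr1.
Qed.

End Fam.
End Cnorm.

(** * The 1-norm under the identification of corners *)

Section ThetaNorm.
Variables (R : realDomainType) (G H : groupType) (L1 L2 : comPzRingType).
Variables (a : ringAction G L1) (b : ringAction H L2) (c : coupling a b).
Variables (N1 : ringnorm R a) (N2 : ringnorm R b) (r : R).
Hypothesis rN : forall u, r * N2 (push c u) = N1 (pull c 1 * u).

Lemma theta_coef x h : theta c x h = \sum_(g <- csupp x) cell c g h * push c (x g).
Proof.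
rewrite {1}[x]crossed_sumE theta_sum crossed_sum; apply: eq_bigr => g _.
exact: theta_singleE.
Qed.

(** For fixed h the cells of distinct g are orthogonal, so the coefficient at h is composed of its
    contributions without cancellation. For fixed g the cells add up to one idempotent, which is the
    compression by e on the right. *)
Lemma cnorm_theta x :
  r * cnorm N2 (theta c x) =
  cnorm N1 (single a (pull c 1) 1%g * x * single a (pull c 1) 1%g).
Proof.
pose s := undup (flatten [seq rows c g | g <- csupp x]).
have us : uniq s by exact: undup_uniq.
have rs g : g \in csupp x -> {subset rows c g <= s}.
  by move=> gx h hg; rewrite mem_undup; apply/flatten_mapP; exists g.
rewrite (@cnormE _ _ _ _ _ s) //; last first.
  move=> h; rewrite /mkset theta_coef; apply: contraNT => hs.
  rewrite big_seq big1 // => g gx; rewrite cell_rows ?mul0r //.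
  by apply: contra hs; exact: rs.
transitivity (\sum_(g <- csupp x) \sum_(h <- s) r * N2 (cell c g h * push c (x g))).
  rewrite mulr_sumr exchange_big; apply: eq_bigr => h _; rewrite -mulr_sumr.
  congr (_ * _); set w := theta c x h.
  have E g : g \in csupp x -> cell c g h * push c (x g) = cell c g h * w.
    move=> gx; rewrite /w theta_coef mulr_sumr (bigD1_seq g) ?csupp_uniq //=.
    rewrite mulrA cell_colM eqxx big1 ?addr0 // => g' gg'.
    by rewrite mulrA cell_colM eq_sym (negPf gg') mul0r.
  under eq_big_seq => g gx do rewrite E //.
  rewrite -(rn_orth N2 w (csupp_uniq x) (fun g g' => cell_colM c g g' h)).
  congr (N2 _); rewrite mulr_suml.
  under eq_big_seq => g gx do rewrite -E //.
  by rewrite -theta_coef.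
rewrite (cnormE N1 (csupp_uniq x)) => [|g]; last first.
  rewrite /mkset mulr_single1E mul_single1E => H0; apply: csuppP.
  by apply: contraNneq H0 => ->; rewrite mulr0 mul0r.
apply: eq_big_seq => g gx; rewrite mulr_single1E mul_single1E.
rewrite -mulr_sumr -(rn_orth N2 (push c (x g)) us (fun h h' => cell_rowM c g h h')).
have -> : \sum_(h <- s) cell c g h = push c (a g (pull c 1)).
  rewrite -sum_rows (bigID (fun h => h \in rows c g)) /= [X in _ + X]big1 ?addr0.
    rewrite -big_filter; apply: perm_big; apply: uniq_perm.
    - exact: filter_uniq.
    - exact: rows_uniq.
    by move=> h; rewrite mem_filter; case: (boolP (h \in rows c g)) => //= /(rs g gx) ->.
  by move=> h; exact: cell_rows.
by rewrite -pushM rN mulrA mulrAC.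
Qed.

End ThetaNorm.

Section MisoNorm.
Variables (R : realFieldType) (G H : groupType) (L1 L2 : comPzRingType).
Variables (a : ringAction G L1) (b : ringAction H L2) (c : coupling a b).
Variables (F : unitfam a (pull c 1)) (E : unitfam b (push c 1)).
Variables (N1 : ringnorm R a) (N2 : ringnorm R b) (r : R).
Hypothesis r0 : r != 0.
Hypothesis rN : forall v, N1 (pull c v) = r * N2 (push c 1 * v).
Local Notation T := (theta_rep F).
Variables (M : lmodType (crossed b)) (I : finType).
Variable iso : {linear M -> {ffun I -> (crossed b)^o}}.

Lemma uf_a_f_orth (k m : uf_idx F) : k != m -> T 1 k m = 0.
Proof. by move=> km; rewrite theta_repE mulr1 uf_aa' (negPf km) theta0. Qed.

Lemma mpull_diag (u : mpull T M) k : T 1 k k *: u k = u k.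
Proof.
rewrite -[RHS]mpull1E (bigD1 k) // big1 => [|m mk]; first by rewrite [RHS]addr0.
by rewrite uf_a_f_orth 1?eq_sym // scale0r.
Qed.

(** [cnorm_glue] accounts for the sum over k, [cnorm_spread] for the sum over l, and [cnorm_theta]
    for the factor r. *)
Lemma miso_norm (u : mpull T M) :
  \sum_(il : I * uf_idx E) cnorm N1 (miso E iso u il) =
  r * \sum_k \sum_i cnorm N2 (iso (u k) i).
Proof.
have cn x : cnorm N1 (theta (coupling_sym c) x) =
    r * cnorm N2 (single b (push c 1) 1%g * x * single b (push c 1) 1%g).
  rewrite -(@cnorm_theta _ _ _ _ _ _ _ (coupling_sym c) N2 N1 r^-1).
    by rewrite mulrA mulfV // mul1r.
  by move=> v; rewrite [push _ _]/= rN mulrA mulVf // mul1r.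
have uE k i : T 1 k k * (iso (u k) i : crossed b) = iso (u k) i.
  by rewrite -{2}(mpull_diag u k) isoZ.
transitivity (\sum_(il : I * uf_idx E) \sum_k
    r * cnorm N2 ((iso (u k) il.1 : crossed b) * uf_a' il.2)).
  apply: eq_bigr => -[i l] _; rewrite ffunE /miso_fun /= cnorm_glue => [|k].
    apply: eq_bigr => k _; rewrite cn; congr (r * cnorm N2 _).
    rewrite -!mulrA uf_a'e mulrA -uE mulrA.
    by rewrite mul_f_theta.
  have E1 := theta'_thetaM c (uf_a k * uf_a' k) ((iso (u k) i : crossed b) * uf_a' l).
  have E2 := uE k i; rewrite theta_repE mulr1 in E2.
  rewrite mulrA E2 in E1; rewrite [in RHS]E1.
  by rewrite [single _ _ _ * (_ * _)]mulrA uf_ea.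
rewrite mulr_sumr exchange_big; apply: eq_bigr => k _ /=.
rewrite mulr_sumr -(pair_bigA _ (fun i l => r * cnorm N2 ((iso (u k) i : crossed b) * uf_a' l))).
apply: eq_bigr => i _ /=; rewrite -mulr_sumr; congr (r * _).
exact: cnorm_spread.
Qed.

End MisoNorm.

(** * The 1-norm of essentially bounded functions *)

Section LinfNorm.
Variables (R : realType) (d : measure_display) (X : measurableType d).
Variables (mu : probability X R) (Z : normedCoeff R).
Hypothesis norm0 : coeff_norm (0 : Z) = 0.
Implicit Types (u v w : Linf mu Z) (f : bmf mu Z).

Lemma bmf_norm_measurable f : measurable_fun setT (fun x => (coeff_norm (f x))%:E).
Proof.
apply/measurable_EFinP => _ S _; rewrite setTI.
by case: f => f /= /asboolP[mf _]; exact: (mf (@coeff_norm R Z @^-1` S)).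
Qed.

Lemma Linf_int_fin u : (\int[mu]_x (coeff_norm (repr u x))%:E)%E \is a fin_num.
Proof.
have [C uC] : exists C : R, {ae mu, forall x, coeff_norm (repr u x) <= C}.
  by case: (repr u) => f /= /asboolP[_ [C fC]]; exists C.
rewrite ge0_fin_numE; last by apply: integral_ge0 => x _; rewrite lee_fin coeff_norm_ge0.
apply: (@le_lt_trans _ _ (\int[mu]_x (cst (Num.max C 0)%:E x))%E).
  apply: ae_ge0_le_integral => //.
  - by move=> x _; rewrite lee_fin coeff_norm_ge0.
  - exact: bmf_norm_measurable.
  - by move=> x _; rewrite lee_fin le_max lexx orbT.
  - by apply: filterS uC => x ux _; rewrite lee_fin le_max ux.
by rewrite integral_cst //= [X in (_ * X)%E]probability_setT mule1 ltry.
Qed.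

Lemma Linf_norm1E u : (Linf_norm1 u)%:E = (\int[mu]_x (coeff_norm (repr u x))%:E)%E.
Proof. by rewrite /Linf_norm1 fineK ?Linf_int_fin. Qed.

Lemma Linf_norm1_ge0 u : 0 <= Linf_norm1 u.
Proof.
by rewrite -lee_fin Linf_norm1E; apply: integral_ge0 => x _; rewrite lee_fin coeff_norm_ge0.
Qed.

Lemma Linf_norm1_add u v : (Linf_norm1 u + Linf_norm1 v)%:E =
  (\int[mu]_x (coeff_norm (repr u x) + coeff_norm (repr v x))%:E)%E.
Proof.
rewrite EFinD !Linf_norm1E -ge0_integralD //.
all: try (by move=> x _; rewrite lee_fin coeff_norm_ge0).
all: exact: bmf_norm_measurable.
Qed.

Lemma bmf_norm_add_measurable u v :
  measurable_fun setT (fun x => (coeff_norm (repr u x) + coeff_norm (repr v x))%:E).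
Proof.
under eq_fun do rewrite EFinD.
by apply: emeasurable_funD; exact: bmf_norm_measurable.
Qed.

Lemma Linf_norm1_le u v w :
  {ae mu, forall x, coeff_norm (repr u x) <= coeff_norm (repr v x) + coeff_norm (repr w x)} ->
  Linf_norm1 u <= Linf_norm1 v + Linf_norm1 w.
Proof.
move=> H; rewrite -lee_fin Linf_norm1_add Linf_norm1E.
apply: ae_ge0_le_integral => //.
- by move=> x _; rewrite lee_fin coeff_norm_ge0.
- exact: bmf_norm_measurable.
- by move=> x _; rewrite lee_fin addr_ge0 // coeff_norm_ge0.
- exact: bmf_norm_add_measurable.
- by apply: filterS H => x ux _; rewrite lee_fin.
Qed.

Lemma Linf_norm1_eq u v w :
  {ae mu, forall x, coeff_norm (repr u x) = coeff_norm (repr v x) + coeff_norm (repr w x)} ->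
  Linf_norm1 u = Linf_norm1 v + Linf_norm1 w.
Proof.
move=> H; apply: EFin_inj; rewrite Linf_norm1_add Linf_norm1E.
apply: ae_eq_integral => //.
- exact: bmf_norm_measurable.
- exact: bmf_norm_add_measurable.
- by apply: filterS H => x ux _; rewrite ux.
Qed.

Lemma Linf_norm1_0 : Linf_norm1 (0 : Linf mu Z) = 0.
Proof.
apply: (addIr (Linf_norm1 (0 : Linf mu Z))); rewrite add0r; apply/esym.
by apply: Linf_norm1_eq; apply: filterS (repr_zero mu Z) => x ->; rewrite norm0 addr0.
Qed.

Lemma Linf_norm1D u v : Linf_norm1 (u + v) <= Linf_norm1 u + Linf_norm1 v.
Proof.
by apply: Linf_norm1_le; apply: filterS (repr_add u v) => x ->; exact: coeff_normD.
Qed.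

(** Multiplicativity forces the norms of 1, p and 1 - p to be 0 or 1. Those of p and 1 - p have
    product |0| = 0 and sum at least |1|, so they add up to |1|. *)
Lemma coeff_norm_idem (p z : Z) : p * p = p ->
  coeff_norm z = coeff_norm (p * z) + coeff_norm ((1 - p) * z).
Proof.
move=> pp; rewrite !coeff_normM -mulrDl.
have pn : coeff_norm p * coeff_norm p = coeff_norm p by rewrite -coeff_normM pp.
have q0 : coeff_norm p * coeff_norm (1 - p) = 0.
  by rewrite -coeff_normM mulrBr mulr1 pp subrr.
have qn : coeff_norm (1 - p) * coeff_norm (1 - p) = coeff_norm (1 - p).
  by rewrite -coeff_normM mulrBr mulr1 mulrBl mul1r pp subrr subr0.
have n1 : coeff_norm (1 : Z) <= coeff_norm p + coeff_norm (1 - p).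
  by rewrite -{1}(subrK p 1) addrC (le_trans (coeff_normD _ _)) // addrC.
have nz : coeff_norm z = coeff_norm (1 : Z) * coeff_norm z by rewrite -coeff_normM mul1r.
have n11 : coeff_norm (1 : Z) * coeff_norm (1 : Z) = coeff_norm (1 : Z).
  by rewrite -coeff_normM mul1r.
have id01 (x : R) : x * x = x -> x = 0 \/ x = 1.
  move=> xx; have [->|x0] := eqVneq x 0; first by left.
  by right; apply: (mulfI x0); rewrite xx mulr1.
have pn1 : coeff_norm p = coeff_norm (1 : Z) * coeff_norm p by rewrite -coeff_normM mul1r.
have qn1 : coeff_norm (1 - p) = coeff_norm (1 : Z) * coeff_norm (1 - p).
  by rewrite -coeff_normM mul1r.
rewrite {1}nz; congr (_ * _).
case: (id01 _ n11) => e1; rewrite e1 in pn1 qn1 n1 *.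
  by rewrite pn1 qn1 !mul0r addr0.
case: (id01 _ pn) => ep; case: (id01 _ qn) => eq; rewrite ep eq ?addr0 ?add0r // in n1 q0 *.
  by move: n1; rewrite ler10.
by move/eqP: q0; rewrite mulr1 oner_eq0.
Qed.

Lemma Linf_norm1_idem p u : p * p = p ->
  Linf_norm1 u = Linf_norm1 (p * u) + Linf_norm1 ((1 - p) * u).
Proof.
move=> pp; apply: Linf_norm1_eq.
have H1 : {ae mu, forall x, repr (1 - p) x = 1 - repr p x}.
  apply: filterS2 (repr_add (1 - p) p) (repr_one mu Z) => x.
  by rewrite subrK => -> H; rewrite -H addrK.
have Hp : {ae mu, forall x, repr p x * repr p x = repr p x}.
  by have := repr_mul p p; rewrite pp; apply: filterS => x.
apply: filterS3 (repr_mul p u) (repr_mul (1 - p) u) (filterI H1 Hp) => x -> -> [-> px].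
exact: coeff_norm_idem.
Qed.

Lemma Linf_norm1M v : exists2 C, 0 <= C & forall u, Linf_norm1 (u * v) <= C * Linf_norm1 u.
Proof.
have [C vC] : exists C : R, {ae mu, forall x, coeff_norm (repr v x) <= C}.
  by case: (repr v) => f /= /asboolP[_ [C fC]]; exists C.
exists (Num.max C 0); first by rewrite le_max lexx orbT.
move=> u; rewrite -lee_fin EFinM !Linf_norm1E -ge0_integralZl_EFin //; last first.
- by rewrite le_max lexx orbT.
- exact: bmf_norm_measurable.
- by move=> x _; rewrite lee_fin coeff_norm_ge0.
apply: ae_ge0_le_integral => //.
- by move=> x _; rewrite lee_fin coeff_norm_ge0.
- exact: bmf_norm_measurable.
- by move=> x _; rewrite -EFinM lee_fin mulr_ge0 ?coeff_norm_ge0 // le_max lexx orbT.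
- by apply: measurable_funeM; exact: bmf_norm_measurable.
- apply: filterS2 vC (repr_mul u v) => x vx -> _; rewrite -EFinM lee_fin coeff_normM mulrC.
  by rewrite ler_wpM2r ?coeff_norm_ge0 // le_max vx.
Qed.

(** Rewrites integrals as finite sums of measures of fibers, to which invariance of the measure and
    the scaling by c apply directly. *)
Lemma Linf_norm1_simple u (v : X -> Z) (s : seq Z) : {ae mu, forall x, repr u x = v x} ->
  simple v -> simple_range v s ->
  (Linf_norm1 u)%:E = (\sum_(z <- s) (coeff_norm z)%:E * mu (v @^-1` [set z]))%E.
Proof.
move=> uv sv [us vs]; have [_ mv] := sv.
rewrite Linf_norm1E.
transitivity (\int[mu]_x (\sum_(z <- s) (coeff_norm z)%:E * (\1_(v @^-1` [set z]) x)%:E))%E.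
  apply: ae_eq_integral => //.
  - exact: bmf_norm_measurable.
  - apply: emeasurable_sum => z; apply: measurable_funeM.
    by apply/measurable_EFinP; exact: measurable_indic.
  - apply: filterS uv => x -> _; rewrite (bigD1_seq (v x)) //= big1 => [|z zv].
      by rewrite indicE mem_set // mule1 adde0.
    by rewrite indicE memNset ?mule0 // => /esym/eqP; rewrite (negPf zv).
rewrite ge0_integral_sum //.
- apply: eq_bigr => z _; rewrite ge0_integralZl_EFin ?coeff_norm_ge0 //.
    by rewrite integral_indic // setIT.
  by apply/measurable_EFinP; exact: measurable_indic.
- move=> z; apply: measurable_funeM.
  by apply/measurable_EFinP; exact: measurable_indic.
- by move=> z x _; rewrite mule_ge0 // lee_fin ?coeff_norm_ge0.
Qed.

End LinfNorm.

Section LinfRingnorm.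
Variables (R : realType) (d : measure_display) (X : measurableType d).
Variables (mu : probability X R) (G : groupType) (a : standardAction mu G).
Variables (Z : normedCoeff R) (fb : finite_balls Z).
Hypothesis norm0 : coeff_norm (0 : Z) = 0.

Lemma Linf_norm1_shift s (u : Linf mu Z) :
  Linf_norm1 (Linf_action a Z s u) = Linf_norm1 u.
Proof.
have [v sv uv] := bmf_asimple (repr u) fb; have [[r [ur vr]] mv] := sv.
apply: EFin_inj; rewrite (Linf_norm1_simple uv sv (conj ur vr)).
rewrite (@Linf_norm1_simple _ _ _ _ _ _ (v \o a s^-1%g) r).
- apply: eq_bigr => z _; congr (_ * _)%E.
  by rewrite comp_preimage sact_preserving.
- by apply: filterS2 (repr_shift a s u) (ae_sact a s^-1%g uv) => x -> ->.
- split; first by exists r; split => // x; exact: vr.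
  by move=> z; rewrite comp_preimage; exact: sact_preimage_measurable.
- by split => // x; exact: vr.
Qed.

Definition Linf_ringnorm : ringnorm R (Linf_action a Z) :=
  @Ringnorm R G (Linf mu Z) (Linf_action a Z) (@Linf_norm1 R d X mu Z)
    (Linf_norm1_0 mu norm0) (@Linf_norm1_ge0 _ _ _ _ _) (@Linf_norm1D _ _ _ _ _)
    (@Linf_norm1_idem _ _ _ _ _ norm0) Linf_norm1_shift (@Linf_norm1M _ _ _ _ _).

End LinfRingnorm.

Section PullNorm.
Variables (R : realType) (d d' : measure_display) (X : measurableType d) (Y : measurableType d').
Variables (mu : probability X R) (nu : probability Y R) (G H : groupType).
Variables (al : standardAction mu G) (be : standardAction nu H).
Variables (A : set X) (B : set Y) (phi : X -> Y) (psi : Y -> X) (c : R).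
Hypothesis oe : oe_data al be A B phi psi c.
Variables (Z : normedCoeff R) (fb : finite_balls Z).
Hypothesis norm0 : coeff_norm (0 : Z) = 0.

Lemma oe_pull_norm (v : Linf nu Z) :
  Linf_norm1 (pull (oe_coupling oe Z) v) =
  c * Linf_norm1 (push (oe_coupling oe Z) 1 * v).
Proof.
have [w0 sw0 vw0] := bmf_asimple (repr v) fb.
have [[r0 r0P] mw0] := sw0.
(* Extended by 0 so that fibers over nonzero values lie inside [B] and correspond to fibers of [t]
   inside [A]. Fibers over 0 do not correspond, but their term vanishes by [norm0]. *)
pose w y := if y \in B then w0 y else 0.
pose r := undup (0 :: r0).
have ur : uniq r by exact: undup_uniq.
have wr y : w y \in r.
  by rewrite /w mem_undup inE; case: ifP => _; rewrite ?eqxx // (proj2 r0P) orbT.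
have wz z : z != 0 -> w @^-1` [set z] = B `&` w0 @^-1` [set z].
  move=> z0; apply/seteqP; split=> y; rewrite /preimage /w /=.
    by case: ifPn => [/set_mem By <-//|_ z0']; rewrite -z0' eqxx in z0.
  by move=> [By <-]; rewrite mem_set.
have mB := oe_mB oe; have mA := oe_mA oe.
have sw : simple w.
  split; first by exists r.
  move=> z; have [->|z0] := eqVneq z 0; last by rewrite wz //; exact: measurableI.
  have -> : w @^-1` [set 0] = ~` B `|` w0 @^-1` [set 0].
    apply/seteqP; split=> y; rewrite /preimage /w /=.
      by have [By|By] := pselect (B y); [rewrite mem_set //; right|left].
    by case: ifPn => // /set_mem By [].
  by apply: measurableU; [exact: measurableC|exact: mw0].
pose t x := if x \in A then w (phi x) else 0.
have tr x : t x \in r by rewrite /t; case: ifP => // _; rewrite mem_undup inE eqxx.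
have tz z : z != 0 -> t @^-1` [set z] = A `&` phi @^-1` (w @^-1` [set z]).
  move=> z0; apply/seteqP; split=> y; rewrite /preimage /t /=.
    by case: ifPn => [/set_mem Ay <-//|_ z0']; rewrite -z0' eqxx in z0.
  by move=> [By <-]; rewrite mem_set.
have st : simple t.
  split; first by exists r.
  move=> z; have [->|z0] := eqVneq z 0; last first.
    by rewrite tz //; apply: (oe_mphi oe) => //; exact: (proj2 sw).
  have -> : t @^-1` [set 0] = ~` A `|` (A `&` phi @^-1` (w @^-1` [set 0])).
    apply/seteqP; split=> y; rewrite /preimage /t /=.
      by have [By|By] := pselect (A y); [rewrite mem_set //; right|left].
    by case: ifPn => // /set_mem By [|[]].
  apply: measurableU; first exact: measurableC.
  by apply: (oe_mphi oe) => //; exact: (proj2 sw).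
have vw : {ae nu, forall y, repr (push (oe_coupling oe Z) 1 * v) y = w y}.
  apply: filterS3 (repr_mul (push (oe_coupling oe Z) 1) v) (repr_push1 oe Z) vw0 => y ->.
  by rewrite [push _ _]/= /w => -> ->; case: ifP; rewrite ?mul1r ?mul0r.
have vt : {ae mu, forall x, repr (pull (oe_coupling oe Z) v) x = t x}.
  apply: filterS2 (repr_push (oe_sym oe) v) (oe_null (oe_sym oe) vw0) => x E H0.
  rewrite [pull _ _]/= E /t; case: ifPn => // /set_mem Ax.
  by rewrite H0 // /w mem_set //; exact: (oe_phi oe).
apply: EFin_inj; rewrite EFinM.
rewrite (Linf_norm1_simple vt st (conj ur tr)) (Linf_norm1_simple vw sw (conj ur wr)).
rewrite ge0_sume_distrr => [|z _]; last by rewrite mule_ge0 // lee_fin coeff_norm_ge0.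
apply: eq_bigr => z _; have [->|z0] := eqVneq z 0.
  by rewrite norm0 !mul0e mule0.
rewrite tz // (oe_scale oe); last exact: (proj2 sw).
by rewrite wz // setIA setIid muleCA.
Qed.

End PullNorm.

(** * Partitions from cofinite sets *)

Section Cover.
Variables (R : realType) (d : measure_display) (X : measurableType d).
Variables (mu : probability X R) (G : groupType) (al : standardAction mu G) (A : set X).

Record transl_cover := Cover {
  cv_idx : finType;
  cv_set : cv_idx -> set X;
  cv_g : cv_idx -> G;
  cv_measurable : forall i, measurable (cv_set i);
  cv_disj : forall i j x, cv_set i x -> cv_set j x -> i = j;
  cv_ae : {ae mu, forall x, exists i, cv_set i x};
  cv_sub : forall i x, cv_set i x -> A (al (cv_g i) x)
}.

(** Each point is assigned to the first of the finitely many translates of [A] that contains it. *)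
Lemma cofinite_cover : cofinite al A -> inhabited transl_cover.
Proof.
move=> [mA [F [fF nF]]].
have [s us Fs] := finite_set_seq fF.
(* The inverses: a point of the translate of [A] by h is brought back into [A] by h^-1. *)
pose g (i : 'I_(size s)) := (tnth (in_tuple s) i)^-1%g.
pose D i := al (g i) @^-1` A.
have mD i : measurable (D i) by exact: sact_preimage_measurable.
pose S (i : 'I_(size s)) := D i `\` \bigcup_(j in [set j : 'I_(size s) | (j < i)%N]) D j.
have mS i : measurable (S i).
  apply: measurableD => //; apply: fin_bigcup_measurable => [|j _]; last exact: mD.
  exact: finite_finset.
have disj i j x : S i x -> S j x -> i = j.
  move=> [Di Ni] [Dj Nj]; apply: ord_inj.
  by case: (ltngtP i j) => // ij; exfalso; [apply: Nj; exists i|apply: Ni; exists j].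
have ae : {ae mu, forall x, exists i, S i x}.
  apply: negligibleS nF => x /= nx [h Fh [x' Ax' xE]]; apply: nx.
  have hs : (index h s < size s)%N by rewrite index_mem; exact: Fs.
  have ex0 : exists k, `[< exists ks : (k < size s)%N, D (Ordinal ks) x >].
    exists (index h s); apply/asboolP; exists hs.
    rewrite /D /g /preimage /= (tnth_nth 1%g) /= nth_index; last exact: Fs.
    by rewrite -xE sactK.
  case: (ex_minnP ex0) => k /asboolP[ks Dk] kmin.
  exists (Ordinal ks); split=> // -[j /= jk Dj].
  suff : (k <= j)%N by rewrite leqNgt (jk : (j < k)%N).
  apply: kmin; apply/asboolP; exists (ltn_ord j).
  by rewrite (_ : Ordinal _ = j) //; exact: ord_inj.
have sub i x : S i x -> A (al (g i) x) by case.
by constructor; exact: Cover mS disj ae sub.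
Qed.

Variables (Z : normedCoeff R) (cv : transl_cover) (e : Linf mu Z).
Hypothesis mA : measurable A.
Hypothesis eE : e = Linf_chi mu Z A.
Local Notation p i := (Linf_chi mu Z (@cv_set cv i)).

Lemma cover_orth i j : p i * p j = if i == j then p i else 0.
Proof.
rewrite chiM; [|exact: cv_measurable|exact: cv_measurable].
case: eqP => [<-|ij]; first by rewrite setIid.
apply: chi_null; first by apply: measurableI; exact: cv_measurable.
by apply: nearW => x [xi xj]; apply: ij; exact: cv_disj xi xj.
Qed.

Lemma cover_sum : \sum_i p i = 1.
Proof.
rewrite -(chi_setT mu Z); apply: chi_sum => //.
- by move=> i; exact: cv_measurable.
- apply: filterS (cv_ae cv) => x [i xi] _.
  rewrite (bigD1 i) //= chi_funT // big1 ?addr0 // => j /eqP ji.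
  by rewrite chi_funF // => xj; apply: ji; exact: cv_disj xj xi.
- by apply: nearW => x /(_ Logic.I).
Qed.

Lemma cover_sub i : p i * Linf_action al Z (@cv_g cv i)^-1%g e = p i.
Proof.
rewrite eE shift_chi // invgK chiM; [|exact: cv_measurable|exact: sact_preimage_measurable].
congr (Linf_chi _ _ _); apply/seteqP; split=> [x []//|x xi].
by split => //; exact: cv_sub xi.
Qed.

Definition cover_unitfam : unitfam (Linf_action al Z) e :=
  @Unitfam G (Linf mu Z) (Linf_action al Z) e (cv_idx cv) (fun i => p i) (@cv_g cv)
    cover_orth cover_sum cover_sub.

End Cover.

(** * Transport of markings and of logarithmic norms *)

Section CyclicIdeal.
Variables (R : realType) (d : measure_display) (X : measurableType d).
Variables (mu : probability X R) (G : groupType) (a : standardAction mu G).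
Variable Z : normedCoeff R.

Lemma cyclic_idealP (A : set X) (z : crossed (Linf_action a Z)) : measurable A ->
  cyclic_ideal A z <-> z * single _ (Linf_chi mu Z A) 1%g = z.
Proof.
move=> mA; split=> [[r ->]|zE]; last by exists z.
by rewrite -mulrA singleM mulg1 ract1 chiM // setIid.
Qed.

(** The generators are the indicators of the marking sets: a coordinate in the ideal of a set is
    unchanged by right multiplication with its indicator. *)
Lemma marking_sum (M : lmodType (crossed (Linf_action a Z))) (m : marking M) :
  exists eps : mk_idx m -> M, forall x, x = \sum_i mk_iso m x i *: eps i.
Proof.
have /choice[eps epsE] : forall i, exists x, mk_iso m x =
    [ffun j => if j == i then single _ (Linf_chi mu Z (mk_set (m := m) i)) 1%g else 0].
  move=> i; apply/mk_range => j; rewrite ffunE; case: eqP => [->|_].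
    by exists 1; rewrite mul1r.
  by exists 0; rewrite mul0r.
exists eps => x; apply: (@mk_inj _ _ _ _ _ _ _ _ m); apply/ffunP => j.
rewrite iso_sum (bigD1 j) //= big1 ?addr0 => [|i ij].
  rewrite isoZ epsE ffunE eqxx; apply/esym/cyclic_idealP; first exact: mk_measurable.
  by move: j; apply/mk_range; exists x.
by rewrite isoZ epsE ffunE eq_sym (negPf ij) mulr0.
Qed.

End CyclicIdeal.

Section Transport.
Variables (R : realType) (d d' : measure_display) (X : measurableType d) (Y : measurableType d').
Variables (mu : probability X R) (nu : probability Y R) (G H : groupType).
Variables (al : standardAction mu G) (be : standardAction nu H).
Variables (A : set X) (B : set Y) (phi : X -> Y) (psi : Y -> X) (c : R).
Hypothesis oe : oe_data al be A B phi psi c.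
Variables (cvA : transl_cover al A) (cvB : transl_cover be B).
Variable Z : normedCoeff R.

Local Notation cpl := (oe_coupling oe Z).

Lemma oe_pull1 : pull cpl 1 = Linf_chi mu Z A.
Proof. by rewrite (oe_chiB (oe_sym oe)). Qed.

Lemma oe_push1 : push cpl 1 = Linf_chi nu Z B.
Proof. by rewrite (oe_chiB oe). Qed.

Definition oe_famA : unitfam (Linf_action al Z) (pull cpl 1) :=
  cover_unitfam cvA (oe_mA oe) oe_pull1.
Definition oe_famB : unitfam (Linf_action be Z) (push cpl 1) :=
  cover_unitfam cvB (oe_mB oe) oe_push1.

Local Notation T := (theta_rep oe_famA).

Section Marking.
Variables (M : lmodType (crossed (Linf_action be Z))) (m : marking M).
Local Notation I := (mk_idx m).
Local Notation J := (I * cv_idx cvB)%type.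

(** The part of [C] over [l], translated by [cv_g l]; the translate lies in [B]. *)
Definition moved (C : set Y) (l : cv_idx cvB) : set Y :=
  be (cv_g l)^-1%g @^-1` (C `&` cv_set l).

Definition mpull_set (C : I -> set Y) (il : J) : set X := A `&` phi @^-1` (moved (C il.1) il.2).

Lemma moved_measurable C l : measurable C -> measurable (moved C l).
Proof.
by move=> mC; apply: sact_preimage_measurable; apply: measurableI => //; exact: cv_measurable.
Qed.

Lemma mpull_set_measurable C il : measurable (C il.1) -> measurable (mpull_set C il).
Proof. by move=> mC; apply: (oe_mphi oe); [exact: (oe_mA oe)|exact: moved_measurable]. Qed.

Lemma mpull_set_chi C i l : measurable (C i) ->
  Linf_chi mu Z (mpull_set C (i, l)) =
  miso_set (E := oe_famB) (fun i => Linf_chi nu Z (C i)) i l.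
Proof.
move=> mC; rewrite /miso_set [uf_p _]/= chiM //; last exact: cv_measurable.
rewrite shift_chi; last by apply: measurableI => //; exact: cv_measurable.
rewrite [pull _ _]/= oe_push_chi //.
exact: moved_measurable.
Qed.

Local Notation iso := (mk_iso m).
Local Notation miso := (miso (F := oe_famA) oe_famB iso).

Lemma miso_idealP C (u : mpull T M) : (forall i, measurable (C i)) ->
  (forall il, cyclic_ideal (mpull_set C il) (miso u il)) <->
  (forall k i, cyclic_ideal (C i) (iso (u k) i)).
Proof.
move=> mC; have [H1 H2] := miso_fixed oe_famB iso (fun i => Linf_chi nu Z (C i)) u.
split=> [ci k i|ci [i l]].
  apply/cyclic_idealP => //; apply: H2 => {k}i l.
  rewrite -mpull_set_chi //; have := ci (i, l); rewrite ffunE.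
  by move/cyclic_idealP; apply; exact: mpull_set_measurable.
apply/cyclic_idealP; first exact: mpull_set_measurable.
rewrite ffunE mpull_set_chi //; apply: H1 => k {}i.
by apply/cyclic_idealP.
Qed.

Definition mpull_iso : {linear mpull T M -> {ffun J -> (crossed (Linf_action al Z))^o}} :=
  miso_lin oe_famA oe_famB iso.

Lemma mpull_marking_inj : injective mpull_iso.
Proof. exact: (miso_inj (F := oe_famA) (E := oe_famB) (@mk_inj _ _ _ _ _ _ _ _ m)). Qed.

Lemma mpull_marking_range (z : {ffun J -> (crossed (Linf_action al Z))^o}) :
  (exists u : mpull T M, mpull_iso u = z) <->
  forall il, cyclic_ideal (mpull_set (mk_set (m := m)) il) (z il).
Proof.
have mS i : measurable (mk_set (m := m) i) by exact: mk_measurable.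
split=> [[u <-]|zi].
  by apply/miso_idealP => // k; apply/mk_range; exists (u k).
have zE i l : (z (i, l) : crossed _) *
    single _ (miso_set (E := oe_famB) (fun i => Linf_chi nu Z (mk_set (m := m) i)) i l) 1%g =
    z (i, l).
  rewrite -mpull_set_chi //; apply/cyclic_idealP => //.
  exact: mpull_set_measurable.
have /choice[u uE] : forall k : cv_idx cvA, exists x : M, iso x =
    [ffun i => \sum_l theta cpl (uf_a (F := oe_famA) k * (z (i, l) : crossed _)) *
      uf_a (F := oe_famB) l].
  move=> k; apply/mk_range => i; rewrite ffunE; apply/cyclic_idealP => //.
  rewrite mulr_suml; apply: eq_bigr => l _.
  rewrite -mulrA -(set_B (fun i => Linf_chi nu Z (mk_set (m := m) i))) mulrA.
  by rewrite -theta_single1 -theta_e ?single1M ?pull1M // -mulrA zE.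
have uiE k i : iso (u k) i =
    \sum_l theta cpl (uf_a (F := oe_famA) k * (z (i, l) : crossed _)) * uf_a (F := oe_famB) l.
  by rewrite uE ffunE.
have [u' u'E] := miso_surj (F := oe_famA) (E := oe_famB) (iso := iso)
  (@mk_inj _ _ _ _ _ _ _ _ m) (r := z) zE uiE.
exists u'; transitivity (miso u'); first by [].
by rewrite u'E; apply/ffunP => il; rewrite ffunE.
Qed.

Definition mpull_marking : marking (mpull T M) :=
  @Marking _ _ _ _ _ al Z (mpull T M) J (mpull_set (mk_set (m := m)))
    (fun il => mpull_set_measurable (mk_measurable il.1)) mpull_iso
    mpull_marking_inj mpull_marking_range.

Lemma mpull_summand C (u : mpull T M) : (forall i, measurable (C i)) ->
  mk_summand (m := mpull_marking) (mpull_set C) u <-> forall k, mk_summand (m := m) C (u k).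
Proof. by move=> mC; exact: miso_idealP. Qed.

Lemma mpull_mk_sub C : mk_sub C -> mk_sub (m := mpull_marking) (mpull_set C).
Proof.
move=> Cs il; have [mC CS] := Cs il.1; split; first exact: mpull_set_measurable.
by move=> x [Ax [Cx lx]]; split => //; split => //; exact: CS.
Qed.

Lemma mpull_decomposition (K : finType) (C : K -> I -> set Y) :
  marked_decomposition C ->
  marked_decomposition (m := mpull_marking) (fun k => mpull_set (C k)).
Proof.
move=> Cd il; have [mC dC uC] := Cd il.1; split.
- by move=> k; exact: mpull_set_measurable.
- move=> k k' _ _ [x [[_ [xk _]] [_ [xk' _]]]].
  by apply: dC => //; eexists; split; [exact: xk|exact: xk'].
- rewrite /= /mpull_set -uC; apply/seteqP; split=> x.
    by move=> [k _ [Ax [Ckx lx]]]; split => //; split => //; exists k.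
  by move=> [Ax [[k _ Ckx] lx]]; exists k => //; split.
Qed.

(** The cover exhausts [C] only up to a null set, whence the detour through the union [U]. *)
Lemma cover_measure C : measurable C ->
  fine (nu C) = \sum_l fine (nu (C `&` cv_set (t := cvB) l)).
Proof.
move=> mC; pose F l := C `&` cv_set (t := cvB) l.
have mF l : measurable (F l) by apply: measurableI => //; exact: cv_measurable.
pose U := \bigcup_(l in [set` index_enum (cv_idx cvB)]) F l.
have mU : measurable U by apply: fin_bigcup_measurable => //; exact: finite_seq.
have CU : U `<=` C by move=> y [l _ []].
have nCU : nu C = nu U.
  rewrite -[in LHS](setDUK CU) measureU //; last 2 first.
  - exact: measurableD.
  - by rewrite setDIK.
  rewrite [X in (_ + X)%E](_ : _ = 0%E) ?adde0 //; apply/negligibleP.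
    exact: measurableD.
  apply: negligibleS (cv_ae cvB) => y [Cy nU] [l yl]; apply: nU; exists l => //=.
  exact: mem_index_enum.
rewrite nCU measure_fin_bigcup //.
- rewrite -fsbig_seq ?index_enum_uniq // sum_fine // => l _.
  by apply: fin_num_measure; exact: mF.
- by move=> l l' _ _ [y [[_ yl] [_ yl']]]; exact: cv_disj yl yl'.
Qed.

(** Translation preserves [nu], and the translated pieces lie in [B], where [phi] scales measures by
    c. *)
Lemma mpull_dim C : (forall i, measurable (C i)) ->
  mk_dim (m := mpull_marking) (mpull_set C) = c * mk_dim (m := m) C.
Proof.
move=> mC; rewrite /mk_dim mulr_sumr.
transitivity (\sum_i \sum_l c * fine (nu (C i `&` cv_set (t := cvB) l))).
  rewrite pair_bigA; apply: eq_bigr => -[i l] _ /=.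
  rewrite /mpull_set (oe_scale oe); last exact: moved_measurable.
  rewrite fineM ?fin_num_measure //; last first.
    by apply: measurableI; [exact: (oe_mB oe)|exact: moved_measurable].
  congr (_ * fine _).
  have -> : B `&` moved (C i) l = moved (C i) l.
    apply/seteqP; split=> [y []//|y [Cy ly]]; split => //.
    by have := cv_sub ly; rewrite sactVK.
  by rewrite /moved sact_preserving //; apply: measurableI => //; exact: cv_measurable.
by apply: eq_bigr => i _; rewrite -mulr_sumr -cover_measure.
Qed.

End Marking.

Section Norms.
Hypothesis fb : finite_balls Z.
Hypothesis norm0 : coeff_norm (0 : Z) = 0.
Local Notation NA := (Linf_ringnorm al fb norm0).
Local Notation NB := (Linf_ringnorm be fb norm0).

Lemma mpull_norm (M : lmodType (crossed (Linf_action be Z))) (m : marking M) (u : mpull T M) :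
  mk_norm1 (mpull_marking m) u = c * \sum_k mk_norm1 m (u k).
Proof.
have c0 : c != 0 by rewrite gt_eqF // (oe_c oe).
exact: (miso_norm oe_famB c0 (N1 := NA) (N2 := NB) (oe_pull_norm oe fb norm0) (mk_iso m) u).
Qed.

Variables (M N : lmodType (crossed (Linf_action be Z))) (m : marking M) (p : marking N).
Variable f : {linear M -> N}.

(** Right multiplication by each fixed coordinate of the image of a generator is bounded. Such a
    bound is needed because [inf] of an empty set is 0, so an operator norm defined as an infimum
    means something only if some bound exists. *)
Lemma linear_bounded : exists2 C, 0 <= C & forall x, mk_norm1 p (f x) <= C * mk_norm1 m x.
Proof.
have [eps xE] := marking_sum m.
have /choice[D DP] : forall ij : mk_idx m * mk_idx p, exists C : R, 0 <= C /\ forall z,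
    cnorm NB (z * (mk_iso p (f (eps ij.1)) ij.2 : crossed _)) <= C * cnorm NB z.
  by move=> [i j]; have [C C0 CP] := cnorm_mulr NB (mk_iso p (f (eps i)) j); exists C.
exists (\sum_i \sum_j D (i, j)).
  by apply: sumr_ge0 => i _; apply: sumr_ge0 => j _; case: (DP (i, j)).
move=> x; rewrite {1}(xE x) linear_sum.
apply: (@le_trans _ _ (\sum_j \sum_i D (i, j) * cnorm NB (mk_iso m x i))).
  apply: ler_sum => j _; rewrite iso_sum.
  apply: (le_trans (cnorm_sum NB _ _)); apply: ler_sum => i _.
  by rewrite linearZ isoZ; case: (DP (i, j)).
rewrite exchange_big mulr_suml /=; apply: ler_sum => i _.
rewrite -mulr_suml; apply: ler_wpM2l; first by apply: sumr_ge0 => j _; case: (DP (i, j)).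
rewrite /mk_norm1 (bigD1 i) //= lerDl; apply: sumr_ge0 => j _.
exact: (cnorm_ge0 NB).
Qed.

Local Notation f' := (mmap (t := T) f).
Local Notation m' := (mpull_marking m).
Local Notation p' := (mpull_marking p).

Lemma res_opnorm_ge0 C : 0 <= res_opnorm (m := m') p' f' C.
Proof.
rewrite /res_opnorm; set S := [set _ | _].
have [->|/set0P S0] := eqVneq S set0; first by rewrite inf0.
by apply: lb_le_inf => // x [].
Qed.

(** A bound for [f] holds for every component, and the norms of [u] and of its image carry the same
    factor c, which cancels. *)
Lemma mpull_opnorm C : (forall i, measurable (C i)) ->
  res_opnorm (m := m') p' f' (mpull_set (m := m) C) <= res_opnorm (m := m) p f C.
Proof.
move=> mC; apply: lb_le_inf.
  by have [D D0 DP] := linear_bounded; exists D; split => // x _.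
move=> D [D0 DP]; apply: ge_inf; first by exists 0 => x [].
split => // u uC.
rewrite !mpull_norm mulrCA; apply: ler_wpM2l; first exact: ltW (oe_c oe).
rewrite mulr_sumr; apply: ler_sum => k _.
by rewrite mmapE; apply: DP; exact: (proj1 (mpull_summand u mC) uC k).
Qed.

Lemma summand_full (x : N) : mk_summand (m := p) (mk_set (m := p)) x.
Proof. by apply/mk_range; exists x. Qed.

Lemma mk_dim_ge0 (d0 : measure_display) (X0 : measurableType d0) (mu0 : probability X0 R)
  (G0 : groupType) (a0 : standardAction mu0 G0) (M0 : lmodType (crossed (Linf_action a0 Z)))
  (m0 : marking M0) C : 0 <= mk_dim (m := m0) C.
Proof. by apply: sumr_ge0 => i _; exact: fine_ge0. Qed.

(** Every marked summand containing the image of [f] pulls back to one containing the image of [f'],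
    with c times its dimension. *)
Lemma mpull_rk C : (forall i, measurable (C i)) ->
  res_rk (m := m') p' f' (mpull_set (m := m) C) <= c * res_rk (m := m) p f C.
Proof.
move=> mC; rewrite -ler_pdivrMl ?(oe_c oe) //; apply: lb_le_inf.
  exists (mk_dim (mk_set (m := p))), (mk_set (m := p)); split => //.
    by move=> i; split => //; exact: mk_measurable.
  by move=> x _; exact: summand_full.
move=> t [D [Ds fD ->]]; rewrite ler_pdivrMl ?(oe_c oe) //.
have mD i : measurable (D i) by case: (Ds i).
apply: ge_inf; first by exists 0 => x [E [_ _ ->]]; exact: mk_dim_ge0.
exists (mpull_set D); split; last by rewrite mpull_dim.
  exact: mpull_mk_sub.
move=> _ [u uC <-]; apply: (proj2 (mpull_summand (f' u) mD)) => k; rewrite mmapE; apply: fD.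
by exists (u k) => //; exact: (proj1 (mpull_summand u mC) uC k).
Qed.

Lemma res_rk_ge0 (d0 : measure_display) (X0 : measurableType d0) (mu0 : probability X0 R)
  (G0 : groupType) (a0 : standardAction mu0 G0) (M0 N0 : lmodType (crossed (Linf_action a0 Z)))
  (m0 : marking M0) (p0 : marking N0) (f0 : {linear M0 -> N0}) C :
  0 <= res_rk (m := m0) p0 f0 C.
Proof.
rewrite /res_rk; set S := [set _ | _].
have [->|/set0P S0] := eqVneq S set0; first by rewrite inf0.
by apply: lb_le_inf => // x [E [_ _ ->]]; exact: mk_dim_ge0.
Qed.

Lemma log_plus_ge0 (t : R) : 0 <= log_plus t.
Proof. by rewrite le_max lexx orbT. Qed.

Lemma log_plus_le (s t : R) : 0 <= s -> s <= t -> log_plus s <= log_plus t.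
Proof.
rewrite le_eqVlt => /orP[/eqP<- _|s0 st].
  (* The case s = 0: the convention [ln 0 = 0] agrees with log_+ 0 = 0. *)
  by rewrite {1}/log_plus ln0 // maxxx log_plus_ge0.
rewrite /log_plus ge_max !le_max lexx orbT andbT.
by rewrite ler_ln ?posrE ?st ?(lt_le_trans s0).
Qed.

Lemma mpull_lognorm' C : (forall i, measurable (C i)) ->
  res_lognorm' (m := m') p' f' (mpull_set (m := m) C) <= c * res_lognorm' (m := m) p f C.
Proof.
move=> mC; rewrite /res_lognorm' minr_pMr ?(ltW (oe_c oe)) //.
have L := log_plus_le (res_opnorm_ge0 _) (mpull_opnorm mC).
rewrite le_min !ge_min; apply/andP; split; apply/orP; [left|right]; rewrite mulrA.
  by rewrite -mpull_dim //; apply: ler_wpM2l => //; exact: mk_dim_ge0.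
by apply: ler_pM => //; [exact: res_rk_ge0|exact: log_plus_ge0|exact: mpull_rk].
Qed.

Lemma res_lognorm'_ge0 (d0 : measure_display) (X0 : measurableType d0) (mu0 : probability X0 R)
  (G0 : groupType) (a0 : standardAction mu0 G0) (M0 N0 : lmodType (crossed (Linf_action a0 Z)))
  (m0 : marking M0) (p0 : marking N0) (f0 : {linear M0 -> N0}) C :
  0 <= res_lognorm' (m := m0) p0 f0 C.
Proof. by rewrite le_min !mulr_ge0 ?mk_dim_ge0 ?res_rk_ge0 ?log_plus_ge0. Qed.

Lemma mpull_lognorm : lognorm m' p' f' <= c * lognorm m p f.
Proof.
rewrite -ler_pdivrMl ?(oe_c oe) //; apply: lb_le_inf.
  (* The decomposition into a single piece shows that the infimum is over a nonempty set. *)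
  exists (\sum_(k : unit) res_lognorm' (m := m) p f (mk_set (m := m))), unit,
    (fun=> mk_set (m := m)); split => // i; split.
  - by move=> _; exact: mk_measurable.
  - by move=> [] [].
  - by apply/seteqP; split=> [x []//|x xi]; exists tt.
move=> t [K [C [Cd ->]]]; rewrite ler_pdivrMl ?(oe_c oe) //.
apply: (@le_trans _ _ (\sum_k res_lognorm' (m := m') p' f' (mpull_set (m := m) (C k)))).
  apply: ge_inf; first by exists 0 => x [K' [C' [_ ->]]]; apply: sumr_ge0 => k _;
    exact: res_lognorm'_ge0.
  exists K, (fun k => mpull_set (m := m) (C k)); split => //.
  exact: mpull_decomposition.
rewrite mulr_sumr; apply: ler_sum => k _; apply: mpull_lognorm' => i.
by have [mC _ _] := Cd i.
Qed.

End Norms.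
End Transport.

(** * Transport of embeddings *)

Section MpullComplex.
Variables (G H : groupType) (L1 L2 : comPzRingType).
Variables (a : ringAction G L1) (b : ringAction H L2) (c : coupling a b).
Variables (F : unitfam a (pull c 1)) (D : augComplex b).
Local Notation T := (theta_rep F).

Lemma mpull_bd_bd k (u : mpull T (ac_mod D k.+2)) :
  mmap (ac_bd D k) (mmap (ac_bd D k.+1) u) = 0.
Proof. by apply/mpullP => i; rewrite !mmapE ac_bd_bd mpull0E. Qed.

Lemma mpull_aug_bd (u : mpull T (ac_mod D 1%N)) :
  maug (ac_aug D) (mmap (ac_bd D 0%N) u) = 0.
Proof.
by rewrite /maug big1 // => i _; rewrite mmapE ac_aug_bd pull0 crossed_actr0.
Qed.

Definition mpull_complex : augComplex a :=
  @AugComplex G L1 a (fun k => mpull T (ac_mod D k)) (fun k => mmap (ac_bd D k))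
    (maug (ac_aug D)) mpull_bd_bd (maugD (@ac_augD _ _ _ D))
    (maugZ (@ac_augD _ _ _ D) (@ac_augZ _ _ _ D))
    (maug_surj F (@ac_augD _ _ _ D) (@ac_augZ _ _ _ D) (@ac_aug_surj _ _ _ D)) mpull_aug_bd.

Lemma mpull_resolution : is_resolution D -> is_resolution mpull_complex.
Proof.
move=> [ex0 exS]; split; last by move=> k; apply: mmap_exact; exact: exS.
move=> u u0.
(* By [push_act_maug], the vanishing of [maug] on [u] puts every component of [u] into the kernel of
   the augmentation of [D]. *)
have /choice[v vE] : forall i, exists y, ac_bd D 0%N y = u i.
  move=> i; apply: ex0.
  by rewrite -(push_act_maug (@ac_augD _ _ _ D) (@ac_augZ _ _ _ D))
    (u0 : maug (ac_aug D) u = 0) crossed_actr0 push0.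
exists (mpull_mk (t := T) 1 [ffun i => v i]); apply/mpullP => i.
rewrite mmapE mpull_mkE linear_sum -[RHS]mpull1E.
by apply: eq_bigr => j _; rewrite linearZ ffunE vE.
Qed.

End MpullComplex.

Section StepComplex.
Variables (R : realType) (d : measure_display) (X : measurableType d).
Variables (mu : probability X R) (G : groupType) (a : standardAction mu G).
Variables (Z : normedCoeff R) (fb : finite_balls Z).
Variable E : augComplex (trivial_ringAction G Z).

Lemma step_bd_bd k (x : smod a fb (ac_mod E k.+2)) :
  smap (ac_bd E k) (smap (ac_bd E k.+1) x) = 0.
Proof.
apply: steps_ext.
apply: filterS3 (repr_smap (ac_bd E k) (smap (a := a) (fb := fb) (ac_bd E k.+1) x))
  (repr_smap (ac_bd E k.+1) x) (repr_steps0 mu (ac_mod E k)) => p -> -> ->.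
exact: ac_bd_bd.
Qed.

Definition step_complex : augComplex (Linf_action a Z) :=
  @AugComplex G (Linf mu Z) (Linf_action a Z) (fun k => smod a fb (ac_mod E k))
    (fun k => smap (ac_bd E k)) (saug (fb := fb) (ac_aug E)) step_bd_bd
    (saugD (@ac_augD _ _ _ E)) (saugZ (@ac_augD _ _ _ E) (@ac_augZ _ _ _ E))
    (saug_surj a fb (@ac_aug_surj _ _ _ E)) (saug_smap (@ac_aug_bd _ _ _ E)).

Lemma step_resolution : is_resolution E -> is_resolution step_complex.
Proof.
move=> [ex0 exS]; split; first exact: saug_exact.
by move=> k; apply: smap_exact; exact: exS.
Qed.

End StepComplex.

Section Embedding.
Variables (R : realType) (d d' : measure_display) (X : measurableType d) (Y : measurableType d').
Variables (mu : probability X R) (nu : probability Y R) (G H : groupType).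
Variables (al : standardAction mu G) (be : standardAction nu H).
Variables (A : set X) (B : set Y) (phi : X -> Y) (psi : Y -> X) (c : R).
Hypothesis oe : oe_data al be A B phi psi c.
Variables (cvA : transl_cover al A) (cvB : transl_cover be B).
Variables (Z : normedCoeff R) (fb : finite_balls Z) (n : nat).
Variables (C : augComplex (trivial_ringAction G Z)) (E : augComplex (trivial_ringAction H Z)).
Hypothesis fC : forall k, free_module (ac_mod C k).
Hypothesis rE : is_resolution E.

Local Notation F := (oe_famA oe cvA Z).
Local Notation T := (theta_rep F).

(** Replaced by 0 above degree n + 1, the maps are semilinear in all degrees, so [step_map_lin]
    applies to each of them. *)
Lemma embedding_total (D : augComplex (Linf_action be Z)) f :
  @is_embedding _ _ _ _ _ be Z n E D f ->
  exists g : forall k, ac_mod E k -> ac_mod D k,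
  [/\ forall k x y, g k (x + y) = g k x + g k y,
      forall k r x, g k (r *: x) = const_crossed be r *: g k x,
      forall k, (k <= n)%N -> forall x, g k (ac_bd E k x) = ac_bd D k (g k.+1 x) &
      forall x, ac_aug D (g 0%N x) = Linf_cst nu (ac_aug E x)].
Proof.
move=> [fD fZ fbd faug].
exists (fun k x => if (k <= n.+1)%N then f k x else 0); split => //.
- by move=> k x y; case: ifP => kn; rewrite ?fD ?addr0.
- by move=> k r x; case: ifP => kn; rewrite ?fZ ?scaler0.
- by move=> k kn x; rewrite ltnS kn (leqW kn) fbd.
Qed.

(** C is lifted to the pull-back of the step functions with values in [E], a resolution, and then
    sent on to the pull-back of [D] by the extension of [g] to step functions. Both maps are
    compatible with the augmentations. *)
Lemma mpull_embedding (D : augComplex (Linf_action be Z)) f :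
  @is_embedding _ _ _ _ _ be Z n E D f ->
  exists g, @is_embedding _ _ _ _ _ al Z n C (mpull_complex F D) g.
Proof.
move=> /embedding_total[g [gD gZ gbd gaug]].
pose W := mpull_complex F (step_complex be fb E).
have [h [hL hbd haug]] := free_chain_lift (@const_crossedD _ _ _ _ _ al Z)
  (@const_crossedM _ _ _ _ _ al Z) (@Linf_cstD _ _ _ mu Z) (@const_crossed_act _ _ _ _ _ al Z)
  fC (mpull_resolution F (step_resolution be fb rE)).
pose J k := step_map_lin fb (gD k) (gZ k).
exists (fun k x => mmap (J k) (h k x)); split.
- by move=> k _ x y; rewrite (proj1 (hL k)) linearD.
- by move=> k _ r x; rewrite (proj2 (hL k)) linearZ.
- move=> k kn x; rewrite hbd; apply/mpullP => i; rewrite !mmapE.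
  by apply: step_map_natural => e; exact: gbd.
- move=> x; rewrite -haug; apply: eq_bigr => i _; rewrite mmapE.
  congr (crossed_act _ (pull _ _)); apply: (saug_step_map (aug := ac_aug E)) => //.
  exact: ac_augZ.
Qed.

Definition mpull_marked (D : markedComplex be Z) : markedComplex al Z :=
  @MarkedComplex _ _ _ _ _ al Z (mpull_complex F D)
    (fun k => mpull_marking oe cvA cvB (mc_marking D k)).

Lemma mpull_class (D : markedComplex be Z) :
  embedding_class n E D -> embedding_class n C (mpull_marked D).
Proof. by move=> [f /mpull_embedding[g gP]]; exists g. Qed.

Lemma medim_le : (medim al n C <= c%:E * medim be n E)%E.
Proof.
rewrite -lee_pdivrMl ?(oe_c oe) //; apply: le_ereal_inf_tmp => _ [D [DE ->]].
rewrite lee_pdivrMl ?(oe_c oe) //; apply: ereal_inf_lbound.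
exists (mpull_marked D); split; first exact: mpull_class.
by rewrite -EFinM (mpull_dim oe cvA cvB) // => i; exact: mk_measurable.
Qed.

Lemma melognorm_le : coeff_norm (0 : Z) = 0 -> (melognorm al n C <= c%:E * melognorm be n E)%E.
Proof.
move=> norm0; rewrite -lee_pdivrMl ?(oe_c oe) //; apply: le_ereal_inf_tmp => _ [D [DE ->]].
rewrite lee_pdivrMl ?(oe_c oe) // -EFinM.
apply: (@le_trans _ _ (lognorm (mc_marking (mpull_marked D) n.+1)
  (mc_marking (mpull_marked D) n) (ac_bd (mpull_marked D) n))%:E).
  by apply: ereal_inf_lbound; exists (mpull_marked D); split => //; exact: mpull_class.
by rewrite lee_fin; exact: mpull_lognorm.
Qed.

End Embedding.

Lemma oe_data_of (R : realType) (d d' : measure_display) (X : measurableType d)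
    (Y : measurableType d') (mu : probability X R) (nu : probability Y R) (G H : groupType)
    (al : standardAction mu G) (be : standardAction nu H) (c : R) :
  weakly_bounded_OE al be c -> exists A B phi psi,
    [/\ oe_data al be A B phi psi c, cofinite al A & cofinite be B].
Proof.
move=> [A [B [phi [psi [[c0 cA cB] [mphi mpsi phP psP] [sc cE] fw bw]]]]].
have mA := proj1 cA; have mB := proj1 cB.
exists A, B, phi, psi; split => //; split => //.
- by move=> x /phP[].
- by move=> x /phP[].
- by move=> y /psP[].
- by move=> y /psP[].
- move=> S mS.
  (* A null set [A] would make the index 0; this allows cancelling the normalisation. *)
  have A0 : fine (mu A) != 0.
    by apply: contraTneq c0; rewrite cE => ->; rewrite mul0r ltxx.
  have mAS : measurable (A `&` phi @^-1` S) by exact: mphi.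
  have mBS : measurable (B `&` S) by exact: measurableI.
  rewrite -[LHS]fineK ?fin_num_measure // -[X in (_ * X)%E]fineK ?fin_num_measure //.
  rewrite -EFinM; congr EFin; apply: (mulIf (invr_neq0 A0)).
  by rewrite [LHS](sc S mS) cE [RHS]mulrC !mulrA mulVf // mul1r mulrC.
- move=> g; have [F [fF HF]] := fw g.
  have [s us Fs] := finite_set_seq fF; exists s => //.
  by apply: filterS HF => x Hx Ax Agx; have [l Fl E] := Hx Ax Agx; exists l => //; exact: Fs.
- move=> h; have [F [fF HF]] := bw h.
  have [s us Fs] := finite_set_seq fF; exists s => //.
  by apply: filterS HF => x Hx Ax Agx; have [l Fl E] := Hx Ax Agx; exists l => //; exact: Fs.
Qed.

Lemma int_or_finField_balls (R : realType) (Z : normedCoeff R) :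
  int_or_finField Z -> finite_balls Z.
Proof.
case=> [|F] C; last exact: finite_finset.
pose m := Num.bound (Num.max C 0).
(* The list consists of the integers from -m to m - 1; as [m] strictly exceeds the radius, it
   contains the ball. *)
apply: (@sub_finite_set _ _ [set` [seq (k%:Z - m%:Z) | k <- iota 0 (m + m)]]) => [z|].
  move=> zC; have zm : (`|z| < m%:Z)%R.
    have {}zC : `|z|%:~R <= C := zC.
    by rewrite -(ltr_int R); apply: le_lt_trans zC _;
      rewrite (le_lt_trans _ (archi_boundP _)) // le_max lexx ?orbT.
  have [k kE] : exists k : nat, z + m%:Z = k%:Z.
    by exists (absz (z + m%:Z)); rewrite gez0_abs //; lia.
  apply/mapP; exists k; last by rewrite -kE addrK.
  by rewrite mem_iota; lia.
exact: finite_seq.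
Qed.

Local Open Scope ereal_scope.

Theorem theorem1p9 (R : realType) (dX dY : measure_display)
    (X : measurableType dX) (Y : measurableType dY)
    (mu : probability X R) (nu : probability Y R) (G L : groupType)
    (alpha : standardAction mu G) (beta : standardAction nu L)
    (n : nat) (c : R)
    (hG : type_FP G n.+1) (hL : type_FP L n.+1)
    (hOE : weakly_bounded_OE alpha beta c) :
  (forall Z : normedCoeff R, int_or_finField Z ->
   forall (C : augComplex (trivial_ringAction G Z))
          (E : augComplex (trivial_ringAction L Z)),
     is_free_resolution C -> is_free_resolution E ->
     medim alpha n C = c%:E * medim beta n E)
  /\
  (forall (C : augComplex (trivial_ringAction G int))
          (E : augComplex (trivial_ringAction L int)),
     is_free_resolution C -> is_free_resolution E ->
     mevol alpha n C = c%:E * mevol beta n E).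
Proof.
have [A [B [phi [psi [oe /cofinite_cover[cvA] /cofinite_cover[cvB]]]]]] := oe_data_of hOE.
have c0 := oe_c oe.
split=> [Z /int_or_finField_balls fb|] C E [rC fC] [rE fE].
  apply/le_anti/andP; split; first exact: (medim_le oe cvA cvB fb n fC rE).
  (* The reverse inequality is the same lemma for the inverse equivalence, of index 1/c. *)
  by rewrite -lee_pdivlMl //; exact: (medim_le (oe_sym oe) cvB cvA fb n fE rC).
have fb := int_or_finField_balls (is_int_coeff R).
have norm0 : coeff_norm (0 : int_coeff R) = 0%R by rewrite /= normr0.
apply/le_anti/andP; split; first exact: (melognorm_le oe cvA cvB fb n fC rE norm0).
by rewrite -lee_pdivlMl //; exact: (melognorm_le (oe_sym oe) cvB cvA fb n fE rC norm0).
Qed.
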